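(* Let $V$ be a Probability Vector Field on $\mathcal{P}(\mathbb{R}^n)$ which is support sublinear and locally $\mathcal{W}$-Lipschitz, and let $T>0$. Then there exists a Lipschitz semigroup $S:[0,T]\times\mathcal{P}_c(\mathbb{R}^n)\to\mathcal{P}_c(\mathbb{R}^n)$ of solutions to $\dot\mu=V[\mu]$, obtained by passing to the limit in Lattice Approximate Solutions.
   Context: $T\mathbb{R}^n=\mathbb{R}^n\times\mathbb{R}^n$ with points $(x,v)$, $\pi_1(x,v)=x$, $\pi_{13}(x,v,y,w)=(x,y)$. $\mathcal{P}(X)$: Borel probability measures; $\mathcal{P}_c(X)$: those with compact support. $P(\mu,\nu)$ is the set of couplings (transference plans) of $\mu,\nu$; $W$ is the 1-Wasserstein metric on $\mathbb{R}^n$ and $P^{opt}(\mu,\nu)$ the set of couplings minimizing $\int|x-y|\,d\tau$. $B(0,R)$ is the ball of radius $R$ centered at $0$. A Probability Vector Field (PVF) is a map $V:\mathcal{P}(\mathbb{R}^n)\to\mathcal{P}(T\mathbb{R}^n)$ with $\pi_1\#V[\mu]=\mu$. It is support sublinear with constant $C>0$ if for every $\mu\in\mathcal{P}_c(\mathbb{R}^n)$: $\sup_{(x,v)\in \mathrm{Supp}(V[\mu])}|v|\le C(1+\sup_{x\in \mathrm{Supp}(\mu)}|x|)$. For $V_1,V_2\in\mathcal{P}_c(T\mathbb{R}^n)$ with $\mu_i=\pi_1\#V_i$, $$\mathcal{W}(V_1,V_2)=\inf\Big\{\int|v-w|\,dT(x,v,y,w): T\in P(V_1,V_2),\ \pi_{13}\#T\in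 P^{opt}(\mu_1,\mu_2)\Big\}.$$ $V$ is locally $\mathcal{W}$-Lipschitz if for every $R>0$ there is $K=K(R)>0$ with $\mathcal{W}(V[\mu],V[\nu])\le K\,W(\mu,\nu)$ whenever $\mathrm{Supp}(\mu),\mathrm{Supp}(\nu)\subset B(0,R)$. Solution: $\mu:[0,T]\to\mathcal{P}(\mathbb{R}^n)$ is a solution to $\dot\mu=V[\mu]$ if for every $f\in C_c^\infty(\mathbb{R}^n)$: $\int_{T\mathbb{R}^n}\nabla f(x)\cdot v\,dV[\mu(s)](x,v)$ is defined for a.e. $s$ and is $L^1$ in $s\in[0,T]$, $t\mapsto\int f\,d\mu(t)$ is absolutely continuous, and for a.e. $t$, $\frac{d}{dt}\int f\,d\mu(t)=\int_{T\mathbb{R}^n}\nabla f(x)\cdot v\,dV[\mu(t)](x,v)$. Lipschitz semigroup for $\dot\mu=V[\mu]$: a map $S:[0,T]\times\mathcal{P}_c(\mathbb{R}^n)\to\mathcal{P}_c(\mathbb{R}^n)$ such that for all $\mu,\nu\in\mathcal{P}_c(\mathbb{R}^n)$ and $t,s\in[0,T]$: (i) $S_0\mu=\mu$ and $S_tS_s\mu=S_{t+s}\mu$ (when $t+s\le T$); (ii) $t\mapsto S_t\mu$ is a solution to $\dot\mu=V[\mu]$; (iii) for every $R>0$ there is $C(R)>0$ such that if $\mathrm{Supp}(\mu),\mathrm{Supp}(\nu)\subset B(0,R)$ then $\mathrm{Supp}(S_t\mu)\subset B(0,e^{Ct}(R+1))$ (with $C$ the support-sublinearity constant), $W(S_t\mu,S_t\nu)\le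 e^{C(R)t}W(\mu,\nu)$, and $W(S_t\mu,S_s\mu)\le C(R)|t-s|$. Lattice Approximate Solutions (LAS) with initial datum $\mu_0\in\mathcal{P}_c(\mathbb{R}^n)$: for $N\in\mathbb{N}$ let $\Delta_N=1/N$, let $x_i$ be the points of $(\mathbb{Z}^n/N^2)\cap[-N,N]^n$ and $v_j$ the points of $(\mathbb{Z}^n/N)\cap[-N,N]^n$. Set $\mu^N_0=\sum_i\mu_0(x_i+[0,N^{-2})^n)\,\delta_{x_i}$. Recursively, given $\mu^N_\ell$ supported on the points $x_i$, put $m_{ij}=V[\mu^N_\ell](\{(x_i,v): v\in v_j+[0,N^{-1})^n\})$ and, for $t\in[0,\Delta_N]$, $\mu^N(\ell\Delta_N+t)=\sum_{i,j}m_{ij}\,\delta_{x_i+t v_j}$, with $\mu^N_{\ell+1}=\mu^N((\ell+1)\Delta_N)$. This is considered for $N$ large enough that all mass stays within the grids on $[0,T]$. ''Obtained by passing to the limit in LASs'' means that each trajectory $t\mapsto S_t\mu_0$ is a limit, uniform on $[0,T]$ for $W$, of (a subsequence of) the LASs with initial datum $\mu_0$. *)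

(* Defs.v *)
From HB Require Import structures.
From mathcomp Require Import all_boot all_order all_algebra.
From mathcomp Require Import all_classical all_reals all_analysis.

Set Implicit Arguments.
Unset Strict Implicit.
Unset Printing Implicit Defensive.

Import Order.TTheory GRing.Theory Num.Theory.
Import numFieldNormedType.Exports.

Local Open Scope classical_set_scope.
Local Open Scope ring_scope.

(* R^n is 'rV[R]_n with its Borel sigma-algebra. TR^n and products of it carry
   the library's product sigma-algebra, which is the Borel one since these
   spaces are second countable. *)
HB.instance Definition _ (R : realType) (m n : nat) :=
  @isMeasurable.Build (sigma_display (@open 'M[R]_(m, n))) 'M[R]_(m, n)
    <<s @open 'M[R]_(m, n) >>
    (@sigma_algebra0 _ setT _) (@sigma_algebraC _ _)
    (@sigma_algebra_bigcup _ setT _).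

Section Euclidean.
Variables (R : realType) (n : nat).
Implicit Types u v x : 'rV[R]_n.

Definition dotp u v : R := \sum_(k < n) u ord0 k * v ord0 k.

(* The library norm `|v| on 'rV[R]_n is the sup norm. *)
Definition enorm v : R := Num.sqrt (dotp v v).

Definition eball (r : R) : set 'rV[R]_n := [set x | enorm x < r].

Definition basisv (k : 'I_n) : 'rV[R]_n := delta_mx ord0 k.

Definition grad (f : 'rV[R]_n -> R) x : 'rV[R]_n := \row_k 'D_(basisv k) f x.

Definition iter_partial (s : seq 'I_n) (f : 'rV[R]_n -> R) : 'rV[R]_n -> R :=
  foldr (fun k g => 'D_(basisv k) g) f s.

Definition smooth (f : 'rV[R]_n -> R) : Prop :=
  forall s : seq 'I_n, continuous (iter_partial s f) /\
    forall k x, derivable (iter_partial s f) x (basisv k).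

Definition test_function (f : 'rV[R]_n -> R) : Prop :=
  smooth f /\ compact (closure [set x | f x != 0]).

Definition grid (M N : nat) : set 'rV[R]_n :=
  [set x | forall k, (exists z : int, x ord0 k = z%:~R / M%:R) /\
                     `|x ord0 k| <= N%:R].

Definition cell x (h : R) : set 'rV[R]_n :=
  [set y | forall k, x ord0 k <= y ord0 k < x ord0 k + h].

End Euclidean.

Definition abs_continuous (R : realType) (a b : R) (f : R -> R) : Prop :=
  forall e : R, 0 < e -> exists2 d : R, 0 < d &
    forall (m : nat) (p q : 'I_m -> R),
      (forall i, a <= p i <= q i /\ q i <= b) ->
      trivIset setT (fun i => `]p i, q i[%classic) ->
      \sum_(i < m) (q i - p i) < d ->
      \sum_(i < m) `|f (q i) - f (p i)| < e.

Section Measures.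
Local Open Scope ereal_scope.
Variable R : realType.

Definition supp (X : topologicalType) (m : set X -> \bar R) : set X :=
  [set x | forall U, open U -> U x -> 0 < m U].

(* A library measure is a function on all sets, of which only the values on
   measurable sets are meaningful. Measures are therefore compared with
   meas_eq and not with Leibniz equality. *)
Definition meas_eq d (X : measurableType d) (m1 m2 : set X -> \bar R) : Prop :=
  forall A, measurable A -> m1 A = m2 A.

Definition coupling d (X : measurableType d) (mu nu : set X -> \bar R)
    (tau : probability (X * X)%type R) : Prop :=
  meas_eq (pushforward tau fst) mu /\ meas_eq (pushforward tau snd) nu.

Variable n : nat.
Notation E := 'rV[R]_n.
Notation TE := (E * E)%type.

Definition transport_cost (tau : probability (E * E)%type R) : \bar R :=
  \int[tau]_z (enorm (z.1 - z.2))%:E.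

Definition W1 (mu nu : set E -> \bar R) : \bar R :=
  ereal_inf [set transport_cost tau | tau in [set tau | coupling mu nu tau]].

Definition opt_coupling (mu nu : set E -> \bar R)
    (tau : probability (E * E)%type R) : Prop :=
  coupling mu nu tau /\
  forall tau', coupling mu nu tau' -> transport_cost tau <= transport_cost tau'.

Definition pi13 (z : TE * TE) : E * E := (z.1.1, z.2.1).

(* The base marginals mu_i are the pushforwards of V_i by the first
   projection. *)
Definition calW (V1 V2 : probability TE R) : \bar R :=
  ereal_inf
    [set \int[T]_z (enorm (z.1.2 - z.2.2))%:E | T in
      [set T : probability (TE * TE)%type R | coupling V1 V2 T /\
        exists2 tau, opt_coupling (pushforward V1 fst) (pushforward V2 fst) tau
                   & meas_eq (pushforward T pi13) tau]].

Definition compactly_supported (mu : probability E R) : Prop :=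
  compact (supp mu).

Definition PVF (V : probability E R -> probability TE R) : Prop :=
  forall mu, meas_eq (pushforward (V mu) fst) mu.

Definition support_sublinear (C : R)
    (V : probability E R -> probability TE R) : Prop :=
  forall mu, compactly_supported mu ->
    ereal_sup [set (enorm z.2)%:E | z in supp (V mu)] <=
    C%:E * (1 + ereal_sup [set (enorm x)%:E | x in supp mu]).

Definition locally_calW_lipschitz
    (V : probability E R -> probability TE R) : Prop :=
  forall r : R, (0 < r)%R -> exists2 K : R, (0 < K)%R &
    forall mu nu : probability E R,
      supp mu `<=` eball r -> supp nu `<=` eball r ->
      calW (V mu) (V nu) <= K%:E * W1 mu nu.

Section Equation.
Variables (V : probability E R -> probability TE R) (T : R).

Definition transport_term (f : E -> R) (z : TE) : R := dotp (grad f z.1) z.2.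

(* Only the values of mu on [0, T] matter. *)
Definition is_solution (mu : R -> probability E R) : Prop :=
  forall f : E -> R, test_function f ->
  [/\ \forall s \ae @lebesgue_measure R, s \in `[0%R, T] ->
        (V (mu s)).-integrable setT (EFin \o transport_term f),
      (@lebesgue_measure R).-integrable `[0%R, T]
        (fun s => \int[V (mu s)]_z (transport_term f z)%:E),
      abs_continuous 0%R T (fun t => (\int[mu t]_x f x)%R)
    & \forall t \ae @lebesgue_measure R, t \in `[0%R, T] ->
        is_derive t (1 : R)%R (fun t => (\int[mu t]_x f x)%R)
          (\int[V (mu t)]_z transport_term f z)%R].

(* C is the support-sublinearity constant of V. Only the values of S at times
   in [0, T] and compactly supported measures matter. *)
Definition lipschitz_semigroup (C : R)
    (S : R -> probability E R -> probability E R) : Prop :=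
  [/\ forall t mu, t \in `[0%R, T] -> compactly_supported mu ->
        compactly_supported (S t mu),
      forall mu, compactly_supported mu -> meas_eq (S 0%R mu) mu /\
        forall t s, t \in `[0%R, T] -> s \in `[0%R, T] -> (t + s <= T)%R ->
          meas_eq (S t (S s mu)) (S (t + s)%R mu),
      forall mu, compactly_supported mu -> is_solution (fun t => S t mu)
    & forall r : R, (0 < r)%R -> exists2 L : R, (0 < L)%R &
        forall mu nu, compactly_supported mu -> compactly_supported nu ->
          supp mu `<=` eball r -> supp nu `<=` eball r ->
          forall t s, t \in `[0%R, T] -> s \in `[0%R, T] ->
          [/\ supp (S t mu) `<=` eball (expR (C * t) * (r + 1))%R,
              W1 (S t mu) (S t nu) <= (expR (L * t))%:E * W1 mu nu
            & W1 (S t mu) (S s mu) <= (L * `|t - s|)%:E]].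

(* m is, on [0, T], the lattice approximate solution of order N with initial
   datum mu0. That m takes values in probability measures expresses that all
   mass stays within the grids, without which the sums below would have total
   mass smaller than 1. *)
Definition is_LAS (N : nat) (mu0 : probability E R)
    (m : R -> probability E R) : Prop :=
  [/\ (0 < N)%N,
      meas_eq (m 0%R) (fun A =>
        \sum_(x \in grid (N ^ 2) N)
          mu0 (cell x (N%:R ^- 2)) * \d_x A)
    & forall (l : nat) (t : R), (0 <= t <= N%:R^-1)%R ->
        (l%:R / N%:R + t <= T)%R ->
        meas_eq (m (l%:R / N%:R + t)%R) (fun A =>
          \sum_(x \in grid (N ^ 2) N) \sum_(v \in grid N N)
            V (m (l%:R / N%:R)%R) ([set x] `*` cell v N%:R^-1) *
            \d_(x + t *: v)%R A)].

(* Uniform convergence on [0, T] of a subsequence of the lattice approximate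
   solutions with initial datum mu0. *)
Definition is_LAS_limit (mu0 : probability E R)
    (mu : R -> probability E R) : Prop :=
  exists (N : nat -> nat) (m : nat -> R -> probability E R),
  [/\ {homo N : i j / (i < j)%N},
      forall i, is_LAS (N i) mu0 (m i)
    & forall e : R, (0 < e)%R -> \forall i \near \oo,
        forall t, t \in `[0%R, T] -> W1 (m i t) (mu t) <= e%:E].

End Equation.
End Measures.

(* Main.v *)
(** The lattice approximate solutions are the iterates of an Euler step
    [euler N t], the law of [x + t * v] under [V mu] with [v] rounded to the
    lattice. A nearly optimal plan for [calW] shows that a step turns a distance
    [a] in [W1] into at most [(1 + K t) a + 2 t n / N], and a discrete Gronwall
    argument makes the approximations stable uniformly in [N]. Fix a
    nonprincipal ultrafilter on the integers [N]. Measures on a fixed ball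
    converge in [W1] along it, which defines the flow at once for all data and
    times; supports, stability and the semigroup property pass to the limit.
    A Taylor expansion of one step gives
    [\int f d(S_h mu) = \int f d mu + h * Phi mu + O(h ^ 2)], where
    [Phi mu = \int grad f(x) . v d(V mu)] is Lipschitz in [W1], so [S_t mu] is a
    solution. Finally, being within [e] of the flow uniformly on [[0, T]] holds
    on a set of the ultrafilter, hence for arbitrarily large [N], and a
    subsequence converges uniformly. *)
Require Import Defs.
From HB Require Import structures.
From mathcomp Require Import all_boot all_order all_algebra.
From mathcomp Require Import all_classical all_reals all_analysis.
From mathcomp Require Import measurable_realfun ring lra zify.

Set Implicit Arguments.
Unset Strict Implicit.
Unset Printing Implicit Defensive.

Import Order.TTheory GRing.Theory Num.Theory.
Import numFieldNormedType.Exports.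

Local Open Scope classical_set_scope.
Local Open Scope ring_scope.

(** * Euclidean norm and Borel sets *)

Section Euclid.
Variables (R : realType) (n : nat).
Implicit Types u v x : 'rV[R]_n.

(** Three facts carry the estimates. The infimum in [calW] runs over plans whose base marginal is
    optimal, so a single plan bounds both the displacement of positions and the difference of
    velocities. Positions are rounded once, at the start; afterwards only velocities are, and their
    error of order [1 / N] is multiplied by the time step, so that the errors add up to [O(1 / N)]
    on [[0, T]]. Finally, the two measure-theoretic constructions, composing plans and producing
    limits, both rest on countable labels: laws that give every label the same mass are coupled by
    an explicit density with respect to their product, and the loss is small when the labels are
    fine. This takes the place of disintegration and of tightness arguments. *)

Lemma enorm_ge0 v : 0 <= enorm v.
Proof. exact: sqrtr_ge0. Qed.

Lemma dotp_ge0 v : 0 <= dotp v v.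
Proof. by apply: sumr_ge0 => k _; rewrite -expr2 sqr_ge0. Qed.

Lemma sqr_enorm v : enorm v ^+ 2 = dotp v v.
Proof. by rewrite sqr_sqrtr ?dotp_ge0. Qed.

Lemma dotpC u v : dotp u v = dotp v u.
Proof. by apply: eq_bigr => k _; rewrite mulrC. Qed.

Lemma dotpDl u v w : dotp (u + v) w = dotp u w + dotp v w.
Proof. by rewrite -big_split; apply: eq_bigr => k _; rewrite mxE mulrDl. Qed.

Lemma dotpZl a u w : dotp (a *: u) w = a * dotp u w.
Proof. by rewrite mulr_sumr; apply: eq_bigr => k _; rewrite mxE mulrA. Qed.

Lemma dotpDr u v w : dotp w (u + v) = dotp w u + dotp w v.
Proof. by rewrite dotpC dotpDl !(dotpC w). Qed.

Lemma dotpZr a u w : dotp w (a *: u) = a * dotp w u.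
Proof. by rewrite dotpC dotpZl dotpC. Qed.

Lemma dotpBl u v w : dotp (u - v) w = dotp u w - dotp v w.
Proof. by rewrite -scaleN1r dotpDl dotpZl mulN1r. Qed.

Lemma dotpBr u v w : dotp w (u - v) = dotp w u - dotp w v.
Proof. by rewrite dotpC dotpBl !(dotpC w). Qed.

Lemma cauchy_schwarz u v : `|dotp u v| <= enorm u * enorm v.
Proof.
rewrite -[leLHS]ger0_norm// -[leRHS]ger0_norm ?mulr_ge0 ?enorm_ge0//.
rewrite -ler_sqr ?nnegrE// ?normr_ge0// !real_normK ?num_real//.
rewrite exprMn !sqr_enorm.
have h t : 0 <= dotp u u - (2 * t) * dotp u v + t ^+ 2 * dotp v v.
  have := dotp_ge0 (u - t *: v).
  rewrite dotpBl !dotpBr dotpZl !dotpZr dotpZl (dotpC v u); nra.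
have [v0|v0] := eqVneq (dotp v v) 0.
  suff -> : dotp u v = 0 by rewrite v0 mulr0 expr0n.
  have vk k : v ord0 k = 0.
    move/eqP : v0; rewrite psumr_eq0; last by move=> i _; rewrite -expr2 sqr_ge0.
    by move=> /allP/(_ k); rewrite mem_index_enum => /(_ isT)/=; rewrite mulf_eq0 orbb => /eqP.
  by apply: big1 => k _; rewrite vk mulr0.
have vp : 0 < dotp v v by rewrite lt_def v0 dotp_ge0.
(* The quadratic [h] is evaluated at its minimum. *)
have := h (dotp u v / dotp v v).
set a := dotp u u; set b := dotp u v; set c := dotp v v.
have -> : a - 2 * (b / c) * b + (b / c) ^+ 2 * c = a - b ^+ 2 / c by field.
by rewrite subr_ge0 ler_pdivrMr.
Qed.

Lemma enormD u v : enorm (u + v) <= enorm u + enorm v.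
Proof.
rewrite -ler_sqr ?nnegrE ?addr_ge0 ?enorm_ge0// sqr_enorm dotpDl !dotpDr (dotpC v u).
rewrite sqrrD !sqr_enorm.
have := le_trans (ler_norm _) (cauchy_schwarz u v); lra.
Qed.

Lemma enormZ a v : enorm (a *: v) = `|a| * enorm v.
Proof.
by rewrite /enorm dotpZl dotpZr mulrA -expr2 sqrtrM ?sqr_ge0// sqrtr_sqr.
Qed.

Lemma enormN v : enorm (- v) = enorm v.
Proof. by rewrite -scaleN1r enormZ normrN1 mul1r. Qed.

Lemma enorm0 : enorm (0 : 'rV[R]_n) = 0.
Proof. by rewrite -(scale0r 0) enormZ normr0 mul0r. Qed.

Lemma enorm_distC u v : enorm (u - v) = enorm (v - u).
Proof. by rewrite -enormN opprB. Qed.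

Lemma enorm_triangle u v w : enorm (u - w) <= enorm (u - v) + enorm (v - w).
Proof. by rewrite -(subrKA v) enormD. Qed.

Lemma enorm_coord v k : `|v ord0 k| <= enorm v.
Proof.
rewrite -ler_sqr ?nnegrE ?enorm_ge0// sqr_enorm real_normK ?num_real//.
rewrite /dotp (bigD1 k)//= -expr2 lerDl.
by apply: sumr_ge0 => i _; rewrite -expr2 sqr_ge0.
Qed.

Lemma enorm_le_sum v : enorm v <= \sum_(k < n) `|v ord0 k|.
Proof.
rewrite -ler_sqr ?nnegrE ?enorm_ge0 ?sumr_ge0// sqr_enorm /dotp.
suff [] : 0 <= \sum_(k < n) `|v ord0 k| /\ \sum_(k < n) v ord0 k * v ord0 k <= (\sum_(k < n) `|v ord0 k|) ^+ 2 by [].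
elim/big_rec2: _ => [|i y x _ [x0 h]]; first by rewrite expr0n.
split; first by rewrite addr_ge0.
rewrite sqrrD real_normK ?num_real// -expr2.
have := mulr_ge0 (normr_ge0 (v ord0 i)) x0; lra.
Qed.

Lemma enorm_le_coord v (c : R) : (forall k, `|v ord0 k| <= c) -> enorm v <= n%:R * c.
Proof.
move=> h; apply: (le_trans (enorm_le_sum v)).
apply: (le_trans (ler_sum _ (fun k _ => h k))).
by rewrite sumr_const card_ord mulr_natl.
Qed.

Lemma mxnorm_coord (v : 'rV[R]_n) k : `|v ord0 k| <= `|v|.
Proof.
rewrite [leRHS]mx_normrE.
exact: (le_bigmax _ (fun ij : 'I_1 * 'I_n => `|v ij.1 ij.2|) (ord0, k)).
Qed.

Lemma enorm_le_mxnorm v : enorm v <= n%:R * `|v|.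
Proof. by apply: enorm_le_coord => k; exact: mxnorm_coord. Qed.

Lemma mxnorm_le_enorm v : `|v| <= enorm v.
Proof.
rewrite [leLHS]mx_normrE; apply: bigmax_le; first exact: enorm_ge0.
by move=> [i k] _ /=; rewrite ord1; exact: enorm_coord.
Qed.

Lemma continuous_enorm : continuous (@enorm R n).
Proof.
move=> x; apply/(@cvgrPdist_lt _ _ _ (nbhs x)) => e e0.
near=> y.
apply: (@le_lt_trans _ _ (enorm (x - y))).
  rewrite ler_norml; apply/andP; split.
    have := enormD (y - x) x; rewrite subrK (enorm_distC y) ; lra.
  have := enormD (x - y) y; rewrite subrK; lra.
apply: (le_lt_trans (enorm_le_mxnorm _)).
have np : 0 < n%:R + 1 :> R by rewrite ltr_wpDl.
apply: (@le_lt_trans _ _ ((n%:R + 1) * `|x - y|)); first by rewrite ler_wpM2r// lerDl.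
rewrite mulrC -ltr_pdivlMr//; near: y.
by apply: (@cvgr_dist_lt _ _ _ (nbhs x) _ id) => //; rewrite divr_gt0.
Unshelve. all: by end_near. Qed.

Definition cball (r : R) : set 'rV[R]_n := [set x | enorm x <= r].

Lemma closed_cball r : closed (cball r).
Proof.
rewrite (_ : cball r = @enorm R n @^-1` [set x | x <= r])//.
by apply: closed_comp => [x _|]; [exact: continuous_enorm|exact: closed_le].
Qed.

Lemma compact_cball r : compact (cball r).
Proof.
apply: bounded_closed_compact; last exact: closed_cball.
exists r; split; first exact: num_real.
move=> M rM x /= xr; apply: le_trans (ltW rM); apply: le_trans xr.
exact: mxnorm_le_enorm.
Qed.

Lemma open_eball r : open (@eball R n r).
Proof.
rewrite (_ : eball r = @enorm R n @^-1` [set x | x < r])//.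
by apply: open_comp => [x _|]; [exact: continuous_enorm|exact: open_lt].
Qed.

End Euclid.

(** * Second countability, Borel sets and supports *)

Section Borel.
Variable R : realType.

Lemma basis_bigcup (T : topologicalType) (B : set (set T)) (U : set T) :
  basis B -> open U -> U = \bigcup_(A in [set A | B A /\ A `<=` U]) A.
Proof.
move=> [Bop Bnb] oU; apply/seteqP; split => [x Ux|x [A [BA AU] Ax]]; last exact: AU.
have [/= A [BA Ax] AU] := Bnb x U (open_nbhs_nbhs (conj oU Ux)).
by exists A.
Qed.

(** Balls of matrices are boxes, so membership is a finite conjunction over the entries;
    [measurable_mx] relies on this to get measurability from the coordinates. *)
Definition rbox m n (p : 'M[rat]_(m, n) * nat) : set 'M[R]_(m, n) :=
  ball (\matrix_(i, j) ratr (p.1 i j) : 'M[R]_(m, n)) (p.2.+1%:R^-1).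

Lemma basis_rbox m n : basis (range (@rbox m n)).
Proof.
split.
  move=> _ [[q k] _ <-]; exact: ball_open.
move=> x U /nbhs_ballP[e /= e0 xU].
have e20 : 0 < e / 2 by rewrite divr_gt0.
have [k ke] : exists k : nat, k.+1%:R^-1 < e / 2.
  have [k _ /(_ k (leqnn k)) ke] := near_infty_natSinv_lt (PosNum e20).
  by exists k.
have kp : 0 < k.+1%:R^-1 :> R by rewrite invr_gt0.
have hq (r d : R) : 0 < d -> exists q : rat, `|r - ratr q| < d.
  move=> d0; have xx : r - d < r + d by lra.
  have [q] := rat_in_itvoo xx; rewrite in_itv/= => /andP[q1 q2].
  by exists q; rewrite ltr_distlC; apply/andP; split; lra.
pose q := \matrix_(i, j) sval (cid (hq (x i j) _ kp)).
have xq : ball x (k.+1%:R^-1) (\matrix_(i, j) ratr (q i j) : 'M[R]_(m,n)).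
  by split => // i j; rewrite /ball/= !mxE; case: cid.
exists (rbox (q, k)) => /=.
  by split; [exists (q, k)|exact: ball_sym].
move=> y qy; apply: xU.
apply: (@le_ball _ _ _ (k.+1%:R^-1 + k.+1%:R^-1)).
  by rewrite [leRHS]splitr lerD// ltW.
exact: ball_triangle xq qy.
Qed.

Lemma countable_rbox m n : countable (range (@rbox m n)).
Proof. by apply: (card_le_trans (card_image_le _ _)); exact: countableP. Qed.

Lemma second_countable_mx m n : @second_countable 'M[R]_(m, n).
Proof. by exists (range (@rbox m n)); [exact: countable_rbox|exact: basis_rbox]. Qed.

Lemma basis_prod (T1 T2 : topologicalType) (B1 : set (set T1)) (B2 : set (set T2)) :
  basis B1 -> basis B2 -> basis [set A.1 `*` A.2 | A in B1 `*` B2].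
Proof.
move=> [op1 nb1] [op2 nb2]; split.
  move=> _ [[A1 A2] /= [/op1 oA1 /op2 oA2] <-]; rewrite openE => -[x y] [/= A1x A2y].
  by exists (A1, A2) => //=; split; apply: open_nbhs_nbhs.
move=> [x y] U [[U1 U2] /= [xU1 yU2] UU].
have [A1 /= [BA1 A1x] AU1] := nb1 x _ xU1.
have [A2 /= [BA2 A2x] AU2] := nb2 y _ yU2.
exists (A1 `*` A2) => /=; first by split => //; exists (A1, A2).
by move=> [a b] [/= ? ?]; apply: UU; split => /=; [exact: AU1|exact: AU2].
Qed.

Lemma countable_prod_sets (T1 T2 : Type) (B1 : set (set T1)) (B2 : set (set T2)) :
  countable B1 -> countable B2 -> countable [set A.1 `*` A.2 | A in B1 `*` B2].
Proof.
move=> cB1 cB2; apply: (card_le_trans (card_image_le _ _)); exact: countableX.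
Qed.

Lemma second_countable_prod (T1 T2 : topologicalType) :
  @second_countable T1 -> @second_countable T2 -> @second_countable (T1 * T2)%type.
Proof.
move=> [B1 cB1 bB1] [B2 cB2 bB2]; exists [set A.1 `*` A.2 | A in B1 `*` B2].
  exact: countable_prod_sets.
exact: basis_prod.
Qed.

Lemma open_measurable_mx m n (U : set 'M[R]_(m, n)) : open U -> measurable U.
Proof. exact: sub_sigma_algebra. Qed.

Lemma countable_bigcup_measurable d (T : measurableType d) (D : set (set T)) :
  countable D -> D `<=` measurable -> measurable (\bigcup_(A in D) A).
Proof.
move=> /pfcard_geP[->|[f]] mD; first by rewrite bigcup_set0.
rewrite -[D](image_eq f) bigcup_image; apply: bigcupT_measurable => k.
by apply: mD; exact: funS.
Qed.

(** By second countability an open set is a countable union of open rectangles. This makes the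
    complement of [supp (V mu)] measurable for the product sigma-algebra. *)
Lemma open_measurable_mx2 m n (U : set ('M[R]_(m, n) * 'M[R]_(m, n))) :
  open U -> measurable U.
Proof.
move=> oU; have [B cB bB] := @second_countable_mx m n.
rewrite (basis_bigcup (basis_prod bB bB) oU); apply: countable_bigcup_measurable.
  apply: (sub_countable _ (countable_prod_sets cB cB)).
  by apply: subset_card_le => A [].
move=> A [[[A1 A2] /= [BA1 BA2] <-] _].
by apply: measurableX; apply: open_measurable_mx; apply: bB.1.
Qed.

Lemma measurable_open_preimage d (T : measurableType d) m n (f : T -> 'M[R]_(m, n)) :
  (forall U, open U -> measurable (f @^-1` U)) -> measurable_fun setT f.
Proof.
move=> h; apply: (@measurability _ _ _ _ _ f (@open 'M[R]_(m,n))) => //.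
by move=> _ [U oU <-]; rewrite setTI; exact: h.
Qed.

Lemma measurable_open_preimageR d (T : measurableType d) (f : T -> R) :
  (forall U, open U -> measurable (f @^-1` U)) -> measurable_fun setT f.
Proof.
move=> h; apply: (measurability _ (RGenOpens.measurableE R)) => //.
move=> _ [_ [a [b ->] <-]]; rewrite setTI.
by apply: h; exact: interval_open.
Qed.

Lemma measurable_coord m n i j : measurable_fun setT (fun M : 'M[R]_(m, n) => M i j).
Proof.
apply: measurable_open_preimageR => U oU; apply: open_measurable_mx.
by apply: open_comp => // x _; exact: coord_continuous.
Qed.

Lemma measurable_mx d (T : measurableType d) m n (f : T -> 'M[R]_(m, n)) :
  (forall i j, measurable_fun setT (fun x => f x i j)) -> measurable_fun setT f.
Proof.
move=> mf; apply: measurable_open_preimage => U oU.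
rewrite (basis_bigcup (@basis_rbox m n) oU).
have -> : f @^-1` (\bigcup_(A in [set A | range (@rbox m n) A /\ A `<=` U]) A) =
    \bigcup_(B in [set f @^-1` A | A in [set A | range (@rbox m n) A /\ A `<=` U]]) B.
  by rewrite bigcup_image preimage_bigcup.
apply: countable_bigcup_measurable.
  apply: (card_le_trans (card_image_le _ _)).
  apply: (sub_countable _ (@countable_rbox m n)).
  by apply: subset_card_le => A [].
move=> _ [_ [[[q k] _ <-] _] <-].
rewrite (_ : _ @^-1` _ = \bigcap_(ij in [set: 'I_m * 'I_n])
   ((fun x => f x ij.1 ij.2) @^-1` ball (ratr (q ij.1 ij.2) : R) (k.+1%:R^-1))).
  apply: fin_bigcap_measurable; first exact: finite_finset.
  move=> -[i j] _ /=; rewrite -[X in measurable X]setTI; apply: mf => //.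
  by apply: open_measurable; exact: ball_open.
apply/seteqP; split => x /=.
  by move=> [_ fx] [i j] _ /=; have := fx i j; rewrite mxE.
move=> fx; split; first by rewrite invr_gt0.
by move=> i j; have := fx (i, j) I; rewrite /= mxE.
Qed.

Lemma continuous_measurable_mx m n (f : 'M[R]_(m, n) -> R) :
  continuous f -> measurable_fun setT f.
Proof.
move=> cf; apply: measurable_open_preimageR => U oU; apply: open_measurable_mx.
by apply: open_comp => // x _; exact: cf.
Qed.

Lemma closed_supp (T : topologicalType) (m : set T -> \bar R) : closed (supp m).
Proof.
rewrite -openC openE => x /=.
move=> /existsNP[U /not_implyP[oU /not_implyP[Ux mU]]].
apply: (filterS _ (open_nbhs_nbhs (conj oU Ux))) => y Uy.
by move=> /(_ U oU Uy).
Qed.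

Lemma negligible_countable_bigcup d (T : measurableType d) (P : {measure set T -> \bar R})
    (D : set (set T)) :
  countable D -> (forall A, D A -> measurable A /\ P A = 0%E) -> P (\bigcup_(A in D) A) = 0%E.
Proof.
move=> /pfcard_geP[->|[f]] mD; first by rewrite bigcup_set0 measure0.
have fm k : measurable (f k) /\ P (f k) = 0%E by apply: mD; exact: funS.
rewrite -[D](image_eq f) bigcup_image.
apply/negligibleP.
  by apply: bigcupT_measurable => k; exact: (fm k).1.
by apply: negligible_bigcup => k; apply/negligibleP; [exact: (fm k).1|exact: (fm k).2].
Qed.

(** Every point outside the support has a null basic neighbourhood, and there are countably many of
    these. The map [g] links a topological type to a measurable one; it is applied with [id] to a
    type that carries both structures. *)
Lemma supp_null (T : topologicalType) d (S : measurableType d) (g : S -> T)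
    (P : {measure set S -> \bar R}) (m : set T -> \bar R) :
  @second_countable T -> (forall U, open U -> measurable (g @^-1` U)) ->
  (forall U, open U -> m U = P (g @^-1` U)) ->
  P (g @^-1` (~` supp m)) = 0%E.
Proof.
move=> [B cB bB] mg gm.
have oS : open (~` supp m) by rewrite openC; exact: closed_supp.
have -> : ~` supp m = \bigcup_(A in [set A | B A /\ P (g @^-1` A) = 0%E]) A.
  apply/seteqP; split => [x /=|x [A [BA PA] Ax] /=].
    move=> /existsNP[U /not_implyP[oU /not_implyP[Ux mU]]].
    have [/= A [BA Ax] AU] := bB.2 x U (open_nbhs_nbhs (conj oU Ux)).
    exists A => //=; split => //.
    apply/eqP; rewrite eq_le measure_ge0 andbT leNgt; apply/negP => PA.
    apply: mU; rewrite gm//; apply: (lt_le_trans PA).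
    apply: le_measure; rewrite ?inE; [exact/mg/bB.1|exact: mg|].
    exact: preimage_subset.
  move=> /(_ A (bB.1 _ BA) Ax); rewrite gm ?PA ?ltxx//; exact: bB.1.
rewrite preimage_bigcup -(bigcup_image _ (fun A => g @^-1` A) id).
apply: negligible_countable_bigcup.
  apply: (card_le_trans (card_image_le _ _)).
  by apply: (sub_countable _ cB); apply: subset_card_le => A [].
by move=> _ [A [BA PA] <-]; split => //; apply: mg; exact: bB.1.
Qed.

End Borel.

(** * Measurable vector-valued maps and rounding *)

Section MeasurableMx.
Context (R : realType) (n : nat) d (T : measurableType d).
Implicit Types f g : T -> 'rV[R]_n.

Lemma measurable_mx_coord f i j : measurable_fun setT f -> measurable_fun setT (fun x => f x i j).
Proof. by move=> mf; apply: (@measurableT_comp _ _ _ _ _ _ (fun M : 'rV[R]_n => M i j)) => //; exact: measurable_coord. Qed.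

Lemma measurable_mxD f g : measurable_fun setT f -> measurable_fun setT g ->
  measurable_fun setT (fun x => f x + g x).
Proof.
move=> mf mg; apply: measurable_mx => i j; under eq_fun do rewrite mxE.
by apply: measurable_funD; exact: measurable_mx_coord.
Qed.

Lemma measurable_mxB f g : measurable_fun setT f -> measurable_fun setT g ->
  measurable_fun setT (fun x => f x - g x).
Proof.
move=> mf mg; apply: measurable_mx => i j; under eq_fun do rewrite !mxE.
by apply: measurable_funB; exact: measurable_mx_coord.
Qed.

Lemma measurable_mxZ (a : R) f : measurable_fun setT f ->
  measurable_fun setT (fun x => a *: f x).
Proof.
move=> mf; apply: measurable_mx => i j; under eq_fun do rewrite !mxE.
by apply: measurable_funM => //; exact: measurable_mx_coord.
Qed.

Lemma measurable_enorm f : measurable_fun setT f ->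
  measurable_fun setT (fun x => enorm (f x)).
Proof.
move=> mf; apply: (measurableT_comp _ mf).
by apply: continuous_measurable_mx; exact: continuous_enorm.
Qed.

Lemma measurable_dotp f g : measurable_fun setT f -> measurable_fun setT g ->
  measurable_fun setT (fun x => dotp (f x) (g x)).
Proof.
move=> mf mg; apply: measurable_sum => k.
by apply: measurable_funM; exact: measurable_mx_coord.
Qed.

(** Rounding down, so that the fibres over lattice points are the half-open cells of the scheme
    ([rnd_fiber]). *)
Definition rnd (M : nat) (x : 'rV[R]_n) : 'rV[R]_n :=
  \row_k ((Num.floor (x ord0 k * M%:R))%:~R / M%:R).

Lemma measurable_rnd M f : measurable_fun setT f ->
  measurable_fun setT (fun x => rnd M (f x)).
Proof.
move=> mf; apply: measurable_mx => i j.
rewrite (_ : (fun x => _) = (fun y : R => (Num.floor (y * M%:R))%:~R / M%:R) \o (fun x => f x ord0 j)); last first.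
  by apply/funext => x; rewrite mxE.
apply: measurableT_comp; last exact: measurable_mx_coord.
apply: nondecreasing_measurable => // x y xy.
by rewrite ler_wpM2r ?invr_ge0// ler_int; apply: le_floor; rewrite ler_wpM2r.
Qed.

End MeasurableMx.

Section Rnd.
Context (R : realType) (n : nat).
Implicit Types x : 'rV[R]_n.

Lemma rnd_err M x : (0 < M)%N -> enorm (x - rnd M x) <= n%:R / M%:R.
Proof.
move=> M0; apply: enorm_le_coord => k; rewrite !mxE.
have Mp : 0 < M%:R :> R by rewrite ltr0n.
have /andP[h1 h2] := floor_itv (x ord0 k * M%:R).
rewrite ger0_norm; last by rewrite subr_ge0 ler_pdivrMr.
rewrite lerBlDr -[X in X + _]mul1r -mulrDl ler_pdivlMr// addrC.
by move: h2; rewrite intrD => /ltW.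
Qed.

End Rnd.

Section Law.
Context (R : realType) d d' (T : measurableType d) (T' : measurableType d').
Variables (P : probability T R) (f : T -> T') (mf : measurable_fun setT f).

Definition law : probability T' R := distribution P (mfun_Sub (mem_set mf)).

Lemma lawE A : law A = P (f @^-1` A).
Proof. by []. Qed.

Lemma ge0_integral_law (g : T' -> \bar R) : measurable_fun setT g -> (forall y, 0 <= g y)%E ->
  (\int[law]_y g y = \int[P]_x g (f x))%E.
Proof. by move=> mg g0; rewrite ge0_integral_distribution. Qed.

End Law.

(** * Couplings and the Wasserstein distance *)

Section Density.
Local Open Scope ereal_scope.
Context d (T : measurableType d) (R : realType) (Q : {measure set T -> \bar R}).
Variables (w : T -> R) (mw : measurable_fun setT w) (w0 : forall x, (0 <= w x)%R).

(* [mw] and [w0] are arguments so that the measure instance below can be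
   inferred from the term. *)
Definition mdens (mw : measurable_fun setT w) (w0 : forall x, (0 <= w x)%R) (A : set T) : \bar R :=
  \int[Q]_(x in A) (w x)%:E.

Let mdens_set0 : mdens mw w0 set0 = 0.
Proof. by rewrite /mdens integral_set0. Qed.

Let mdens_ge0 A : 0 <= mdens mw w0 A.
Proof. by apply: integral_ge0 => x _; rewrite lee_fin. Qed.

Let mdens_sigma_additive : semi_sigma_additive (mdens mw w0).
Proof.
move=> /= F mF tF mUF; rewrite /mdens; apply: cvg_toP.
  apply: ereal_nondecreasing_is_cvgn => m n mn.
  apply: lee_sum_nneg_natr => // k _ _.
  by apply: integral_ge0 => /= x Fkx; rewrite lee_fin; exact: w0.
rewrite ge0_integral_bigcup//=; first exact/measurable_funTS/measurable_EFinP.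
by move=> x _; rewrite lee_fin.
Qed.

HB.instance Definition _ := isMeasure.Build _ _ _ (mdens mw w0)
  mdens_set0 mdens_ge0 mdens_sigma_additive.

End Density.

(** Normalizing by the mass 1 changes nothing and bundles [m] as a [probability]. The Dirac mass is
    the default value for zero or infinite mass, which does not occur. *)
Lemma exists_probability d (T : measurableType d) (R : realType) (m : {measure set T -> \bar R}) :
  m setT = 1%E -> {P : probability T R | forall A, P A = m A}.
Proof.
move=> m1; exists (mnormalize m (dirac point)) => A.
rewrite /= /mnormalize m1 onee_eq0/=.
by rewrite /= invr1 mule1.
Qed.

Lemma measurable_nat_preimage d (T : measurableType d) (f : T -> nat) (S : set nat) :
  (forall i, measurable (f @^-1` [set i])) -> measurable (f @^-1` S).
Proof.
move=> mf; rewrite (_ : f @^-1` S = \bigcup_(i in S) (f @^-1` [set i])); last first.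
  by rewrite -preimage_bigcup bigcup_imset1 image_id.
exact: bigcup_measurable.
Qed.

(** * Couplings along a common label *)

Section LabelCoupling.
Local Open Scope ereal_scope.
Context (R : realType) d d' (T : measurableType d) (T' : measurableType d').
Variables (P : probability T R) (P' : probability T' R) (A : T -> nat) (B : T' -> nat).
Hypotheses (mA : forall i, measurable (A @^-1` [set i])) (mB : forall i, measurable (B @^-1` [set i])).
Hypothesis AB : forall i, P (A @^-1` [set i]) = P' (B @^-1` [set i]).

Let p i := fine (P (A @^-1` [set i])).
Let D : set (T * T') := [set z | A z.1 = B z.2].

Let mpreA S : measurable (A @^-1` S).
Proof. exact: measurable_nat_preimage. Qed.

Let mpreB S : measurable (B @^-1` S).
Proof. exact: measurable_nat_preimage. Qed.

Let mD : measurable D.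
Proof.
rewrite (_ : D = \bigcup_i (A @^-1` [set i] `*` B @^-1` [set i])).
  by apply: bigcupT_measurable => i; exact: measurableX.
by apply/seteqP; split => [z /= Dz|[x y] [i _ /= [Ax Bx]]]; [by exists (A z.1)|rewrite /D/= Ax Bx].
Qed.

(** The block of label [i] has product mass [p i ^ 2], and the weight [1 / p i] leaves it the mass
    [p i]. When [p i = 0] the inverse is 0 by convention; [null1] and [null2] discard these
    labels. *)
Let w (z : T * T') : R := (\1_D z * (p (A z.1))^-1)%R.

Let w0 z : (0 <= w z)%R.
Proof. by rewrite mulr_ge0// ?invr_ge0 ?fine_ge0// indicE. Qed.

Let mw : measurable_fun setT w.
Proof.
apply: measurable_funM; first exact: measurable_indic.
apply: (@measurableT_comp _ _ _ _ _ _ (fun x => (p (A x))^-1)%R) => //.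
by move=> _ S mS; rewrite setTI (_ : _ @^-1` S = A @^-1` [set i | S ((p i)^-1)%R]).
Qed.

Let Q : probability (T * T')%type R := (P \x P').

Let pfin i : P (A @^-1` [set i]) = (p i)%:E.
Proof. by rewrite fineK// fin_num_measure. Qed.

Let null1 : P [set x | p (A x) = 0%R] = 0.
Proof.
rewrite (_ : [set x | _] = \bigcup_(S in [set A @^-1` [set i] | i in [set i | p i = 0%R]]) S).
  apply: negligible_countable_bigcup.
    by apply: (card_le_trans (card_image_le _ _)); exact: countableP.
  by move=> _ [i /= pi0 <-]; split => //; rewrite pfin pi0.
apply/seteqP; split => [x /= px|x [_ [i /= pi0 <-] /= ->]//].
by exists (A @^-1` [set A x]) => //; exists (A x).
Qed.

Let null2 : P' [set x | p (B x) = 0%R] = 0.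
Proof.
rewrite (_ : [set x | _] = \bigcup_(S in [set B @^-1` [set i] | i in [set i | p i = 0%R]]) S).
  apply: negligible_countable_bigcup.
    by apply: (card_le_trans (card_image_le _ _)); exact: countableP.
  by move=> _ [i /= pi0 <-]; split => //; rewrite -[LHS]AB pfin pi0.
apply/seteqP; split => [x /= px|x [_ [i /= pi0 <-] /= ->]//].
by exists (B @^-1` [set B x]) => //; exists (B x).
Qed.

Let mEw : measurable_fun setT (EFin \o w).
Proof. exact/measurable_EFinP. Qed.

(** Integrating out the second variable multiplies [h x] by [P' (B = A x) / p (A x)], which is 1
    unless [p (A x) = 0]. With [h] an indicator this identifies the first marginal. *)
Lemma integral_label_density1 (h : T -> \bar R) : measurable_fun setT h -> (forall x, 0 <= h x) ->
  \int[Q]_z (h z.1 * (w z)%:E) = \int[P]_x h x.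
Proof.
move=> mh h0.
have mhw : measurable_fun setT (fun z : T * T' => h z.1 * (w z)%:E).
  by apply: emeasurable_funM => //; exact: measurableT_comp.
have hw0 z : 0 <= h z.1 * (w z)%:E by rewrite mule_ge0// lee_fin.
rewrite fubini_tonelli1//=.
apply: ge0_ae_eq_integral => //.
- exact: measurable_fun_fubini_tonelli_F.
- by move=> x _; apply: integral_ge0 => y _; exact: hw0.
exists [set x | p (A x) = 0%R]; split => //.
  exact: (mpreA [set i | p i = 0%R]).
move=> x /= /not_implyP[_ hx]; apply: contrapT => /eqP px; apply: hx.
rewrite /fubini_F/= ge0_integralZl//=; first last.
- by move=> y _; rewrite lee_fin.
- by apply/measurable_EFinP; exact: (measurableT_comp mw (measurable_pair1 x)).
have -> : \int[P']_y (w (x, y))%:E = \int[P']_y ((p (A x))^-1%:E * (\1_(B @^-1` [set A x]) y)%:E).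
  apply: eq_integral => y _; rewrite /w /= mulrC EFinM; congr (_ * _%:E).
  rewrite !indicE; congr (nat_of_bool _)%:R.
  by apply/idP/idP; rewrite !inE /D/=.
rewrite ge0_integralZl//=; last 2 first.
- by apply/measurable_EFinP; exact: measurable_indic.
- by rewrite lee_fin invr_ge0 fine_ge0.
transitivity (h x * ((p (A x))^-1%:E * P' (B @^-1` [set A x]))).
  by congr (_ * (_ * _)); rewrite integral_indic// setIT.
by rewrite -AB pfin -EFinM mulVf// mule1.
Qed.

Lemma integral_label_density2 (h : T' -> \bar R) : measurable_fun setT h -> (forall x, 0 <= h x) ->
  \int[Q]_z (h z.2 * (w z)%:E) = \int[P']_x h x.
Proof.
move=> mh h0.
have mhw : measurable_fun setT (fun z : T * T' => h z.2 * (w z)%:E).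
  by apply: emeasurable_funM => //; exact: measurableT_comp.
have hw0 z : 0 <= h z.2 * (w z)%:E by rewrite mule_ge0// lee_fin.
rewrite fubini_tonelli2//=.
apply: ge0_ae_eq_integral => //.
- exact: measurable_fun_fubini_tonelli_G.
- by move=> x _; apply: integral_ge0 => y _; exact: hw0.
exists [set x | p (B x) = 0%R]; split => //.
  exact: (mpreB [set i | p i = 0%R]).
move=> y /= /not_implyP[_ hx]; apply: contrapT => /eqP px; apply: hx.
rewrite /fubini_G/= ge0_integralZl//=; first last.
- by move=> x _; rewrite lee_fin.
- by apply/measurable_EFinP; exact: (measurableT_comp mw (measurable_pair2 y)).
have -> : \int[P]_x (w (x, y))%:E = \int[P]_x ((p (B y))^-1%:E * (\1_(A @^-1` [set B y]) x)%:E).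
  apply: eq_integral => x _; rewrite /w /= mulrC -EFinM.
  have [ABe|AB'] := eqVneq (A x) (B y).
    by rewrite ABe !indicE; congr (_ * (nat_of_bool _)%:R)%:E; apply/idP/idP; rewrite !inE /D/=.
  have nD : (x, y) \notin D by apply/negP; rewrite inE /D/= => /eqP; apply/negP.
  rewrite !indicE (negbTE nD) memNset ?mulr0//=; exact/eqP.
rewrite ge0_integralZl//=; last 2 first.
- by apply/measurable_EFinP; exact: measurable_indic.
- by rewrite lee_fin invr_ge0 fine_ge0.
transitivity (h y * ((p (B y))^-1%:E * P (A @^-1` [set B y]))).
  by congr (_ * (_ * _)); rewrite integral_indic// setIT.
by rewrite pfin -EFinM mulVf// mule1.
Qed.

(* Conditionally on their common label the two components are independent. *)
Lemma exists_label_coupling : exists Z : probability (T * T')%type R,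
  [/\ meas_eq (pushforward Z fst) P, meas_eq (pushforward Z snd) P'
    & Z (~` [set z | A z.1 = B z.2]) = 0].
Proof.
have mdE S : measurable S -> mdens Q mw w0 S = \int[Q]_z ((\1_S z)%:E * (w z)%:E).
  move=> mS; rewrite /mdens integral_mkcond; apply: eq_integral => z _.
  by rewrite patchE indicE; case: ifPn; rewrite ?mul1e ?mul0e.
have m1 S : measurable S -> mdens Q mw w0 (fst @^-1` S) = P S.
  move=> mS; rewrite mdE; last by rewrite -[X in measurable X]setTI; exact: measurable_fst.
  transitivity (\int[P]_x (\1_S x)%:E); last by rewrite integral_indic// setIT.
  rewrite -(integral_label_density1 (h := fun x => (\1_S x)%:E))//.
  by apply/measurable_EFinP; exact: measurable_indic.
have m2 S : measurable S -> mdens Q mw w0 (snd @^-1` S) = P' S.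
  move=> mS; rewrite mdE; last by rewrite -[X in measurable X]setTI; exact: measurable_snd.
  transitivity (\int[P']_x (\1_S x)%:E); last by rewrite integral_indic// setIT.
  rewrite -(integral_label_density2 (h := fun x => (\1_S x)%:E))//.
  by apply/measurable_EFinP; exact: measurable_indic.
have mT : mdens Q mw w0 setT = 1 by rewrite -(preimage_setT fst) m1// probability_setT.
have [Z ZE] := exists_probability mT.
exists Z; split.
- by move=> S mS; rewrite /pushforward ZE; exact: m1.
- by move=> S mS; rewrite /pushforward ZE; exact: m2.
transitivity (mdens Q mw w0 (~` D)); [exact: ZE|rewrite mdE; last exact: measurableC].
apply: integral0_eq => z _; rewrite /w !indicE in_setC.
by case: (z \in D); rewrite ?mul0e// mul0r mule0.
Qed.

End LabelCoupling.

Section W1label.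
Local Open Scope ereal_scope.
Context (R : realType) (n : nat).
Notation E := 'rV[R]_n.
Implicit Types mu nu : probability E R.

Definition cost (z : E * E) : \bar R := (enorm (z.1 - z.2))%:E.

Lemma measurable_cost : measurable_fun setT cost.
Proof. by apply/measurable_EFinP/measurable_enorm/measurable_mxB. Qed.

Lemma cost_ge0 z : 0 <= cost z.
Proof. by rewrite lee_fin enorm_ge0. Qed.

Lemma W1_le (mu nu : set E -> \bar R) tau : coupling mu nu tau -> W1 mu nu <= transport_cost tau.
Proof. by move=> ct; apply: ereal_inf_lbound; exists tau. Qed.

Lemma W1_ge0 (mu nu : set E -> \bar R) : 0 <= W1 mu nu.
Proof.
apply: le_ereal_inf_tmp => _ [tau _ <-]; apply: integral_ge0 => z _; exact: cost_ge0.
Qed.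

Lemma W1_eq (mu nu mu' nu' : set E -> \bar R) :
  meas_eq mu mu' -> meas_eq nu nu' -> W1 mu nu = W1 mu' nu'.
Proof.
move=> m1 m2; rewrite /W1; congr ereal_inf; congr image; apply/seteqP.
by split => tau [h1 h2]; split => A mA; rewrite ?h1 ?h2 ?m1 ?m2.
Qed.

Lemma W1_joint d (T : measurableType d) (P : probability T R) (X Y : T -> E)
    (mX : measurable_fun setT X) (mY : measurable_fun setT Y) (mu nu : set E -> \bar R) :
  meas_eq (pushforward P X) mu -> meas_eq (pushforward P Y) nu ->
  W1 mu nu <= \int[P]_x (enorm (X x - Y x))%:E.
Proof.
move=> hX hY.
have mXY : measurable_fun setT (fun x => (X x, Y x)) by exact: measurable_fun_pair.
have -> : \int[P]_x (enorm (X x - Y x))%:E = transport_cost (law P mXY).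
  by rewrite /transport_cost (ge0_integral_law P mXY measurable_cost cost_ge0).
by apply: W1_le; split => A mA; [rewrite -hX|rewrite -hY].
Qed.

Lemma W1_witness (mu nu : set E -> \bar R) (c e : R) : W1 mu nu <= c%:E -> (0 < e)%R ->
  exists2 tau, coupling mu nu tau & transport_cost tau <= (c + e)%:E.
Proof.
move=> hW e0.
have hlt : W1 mu nu < (c + e)%:E by apply: (le_lt_trans hW); rewrite lte_fin ltrDl.
have [_ [tau ct <-] /ltW h] := ereal_inf_lt hlt.
by exists tau.
Qed.

(** The form in which labels are used: a pointwise bound on pairs with equal labels, split into a
    share for each side, is integrated against the two laws separately, so the joint law does not
    appear. It yields both the triangle inequality and the convergence in [ultra_limit_bound]. *)
Lemma label_coupling d d' (T : measurableType d) (T' : measurableType d')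
    (P : probability T R) (P' : probability T' R) (A : T -> nat) (B : T' -> nat)
    (X : T -> E) (Y : T' -> E) (f : T -> \bar R) (g : T' -> \bar R) (mu nu : set E -> \bar R) :
  (forall i, measurable (A @^-1` [set i])) -> (forall i, measurable (B @^-1` [set i])) ->
  (forall i, P (A @^-1` [set i]) = P' (B @^-1` [set i])) ->
  measurable_fun setT X -> measurable_fun setT Y ->
  meas_eq (pushforward P X) mu -> meas_eq (pushforward P' Y) nu ->
  measurable_fun setT f -> (forall x, 0 <= f x) ->
  measurable_fun setT g -> (forall x, 0 <= g x) ->
  (forall x y, A x = B y -> (enorm (X x - Y y))%:E <= f x + g y) ->
  W1 mu nu <= \int[P]_x f x + \int[P']_y g y.
Proof.
move=> mA mB AB mX mY hX hY mf f0 mg g0 fg.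
have [Z [Z1 Z2 ZD]] := exists_label_coupling mA mB AB.
have mX1 : measurable_fun setT (fun z : T * T' => X z.1) by exact: (measurableT_comp mX).
have mY2 : measurable_fun setT (fun z : T * T' => Y z.2) by exact: (measurableT_comp mY).
have hW : W1 mu nu <= \int[Z]_z (enorm (X z.1 - Y z.2))%:E.
  apply: (W1_joint mX1 mY2) => S mS.
    rewrite -hX// /pushforward -[RHS]Z1//.
    by rewrite -[X in measurable X]setTI; exact: mX.
  rewrite -hY// /pushforward -[RHS]Z2//.
  by rewrite -[X in measurable X]setTI; exact: mY.
apply: (le_trans hW).
have mf1 : measurable_fun setT (fun z : T * T' => f z.1) by exact: (measurableT_comp mf).
have mg2 : measurable_fun setT (fun z : T * T' => g z.2) by exact: (measurableT_comp mg).
apply: (@le_trans _ _ (\int[Z]_z (f z.1 + g z.2))).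
  apply: ae_ge0_le_integral => //.
  - by move=> z _; rewrite lee_fin enorm_ge0.
  - exact/measurable_EFinP/measurable_enorm/measurable_mxB.
  - by move=> z _; rewrite adde_ge0.
  - exact: emeasurable_funD.
  exists (~` [set z | A z.1 = B z.2]); split => //.
    apply: measurableC.
    rewrite (_ : [set z | _] = \bigcup_i (A @^-1` [set i] `*` B @^-1` [set i])).
      by apply: bigcupT_measurable => i; exact: measurableX.
    by apply/seteqP; split => [z /= Dz|[x y] [i _ /= [Ax Bx]]]; [by exists (A z.1)|rewrite Ax Bx].
  by move=> z /= /not_implyP[_ h] ABz; apply: h; exact: fg.
rewrite ge0_integralD//.
rewrite -(ge0_integral_law Z measurable_fst mf f0) -(ge0_integral_law Z measurable_snd mg g0).
rewrite (eq_measure_integral P); last by move=> S mS _; exact: Z1.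
by rewrite [X in _ + X](eq_measure_integral P')//; move=> S mS _; exact: Z2.
Qed.

End W1label.

Lemma integral_prob_cst d (T : measurableType d) (R : realType) (P : probability T R) (c : \bar R) :
  (\int[P]__ c = c)%E.
Proof. by rewrite -[RHS]mule1 -(probability_setT P); exact: integral_cst. Qed.

Lemma exists_natdiv_le (R : realType) (c e : R) : 0 < e ->
  exists M : nat, (0 < M)%N /\ c / M%:R <= e.
Proof.
move=> e0; exists (Num.bound (`|c| / e)).+1; split => //.
rewrite ler_pdivrMr ?ltr0n// mulrC -ler_pdivrMr//.
apply: (@le_trans _ _ (`|c| / e)); first by rewrite ler_wpM2r ?invr_ge0 ?(ltW e0)// ler_norm.
rewrite ltW// (lt_trans (archi_boundP _)) ?ltr_nat//.
by rewrite divr_ge0// ltW.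
Qed.

Lemma enorm_eq0 (R : realType) n (v : 'rV[R]_n) : (enorm v == 0) = (v == 0).
Proof.
apply/eqP/eqP => [v0|->]; last exact: enorm0.
apply/rowP => k; apply/eqP; rewrite mxE -normr_le0 -v0; exact: enorm_coord.
Qed.

Lemma measurable_set1_mx (R : realType) n (c : 'rV[R]_n) : measurable [set c].
Proof.
rewrite (_ : [set c] = (fun y => enorm (y - c)) @^-1` [set 0]).
  rewrite -[X in measurable X]setTI; apply: measurable_enorm => //.
  exact: measurable_mxB.
by apply/seteqP; split => y /= => [->|/eqP]; rewrite ?subrr ?enorm0// enorm_eq0 subr_eq0 => /eqP.
Qed.

(** * Metric properties of the Wasserstein distance *)

Section W1theory.
Local Open Scope ereal_scope.
Context (R : realType) (n : nat).
Notation E := 'rV[R]_n.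
Implicit Types mu nu : probability E R.

Lemma coupling_fst (mu nu : set E -> \bar R) tau (A : set E) : coupling mu nu tau -> measurable A ->
  tau (fst @^-1` A) = mu A.
Proof. by move=> [h _] mA; rewrite -h. Qed.

Lemma coupling_snd (mu nu : set E -> \bar R) tau (A : set E) : coupling mu nu tau -> measurable A ->
  tau (snd @^-1` A) = nu A.
Proof. by move=> [_ h] mA; rewrite -h. Qed.

Lemma W1_sym (mu nu : set E -> \bar R) : W1 mu nu = W1 nu mu.
Proof.
suff h (m1 m2 : set E -> \bar R) : W1 m1 m2 <= W1 m2 m1 by apply/eqP; rewrite eq_le !h.
apply: le_ereal_inf_tmp => _ [tau ct <-].
rewrite /transport_cost.
under eq_integral do rewrite enorm_distC.
apply: W1_joint => //.
- by move=> A mA; rewrite /pushforward (coupling_snd ct).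
- by move=> A mA; rewrite /pushforward (coupling_fst ct).
Qed.

Lemma W1_refl (mu : set E -> \bar R) nu : meas_eq nu mu -> W1 mu mu = 0.
Proof.
move=> e; apply/eqP; rewrite eq_le W1_ge0 andbT.
apply: (le_trans (W1_joint (P := nu) (X := id) (Y := id) _ _ e e)) => //.
by under eq_integral do rewrite subrr enorm0; rewrite integral0.
Qed.

(* Rounding the middle marginal to a lattice gives two couplings a common
   discrete label, along which they can be glued. *)
Lemma W1_triangle (mu nu rho : set E -> \bar R) : W1 mu rho <= W1 mu nu + W1 nu rho.
Proof.
have [->|h1] := eqVneq (W1 mu nu) +oo.
  by rewrite addye ?leey// gt_eqF// (lt_le_trans _ (W1_ge0 _ _))// ltNy0.
have [->|h2] := eqVneq (W1 nu rho) +oo.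
  by rewrite addey ?leey// gt_eqF// (lt_le_trans _ (W1_ge0 _ _))// ltNy0.
have f1 : W1 mu nu \is a fin_num by rewrite ge0_fin_numE ?W1_ge0// ltey.
have f2 : W1 nu rho \is a fin_num by rewrite ge0_fin_numE ?W1_ge0// ltey.
apply/lee_addgt0Pr => e e0.
have e4 : (0 < e / 4)%R by rewrite divr_gt0.
have [t1 c1 k1] : exists2 tau, coupling mu nu tau & transport_cost tau <= (fine (W1 mu nu) + e / 4)%:E.
  by apply: W1_witness => //; rewrite fineK.
have [t2 c2 k2] : exists2 tau, coupling nu rho tau & transport_cost tau <= (fine (W1 nu rho) + e / 4)%:E.
  by apply: W1_witness => //; rewrite fineK.
have [M [M0 Me]] : exists M : nat, (0 < M)%N /\ (n%:R / M%:R <= e / 4)%R.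
  exact: exists_natdiv_le.
(* The label is a code of the lattice cell of side [1 / M] that contains [y]. *)
pose lab (y : E) : nat := pickle (\row_k Num.floor (y ord0 k * M%:R) : 'rV[int]_n).
have labE y y' : lab y = lab y' -> rnd M y = rnd M y'.
  move=> /(pcan_inj pickleK)/rowP h; apply/rowP => k; rewrite !mxE.
  by have := h k; rewrite !mxE => ->.
have mlab i : measurable (lab @^-1` [set i]).
  have [[y0 /= <-]|ni] := pselect (exists y0, lab y0 = i); last first.
    by rewrite (_ : _ @^-1` _ = set0)//; apply/seteqP; split => // y /= ly; apply: ni; exists y.
  rewrite (_ : _ @^-1` _ = rnd M @^-1` [set rnd M y0]).
    rewrite -[X in measurable X]setTI; apply: (@measurable_rnd _ _ _ _ M id) => //.
    exact: measurable_set1_mx.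
  apply/seteqP; split => y /=; first exact: labE.
  move=> /rowP h; congr pickle; apply/rowP => k; have := h k; rewrite !mxE => /mulIf.
  by move=> /(_ _) /intr_inj; apply; rewrite invr_eq0 pnatr_eq0 -lt0n.
have mlab1 i : measurable ((lab \o snd : E * E -> nat) @^-1` [set i]).
  by rewrite comp_preimage -[X in measurable X]setTI; exact: measurable_snd.
have mlab2 i : measurable ((lab \o fst : E * E -> nat) @^-1` [set i]).
  by rewrite comp_preimage -[X in measurable X]setTI; exact: measurable_fst.
(* The middle points [y] and [y'] lie in one cell, each within [e / 4] of its corner, and each side
   pays for its own. With the two gaps of [e / 4] from near optimality this adds up to [e]. *)
pose f (z : E * E) := cost z + (e / 4)%:E.
have mf : measurable_fun setT f by apply: emeasurable_funD => //; exact: measurable_cost.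
have f0 z : 0 <= f z by rewrite adde_ge0 ?cost_ge0// lee_fin ltW.
apply: (le_trans (label_coupling (P := t1) (P' := t2) (X := fst) (Y := snd) (f := f) (g := f)
  mlab1 mlab2 _ measurable_fst measurable_snd c1.1 c2.2 mf f0 mf f0 _)).
- move=> i; transitivity (nu (lab @^-1` [set i])).
    exact: (coupling_snd c1 (mlab i)).
  by apply/esym; exact: (coupling_fst c2 (mlab i)).
- move=> [x y] [y' z] /= /labE yy; rewrite /f /cost /= -!EFinD lee_fin.
  have := enorm_triangle x y z; have := enorm_triangle y (rnd M y) z.
  have := enorm_triangle (rnd M y) y' z.
  have := rnd_err y M0; have := rnd_err y' M0.
  rewrite -yy (enorm_distC y').
  lra.
have If (t : probability (E * E)%type R) : \int[t]_z f z = transport_cost t + (e / 4)%:E.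
  rewrite ge0_integralD//; last 3 first.
  - by move=> z _; exact: cost_ge0.
  - exact: measurable_cost.
  - by move=> z _; rewrite lee_fin ltW.
  by congr (_ + _); exact: integral_prob_cst.
rewrite !If -(fineK f1) -(fineK f2).
apply: (le_trans (leeD (leeD k1 (lexx _)) (leeD k2 (lexx _)))).
rewrite -!EFinD lee_fin; lra.
Qed.

Lemma W1_triangle_le (mu nu rho : set E -> \bar R) (a b : R) :
  W1 mu nu <= a%:E -> W1 nu rho <= b%:E -> W1 mu rho <= (a + b)%:E.
Proof. by move=> h1 h2; rewrite EFinD; apply: (le_trans (W1_triangle mu nu rho)); exact: leeD. Qed.

(** Mass of [A] that lands outside [B] travels at least [e], and a plan of cost about [c] can move
    at most [c / e] that far. *)
Lemma W1_enlarge (mu nu : set E -> \bar R) (A B : set E) (c e : R) :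
  measurable A -> measurable B -> (0 < e)%R -> W1 mu nu <= c%:E ->
  (forall x y, A x -> ~ B y -> (e <= enorm (x - y))%R) -> mu A <= nu B + (c / e)%:E.
Proof.
move=> mA mB e0 hW hAB; apply/lee_addgt0Pr => d d0.
(* The gap [d * e] becomes [d] after division by [e]. *)
have [t ct kt] := W1_witness hW (mulr_gt0 d0 e0).
have mA1 : measurable (fst @^-1` A : set (E * E)) by rewrite -[X in measurable X]setTI; exact: measurable_fst.
have mB2 : measurable (snd @^-1` B : set (E * E)) by rewrite -[X in measurable X]setTI; exact: measurable_snd.
rewrite -(coupling_fst ct mA) -(coupling_snd ct mB).
pose F : set (E * E) := [set z | e%:E <= `|cost z|].
have mF : measurable F.
  rewrite /F -[X in measurable X]setTI; apply: emeasurable_fun_c_infty => //.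
  by apply: measurableT_comp => //; exact: measurable_cost.
apply: (@le_trans _ _ (t (snd @^-1` B `|` F))).
  apply: le_measure; rewrite ?inE//; first exact: measurableU.
  move=> [x y] /= Ax; have [By|By] := pselect (B y); [by left|right].
  by rewrite /F/= lee_fin ger0_norm ?enorm_ge0//; exact: hAB.
apply: (le_trans (measureU2 _ _ _)) => //.
rewrite -addeA leeD2l// -EFinD.
(* Markov's inequality *)
have := le_integral_abse t measurableT (@measurable_cost R n) e0.
rewrite setTI -/F; under eq_integral do rewrite gee0_abs ?cost_ge0//.
move=> h.
have h2 : e%:E * t F <= (c + d * e)%:E by apply: (le_trans h).
have tF : t F \is a fin_num by rewrite fin_num_measure.
move: h2; rewrite -(fineK tF) -EFinM !lee_fin => h2.
suff H : t F <= (c / e + d)%:E by exact: H.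
by rewrite -(fineK tF) lee_fin -(ler_pM2l e0) mulrDr mulrCA divff ?gt_eqF// mulr1 [(e * d)%R]mulrC.
Qed.

(** Zero distance gives [mu F <= nu (G k)] for the open neighbourhoods [G k] of width [1 / (k + 1)],
    and these decrease to [F] since it is closed. *)
Lemma W1_eq0_closed mu nu (F : set E) : W1 mu nu = 0 -> closed F -> mu F <= nu F.
Proof.
move=> h cF.
have mF : measurable F by rewrite -[F]setCK; apply: measurableC; apply: open_measurable_mx; rewrite openC.
pose G (k : nat) : set E := \bigcup_(x in F) [set y | (enorm (x - y) < k.+1%:R^-1)%R].
have oG k : open (G k).
  apply: bigcup_open => x _.
  rewrite (_ : [set y | _] = (fun y : E => (y - x)%R) @^-1` eball (k.+1%:R^-1)).
    apply: open_comp; last exact: open_eball.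
    by move=> y _; exact: (cvgB cvg_id (cvg_cst _)).
  by apply/seteqP; split => y /=; rewrite /eball/= enorm_distC.
have mG k : measurable (G k) by exact: open_measurable_mx.
have FG : \bigcap_k G k = F.
  apply/seteqP; split => [y yG|y Fy k _]; last by exists y => //=; rewrite subrr enorm0 invr_gt0.
  apply: cF => U /nbhs_ballP[e /= e0 yU].
  have [k _ /(_ k (leqnn k)) ke] := near_infty_natSinv_lt (PosNum e0).
  have [x Fx /= xy] := yG k I.
  exists x; split => //; apply: yU; rewrite -ball_normE /ball_/=.
  by rewrite (le_lt_trans (mxnorm_le_enorm _))// enorm_distC (lt_trans xy).
have hG k : mu F <= nu (G k).
  have := @W1_enlarge mu nu F (G k) 0 (k.+1%:R^-1) mF (mG k).
  rewrite h mul0r adde0; apply => //.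
  by move=> x y Fx Gy; rewrite leNgt; apply/negP => xy; apply: Gy; exists x.
have : nu (G k) @[k --> \oo] --> nu (\bigcap_k G k).
  apply: nonincreasing_cvg_mu => //.
  - by rewrite -ge0_fin_numE// fin_num_measure.
  - by apply: bigcapT_measurable.
  move=> i j ij; apply/subsetPset => y [x Fx /= xy]; exists x => //=.
  by rewrite (lt_le_trans xy)// lef_pV2 ?posrE// ler_nat.
rewrite FG => cG; have <- := cvg_lim (@ereal_hausdorff R) cG.
by apply: lime_ge; [exact: cvgP cG|exact: nearW].
Qed.

(** Closed sets, hence open sets, have equal mass, and open sets form a generating family stable
    under intersection. This turns limits at distance zero into the semigroup identities [flow0] and
    [flowD]. *)
Lemma W1_eq0 mu nu : W1 mu nu = 0 -> meas_eq mu nu.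
Proof.
move=> h A mA.
have hcl F : closed F -> mu F = nu F.
  by move=> cF; apply/eqP; rewrite eq_le !W1_eq0_closed// W1_sym.
have hop U : open U -> mu U = nu U.
  move=> oU.
  have mU : measurable U by exact: open_measurable_mx.
  have cU : closed (~` U) by rewrite -openC setCK.
  have mCU : measurable (~` U) by exact: measurableC.
  by rewrite -(setCK U) !(probability_setC _ mCU) (hcl _ cU).
apply: (@measure_unique _ R E (@open E) (fun=> setT)) => //.
- by move=> X Y; exact: openI.
- by move=> _; exact: openT.
- exact: bigcup_const.
- by move=> _; rewrite -ge0_fin_numE// fin_num_measure.
Qed.

(** Equivalent to the inclusion of the support in [cball r] ([supp_inball], [inball_supp]), but
    stated as a null set, which behaves well under pushforwards and couplings. *)
Definition inball (mu : set E -> \bar R) (r : R) := mu (~` cball r) = 0.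

Lemma measurable_cball r : measurable (@cball R n r).
Proof.
rewrite -[X in measurable X]setCK; apply: measurableC; apply: open_measurable_mx.
by rewrite openC; exact: closed_cball.
Qed.

Lemma inball_le mu (r s : R) : inball mu r -> (r <= s)%R -> inball mu s.
Proof.
move=> h rs; apply/eqP; rewrite eq_le measure_ge0 andbT -h.
apply: le_measure; rewrite ?inE; [by apply: measurableC; exact: measurable_cball..|].
by apply: subsetC => x /= /le_trans; apply.
Qed.

Lemma supp_inball mu (r : R) : supp mu `<=` cball r -> inball mu r.
Proof.
move=> h; apply/eqP; rewrite eq_le measure_ge0 andbT.
have <- : mu (~` supp mu) = 0.
  apply: (@supp_null R E _ E id mu mu) => //; first exact: second_countable_mx.
  exact: open_measurable_mx.
apply: le_measure; rewrite ?inE; [by apply: measurableC; exact: measurable_cball| |exact: subsetC].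
by apply: open_measurable_mx; rewrite openC; exact: closed_supp.
Qed.

Lemma inball_supp mu (r : R) : inball mu r -> supp mu `<=` cball r.
Proof.
move=> h x sx; apply: contrapT => xr; have := sx (~` cball r).
rewrite h ltxx => H; suff : false by []; apply: H => //.
by rewrite openC; exact: closed_cball.
Qed.

Lemma inball_compact mu (r : R) : inball mu r -> compactly_supported mu.
Proof.
move=> h; apply: (subclosed_compact _ (@compact_cball R n r)); first exact: closed_supp.
exact: inball_supp.
Qed.

Lemma compact_inball mu : compactly_supported mu -> exists2 r : R, (0 < r)%R & supp mu `<=` eball r.
Proof.
move=> /compact_bounded [M [_ /(_ (M + 1)%R)]].
rewrite ltrDl ltr01 => /(_ isT) hM; exists (n%:R * `|M + 1| + 1)%R; first by rewrite ltr_wpDl// mulr_ge0.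
move=> x /hM xM; rewrite /eball/= (le_lt_trans (enorm_le_mxnorm _))//.
by rewrite ltr_pwDr// ler_wpM2l// (le_trans xM)// ler_norm.
Qed.

Lemma inball_lim mu nu (r d e : R) : inball mu r -> (0 < d)%R -> W1 mu nu <= e%:E ->
  nu (~` cball (r + d)) <= (e / d)%:E.
Proof.
move=> h d0 hW; rewrite -[leRHS]add0e -[X in X + _]h.
apply: W1_enlarge => //; [by apply: measurableC; exact: measurable_cball..|by rewrite W1_sym|].
move=> x y /= /negP; rewrite -ltNge => xr /contrapT yr.
have := enormD (x - y) y; rewrite subrK; move: xr yr; rewrite /cball/=; lra.
Qed.

End W1theory.

(** * Compactness along an ultrafilter *)

Section UltraLimit.
Context (R : realType) (U : set_system nat) {UU : UltraFilter U}.

(** Compactness of the segment provides a cluster point, and an ultrafilter converges to each of its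
    cluster points. *)
Lemma ultra_cvg (u : nat -> R) (a b : R) : (forall N, a <= u N <= b) ->
  exists l : R, u @ U --> l.
Proof.
move=> uab.
have [|p [_ clp]] := @segment_compact R a b (u @ U) _.
  by apply: (@filterE _ U) => N; rewrite /= in_itv/=; exact: uab.
exists p => V Vp; have [//|nV] := in_ultra_setVsetC (u @^-1` V) UU.
have [y [nVy Vy]] := clp (~` V) V nV Vp.
by exfalso; exact: nVy.
Qed.

End UltraLimit.

Section FindLabel.
Context d (T : measurableType d) (I : Type) (B : I -> set T).

Lemma measurable_find (s : seq I) (k : nat) : (forall i, measurable (B i)) ->
  measurable [set x | find (fun i => `[< B i x >]) s = k].
Proof.
move=> mB; elim: s k => [|i s ih] k /=.
  by have [->|k0] := eqVneq 0%N k; [rewrite (_ : [set _ | _] = setT)//; apply/seteqP|rewrite (_ : [set _ | _] = set0)//; apply/seteqP; split => // x /= /eqP; rewrite (negbTE k0)].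
case: k => [|k].
  rewrite (_ : [set x | _] = B i)//; apply/seteqP; split => x /=; last by move=> /asboolP ->.
  by case: ifPn => // /asboolP.
rewrite (_ : [set x | _] = ~` B i `&` [set x | find (fun i => `[< B i x >]) s = k]).
  by apply: measurableI => //; exact: measurableC.
apply/seteqP; split => x /=; first by case: ifPn => // /asboolPn nB [].
by move=> [/asboolPn/negbTE -> ->].
Qed.

End FindLabel.

Section Partition.
Context (R : realType) (n : nat).
Notation E := 'rV[R]_n.

Lemma measurable_eball_at (c : E) (e : R) : measurable [set x : E | enorm (x - c) < e].
Proof.
rewrite (_ : [set x | _] = (fun x : E => enorm (x - c)) @^-1` [set y | y < e])//.
rewrite -[X in measurable X]setTI; apply: measurable_enorm => //.
  exact: measurable_mxB.
by apply: open_measurable; exact: open_lt.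
Qed.

Lemma finite_partition (rho e : R) : 0 < e -> exists (m : nat) (idx : E -> nat),
  [/\ (0 < m)%N, forall i, measurable (idx @^-1` [set i]), forall x, (idx x < m)%N
    & forall x y, cball rho x -> cball rho y -> idx x = idx y -> enorm (x - y) < e].
Proof.
move=> e0; have e20 : 0 < e / 2 by rewrite divr_gt0.
have := @compact_cball R n rho; rewrite compact_cover => /(_ _ setT (fun c : E => [set x : E | enorm (x - c) < e / 2])).
case.
- move=> c _.
  rewrite (_ : [set x : E | _] = (fun y : E => y - c) @^-1` eball (e / 2))//.
  apply: open_comp; last exact: open_eball.
  by move=> y _; exact: (cvgB cvg_id (cvg_cst _)).
- by move=> x _; exists x => //=; rewrite subrr enorm0.
move=> D _ cD.
pose s : seq E := finmap.enum_fset D.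
pose B (c : E) : set E := [set x | enorm (x - c) < e / 2].
(* [find] returns the first ball of the cover that contains the point, and [size s] for points in
   none, hence the successor. Balls of radius [e / 2] make the cells of diameter less than [e]. *)
exists (size s).+1, (fun x => find (fun c => `[< B c x >]) s); split => //.
- move=> i; apply: measurable_find => c; exact: measurable_eball_at.
- by move=> x; rewrite ltnS find_size.
have hs z : cball rho z -> has (fun c => `[< B c z >]) s.
  move=> /cD [c Dc zc]; apply/hasP; exists c => //; exact/asboolP.
move=> x y xr yr xy.
have /asboolP := nth_find 0 (hs _ xr); have /asboolP := nth_find 0 (hs _ yr).
rewrite xy; set c := nth _ _ _; rewrite /B/= => h1 h2.
have := enorm_triangle x c y; rewrite (enorm_distC c); lra.
Qed.

End Partition.

(** * Quantile functions on finitely many labels *)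

Section Quantile.
Context (R : realType).

Lemma unit_prob : {P : probability (measurableTypeR R) R |
  forall A, P A = @lebesgue_measure R (A `&` `[0, 1[)}.
Proof.
have mI : measurable (`[0, 1[ : set (measurableTypeR R)) by [].
have [|P PE] := @exists_probability _ _ _ (mrestr (@lebesgue_measure R) mI).
  transitivity (@lebesgue_measure R `[0, 1[%classic).
    by rewrite /mrestr; congr (lebesgue_measure _); apply/seteqP; split => x //= [].
  by rewrite lebesgue_measure_itv/= lte_fin ltr01 oppr0 adde0.
by exists P => A; rewrite PE.
Qed.

(* The junk value off [0, 1[ is harmless: [unit_prob] is carried by that interval. *)
Definition clip (w : R) : R := if (0 <= w < 1) then w else 0.

Lemma clip_in w : 0 <= clip w < 1.
Proof. by rewrite /clip; case: ifPn => //; rewrite lexx ltr01. Qed.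

Lemma clip_itv_prob (a b : R) : 0 <= a -> a <= b -> b <= 1 ->
  sval unit_prob (clip @^-1` `[a, b[) = (b - a)%:E.
Proof.
move=> a0 ab b1; case: unit_prob => Q QE /=; rewrite QE.
rewrite (_ : _ `&` _ = `[a, b[%classic).
  rewrite lebesgue_measure_itv/= lte_fin; case: ifPn => //; rewrite -leNgt => h.
  by congr EFin; lra.
apply/seteqP; split => w /=; rewrite !in_itv/= /clip.
  by move=> [+ w01]; rewrite w01.
move=> /andP[h1 h2]; have -> : 0 <= w < 1 by apply/andP; split; lra.
by split => //; apply/andP.
Qed.

Lemma measurable_clip : measurable_fun setT clip.
Proof.
apply: measurable_fun_ifT => //.
by apply: measurable_and; [exact: measurable_fun_ler|exact: measurable_fun_ltr].
Qed.

Variables (F : nat -> R) (P : nat).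
Hypotheses (F0 : F 0%N = 0) (FP : F P = 1) (Fnd : forall i j, (i <= j)%N -> F i <= F j).

(** The generalized inverse of [F], where [F j] stands for the mass of the labels below [j]; label
    [i] thus owns the half-open interval from [F i] to [F i.+1]. *)
Definition quant (w : R) : nat := find (fun j => clip w < F j.+1) (iota 0 P).

Lemma quantP w : [/\ (quant w < P)%N & F (quant w) <= clip w < F (quant w).+1].
Proof.
have /andP[c0 c1] := clip_in w.
have P0 : (0 < P)%N by case: P FP => // FP0; move: F0; rewrite FP0 => /eqP; rewrite oner_eq0.
have hs : has (fun j => clip w < F j.+1) (iota 0 P).
  apply/hasP; exists P.-1; first by rewrite mem_iota/= add0n prednK.
  by rewrite prednK// FP.
have qP : (quant w < P)%N by move: hs; rewrite has_find size_iota.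
split => //; apply/andP; split; last first.
  by have := nth_find 0%N hs; rewrite nth_iota// add0n.
case E : (quant w) => [|j]; first by rewrite F0.
have jq : (j < quant w)%N by rewrite E.
have := before_find 0%N jq; rewrite nth_iota ?(ltn_trans jq)// add0n => /negbT.
by rewrite -leNgt.
Qed.

Lemma quant_uniq w i : F i <= clip w < F i.+1 -> quant w = i.
Proof.
move=> /andP[i1 i2]; have [_ /andP[q1 q2]] := quantP w.
apply/eqP; rewrite eqn_leq; apply/andP; split; rewrite leqNgt; apply/negP => h.
  by have := Fnd h; lra.
by have := Fnd h; lra.
Qed.

Lemma quant_preimage i : quant @^-1` [set i] = clip @^-1` `[F i, F i.+1[.
Proof.
apply/seteqP; split => w /=; rewrite in_itv/=; last exact: quant_uniq.
by move=> <-; have [] := quantP w.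
Qed.

Lemma measurable_quant i : measurable (quant @^-1` [set i]).
Proof.
by rewrite quant_preimage -[X in measurable X]setTI; exact: measurable_clip.
Qed.

Lemma quant_prob i : (i < P)%N -> sval unit_prob (quant @^-1` [set i]) = (F i.+1 - F i)%:E.
Proof.
move=> iP; rewrite quant_preimage clip_itv_prob//; last 2 first.
- exact: Fnd.
- by rewrite -FP; exact: Fnd.
by rewrite -F0; exact: Fnd.
Qed.

End Quantile.

(* The ball is cut into finer and finer cells, labelled in such an order that
   every cell is a consecutive block of cells of the next generation. The
   ultralimits [F k] of the distribution functions [G N k] of the labels are
   then consistent in [k], and reading them as quantile functions produces a
   random variable [X] whose law is the limit. *)
Section Limit.
Context (R : realType) (n : nat) (U : set_system nat) {UU : UltraFilter U}.
Notation E := 'rV[R]_n.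
Variables (mu_ : nat -> probability E R) (rho : R).
Hypothesis hmu : \forall N \near U, inball (mu_ N) rho.
Variables (m : nat -> nat) (idx : nat -> E -> nat).
Hypotheses (m0 : forall k, (0 < m k)%N) (midx : forall k i, measurable (idx k @^-1` [set i]))
  (idx_lt : forall k x, (idx k x < m k)%N)
  (idx_small : forall k x y, cball rho x -> cball rho y -> idx k x = idx k y ->
     enorm (x - y) < k.+1%:R^-1).

(** Mixed-radix numbering: the next generation appends the digit [idx k x] in base [m k], and
    division by [m k] recovers the parent cell. *)
Fixpoint lab (k : nat) (x : E) : nat :=
  if k is k'.+1 then (lab k' x * m k' + idx k' x)%N else 0%N.

Fixpoint cnt (k : nat) : nat := if k is k'.+1 then (cnt k' * m k')%N else 1%N.

Let lab_lt k x : (lab k x < cnt k)%N.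
Proof.
elim: k => //= k ih; rewrite -ltn_divLR// divnMDl// divn_small ?addn0//.
Qed.

Let lab_div k x : (lab k.+1 x %/ m k)%N = lab k x.
Proof. by rewrite /= divnMDl// divn_small ?addn0. Qed.

Let lab_mod k x : (lab k.+1 x %% m k)%N = idx k x.
Proof. by rewrite /= modnMDl modn_small. Qed.

Let mlab k i : measurable (lab k @^-1` [set i]).
Proof.
elim: k i => [|k ih] i.
  have [i0|k0] := eqVneq 0%N i.
    have -> : lab 0 @^-1` [set i] = setT by apply/seteqP; split => // x _.
    exact: measurableT.
  have -> : lab 0 @^-1` [set i] = set0 by apply/seteqP; split => // x /= /eqP; rewrite (negbTE k0).
  exact: measurable0.
rewrite (_ : _ @^-1` _ = lab k @^-1` [set (i %/ m k)%N] `&` idx k @^-1` [set (i %% m k)%N]).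
  by apply: measurableI.
apply/seteqP; split => x.
  by move=> <-; split; [exact: (esym (lab_div k x))|exact: (esym (lab_mod k x))].
by move=> [/= h1 h2]; rewrite h1 h2 -divn_eq.
Qed.

Let G (N k j : nat) : R := fine (mu_ N [set x | (lab k x < j)%N]).

Let mlt k j : measurable [set x | (lab k x < j)%N].
Proof. exact: (measurable_nat_preimage [set i | (i < j)%N] (mlab k)). Qed.

Let GE N k j : mu_ N [set x | (lab k x < j)%N] = (G N k j)%:E.
Proof. by rewrite fineK// fin_num_measure. Qed.

Let G01 N k j : 0 <= G N k j <= 1.
Proof. by rewrite -!lee_fin -GE measure_ge0 probability_le1. Qed.

Let F (k j : nat) : R := sval (cid (ultra_cvg (UU := UU) (fun N => G01 N k j))).

Let FG k j : G N k j @[N --> U] --> F k j.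
Proof. exact: (svalP (cid (ultra_cvg (UU := UU) (fun N => G01 N k j)))). Qed.

Let Gnd N k i j : (i <= j)%N -> G N k i <= G N k j.
Proof.
move=> ij; rewrite -lee_fin -!GE; apply: le_measure; rewrite ?inE//.
by move=> x /= /leq_trans; apply.
Qed.

Let G0 N k : G N k 0 = 0.
Proof. by rewrite /G (_ : [set x | _] = set0) ?measure0//; apply/seteqP; split. Qed.

Let G1 N k : G N k (cnt k) = 1.
Proof.
rewrite /G (_ : [set x | _] = setT) ?probability_setT//.
by apply/seteqP; split => // x _ /=; exact: lab_lt.
Qed.

Let GS N k j : G N k.+1 (j * m k) = G N k j.
Proof.
rewrite /G; congr (fine (mu_ N _)); apply/seteqP; split => x; rewrite /mkset -ltn_divLR// lab_div//.
Qed.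

Let FGle k k' i j : (\forall N \near U, G N k i <= G N k' j) -> F k i <= F k' j.
Proof.
move=> h; rewrite -subr_ge0; apply: (cvgr_to_ge (cvgB (@FG k' j) (@FG k i))).
by apply: filterS h => N /=; rewrite fctE subr_ge0.
Qed.

Let F_unique k j l : (forall N, G N k j = l) -> F k j = l.
Proof.
move=> h; rewrite -(cvg_lim (@Rhausdorff R) (@FG k j)).
by under eq_fun do rewrite h; exact: lim_cst.
Qed.

Let F0 k : F k 0 = 0. Proof. exact: F_unique. Qed.
Let F1 k : F k (cnt k) = 1. Proof. exact: F_unique. Qed.

Let Fnd k i j : (i <= j)%N -> F k i <= F k j.
Proof.
by move=> ij; apply: FGle; apply: nearW => N; exact: Gnd.
Qed.

Let FS k j : F k.+1 (j * m k) = F k j.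
Proof.
by apply/eqP; rewrite eq_le; apply/andP; split; apply: FGle; apply: nearW => N; rewrite GS.
Qed.

Let J k := quant (F k) (cnt k).

Let JP k w : (J k w < cnt k)%N /\ F k (J k w) <= clip w < F k (J k w).+1.
Proof. by have [] := quantP (F0 k) (F1 k) w. Qed.

(** By [FS] the interval of a label lies inside the interval of its parent, so the quantile labels
    of [w] form a branch of nested cells. *)
Let JS k w : (J k.+1 w %/ m k)%N = J k w.
Proof.
apply/esym/quant_uniq; [exact: F0|exact: F1|exact: Fnd|].
have [_ /andP[h1 h2]] := JP k.+1 w.
apply/andP; split; rewrite -FS.
  by apply: (le_trans _ h1); apply: Fnd; exact: leq_divM.
by apply: (lt_le_trans h2); apply: Fnd; rewrite -ltn_divLR.
Qed.

(** If no point of the ball carried the label [J k w], nearly all [mu_ N] would give it no mass and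
    [F k] could not increase there, while [clip w] lies strictly below the next value. *)
Let fiber k w : exists x, cball rho x /\ lab k x = J k w.
Proof.
apply: contrapT => nx.
have [_ /andP[h1 h2]] := JP k w.
have : F k (J k w).+1 <= F k (J k w); last by move=> ?; lra.
apply: FGle.
apply: filterS hmu => N hN.
rewrite -lee_fin -!GE -[leRHS]adde0 -hN.
apply: (@le_trans _ _ (mu_ N ([set x | (lab k x < J k w)%N] `|` ~` cball rho))).
  apply: le_measure; rewrite ?inE//.
    by apply: measurableU => //; apply: measurableC; exact: measurable_cball.
  move=> x /=; rewrite ltnS leq_eqVlt => /orP[/eqP lx|]; last by left.
  by right => xr; apply: nx; exists x.
by apply: measureU2 => //; apply: measurableC; exact: measurable_cball.
Qed.

Let c k (i : nat) : E := get [set x | cball rho x /\ lab k x = i].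

Let X_ k w : E := c k (J k w).

Let XP k w : cball rho (X_ k w) /\ lab k (X_ k w) = J k w.
Proof. exact: (getPex (fiber k w)). Qed.

Let labJ k l w x : (k <= l)%N -> lab l x = J l w -> lab k x = J k w.
Proof.
elim: l => [|l ih]; first by rewrite leqn0 => /eqP ->.
rewrite leq_eqVlt => /orP[/eqP ->//|kl] e; apply: ih => //.
by rewrite -lab_div e JS.
Qed.

Let small k x y : cball rho x -> cball rho y -> lab k.+1 x = lab k.+1 y -> enorm (x - y) < k.+1%:R^-1.
Proof.
by move=> hx hy e; apply: idx_small => //; rewrite -!lab_mod e.
Qed.

Let Xcauchy k l w : (k.+1 <= l)%N -> enorm (X_ k.+1 w - X_ l w) < k.+1%:R^-1.
Proof.
move=> kl; have [h1 h2] := XP k.+1 w; have [h3 h4] := XP l w.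
by apply: small => //; rewrite h2 (labJ kl h4).
Qed.

Let exk (e : R) : 0 < e -> exists k : nat, k.+1%:R^-1 < e.
Proof.
by move=> e0; have [k _ /(_ k (leqnn k)) ke] := near_infty_natSinv_lt (PosNum e0); exists k.
Qed.

Let Xi_cauchy k l w i : (k.+1 <= l)%N -> `|X_ k.+1 w ord0 i - X_ l w ord0 i| < k.+1%:R^-1.
Proof.
move=> kl; apply: (le_lt_trans _ (Xcauchy w kl)).
by have := enorm_coord (X_ k.+1 w - X_ l w) i; rewrite !mxE.
Qed.

Let Xi_cvg w i : cvgn (fun k => X_ k w ord0 i).
Proof.
apply/cauchy_cvgP/cauchy_exP => e e0.
have [k ke] := exk e0.
exists (X_ k.+1 w ord0 i); exists k.+1 => // l /= kl.
by rewrite /ball/= (lt_trans (Xi_cauchy w i kl)).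
Qed.

Let X w : E := \row_i limn (fun k => X_ k w ord0 i).

Let XX k w : enorm (X w - X_ k.+1 w) <= n%:R / k.+1%:R.
Proof.
apply: enorm_le_coord => i; rewrite !mxE distrC.
have h : `|X_ k.+1 w ord0 i - X_ l w ord0 i| @[l --> \oo] --> `|X_ k.+1 w ord0 i - limn (fun k => X_ k w ord0 i)|.
  by apply: cvg_norm; apply: cvgB; [exact: cvg_cst|exact: Xi_cvg].
apply: (cvgr_to_le h).
by exists k.+1 => // l /= kl; rewrite ltW//; exact: Xi_cauchy.
Qed.

Let mJ k i : measurable (J k @^-1` [set i] : set (measurableTypeR R)).
Proof. by apply: measurable_quant => //; exact: Fnd. Qed.

Let mX_ k : measurable_fun setT (X_ k : measurableTypeR R -> E).
Proof.
by move=> _ S mS; rewrite setTI; exact: (measurable_nat_preimage (c k @^-1` S) (mJ k)).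
Qed.

Let mX : measurable_fun setT (X : measurableTypeR R -> E).
Proof.
apply: measurable_mx => z i; rewrite ord1.
apply: (measurable_fun_cvg (h := fun k w => X_ k w ord0 i)).
  by move=> k; exact: (@measurable_mx_coord R n _ _ (X_ k) ord0 i (mX_ k)).
by move=> w _; rewrite mxE; exact: Xi_cvg.
Qed.

Let lam := sval (unit_prob R).

Let nu : probability E R := law lam mX.

Let JG N k := quant (G N k) (cnt k).

Let mJG N k i : measurable (JG N k @^-1` [set i] : set (measurableTypeR R)).
Proof. by apply: measurable_quant => //; exact: Gnd. Qed.

Let mne N k : measurable ([set w | JG N k w <> J k w] : set (measurableTypeR R)).
Proof.
rewrite (_ : mkset _ = \bigcup_i (JG N k @^-1` [set i] `&` ~` (J k @^-1` [set i]))).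
  apply: bigcupT_measurable => i; apply: measurableI; first exact: mJG.
  exact: measurableC (mJ k i).
by apply/seteqP; split => [w /= h|w [i _ /= [-> h]]]; [exists (JG N k w) => //; split => // /esym|move=> /esym].
Qed.

Let law_labels N k i : mu_ N (lab k @^-1` [set i]) = lam (JG N k @^-1` [set i]).
Proof.
have [ik|ik] := ltnP i (cnt k); last first.
  have -> : lab k @^-1` [set i] = set0.
    by apply/seteqP; split => // x /= lx; move: ik; rewrite -lx leqNgt lab_lt.
  have -> : JG N k @^-1` [set i] = set0.
    apply/seteqP; split => // w /= lx; move: ik; rewrite -lx leqNgt.
    by have [-> _] := quantP (G0 N k) (G1 N k) w.
  by rewrite !measure0.
rewrite [RHS]quant_prob//; last exact: Gnd.
have h : mu_ N [set x | (lab k x < i.+1)%N] = (mu_ N [set x | (lab k x < i)%N] + mu_ N (lab k @^-1` [set i]))%E.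
  rewrite -measureU//; last first.
    by apply/seteqP; split => // x [/= + lx]; rewrite lx ltnn.
  congr (mu_ N _); apply/seteqP; split => x /=.
    by rewrite ltnS leq_eqVlt => /orP[/eqP|]; [right|left].
  by move=> [h|->//]; exact: ltnW.
by rewrite EFinB -!GE h [X in (X - _)%E]addeC addeK// fin_num_measure.
Qed.

(* The quantile functions of two distribution functions on the labels differ
   only where some [j] has [w] between its two values. *)
Let near_labels N k : (lam [set w | JG N k w <> J k w] <=
  (\sum_(j < (cnt k).+1) `|G N k j - F k j|)%:E)%E.
Proof.
pose I (j : nat) : set R := @clip R @^-1` `[Num.min (F k j) (G N k j), Num.max (F k j) (G N k j)[.
have mI j : measurable (I j : set (measurableTypeR R)).
  rewrite /I -[X in measurable X]setTI; apply: measurable_clip => //.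
have lI j : (j <= cnt k)%N -> lam (I j) = `|G N k j - F k j|%:E.
  move=> jk.
  have f0 : 0 <= F k j by rewrite -(F0 k); exact: Fnd.
  have f1 : F k j <= 1 by rewrite -(F1 k); exact: Fnd.
  have /andP[g0 g1] := G01 N k j.
  rewrite /lam clip_itv_prob ?le_min ?ge_max ?f0 ?f1 ?g0 ?g1//.
    by congr EFin; have [h|h] := leP (F k j) (G N k j); [rewrite ger0_norm|rewrite ltr0_norm]; lra.
  by rewrite ge_min !le_max lexx.
have mlabs := mne N k.
rewrite -sumEFin.
under eq_bigr => j _ do rewrite -lI ?leq_ord//.
apply: content_subadditive => //.
move=> w /= h.
rewrite -(bigcup_mkord _ I) /=.
have [jG /andP[G1' G2']] := quantP (G0 N k) (G1 N k) w.
have [jF /andP[F1' F2']] := JP k w.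
rewrite -/(JG N k) in jG G1' G2'.
have [lt|lt|//] := ltngtP (JG N k w) (J k w).
  exists (JG N k w).+1 => //=; rewrite /I/= in_itv/= ge_min lt_max G2' orbT andbT.
  by rewrite (le_trans _ F1')//; exact: Fnd.
exists (J k w).+1 => //=; rewrite /I/= in_itv/= ge_min lt_max F2' andbT.
by rewrite (le_trans (Gnd N k lt) G1') orbT.
Qed.

(** Points of [mu_ N] are coupled with parameters [w] through the labels of generation [k + 1], read
    off [w] with the quantile function of [mu_ N] itself. Where it agrees with [J], the point shares
    a cell with [X_ k.+1 w]; elsewhere the diameter [2 * rho] is paid, on a set whose measure is the
    sum in the bound. *)
Lemma ultra_limit_bound k : \forall N \near U,
  (W1 (mu_ N) nu <= (k.+1%:R^-1 + n%:R / k.+1%:R + (2 * rho) * \sum_(j < (cnt k.+1).+1) `|G N k.+1 j - F k.+1 j|)%:E)%E.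
Proof.
apply: filterS hmu => N hN.
have [x0 [x0r _]] := fiber 0 0.
have rho0 : 0 <= rho by apply: le_trans x0r; exact: enorm_ge0.
pose D := [set w | JG N k.+1 w <> J k.+1 w] : set (measurableTypeR R).
have mD : measurable D by exact: mne.
pose d : R := k.+1%:R^-1 + n%:R / k.+1%:R.
have d0 : 0 <= d by rewrite addr_ge0// ?invr_ge0// divr_ge0.
(* [label_coupling] asks for a bound at every point, also off the ball; the second term provides it
   and vanishes [mu_ N]-almost everywhere. In [d] one term is the diameter of a cell and the other
   the distance from [X] to [X_ k.+1]. *)
pose f (x : E) : \bar R := (d%:E + (\1_(~` cball rho) x * (enorm x + rho))%:E)%E.
pose g (w : measurableTypeR R) : \bar R := ((2 * rho)%:E * (\1_D w)%:E)%E.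
have mB : measurable (~` cball rho : set E) by apply: measurableC; exact: measurable_cball.
have mf1 : measurable_fun setT (fun x : E => (\1_(~` cball rho) x * (enorm x + rho))%:E).
  apply/measurable_EFinP; apply: measurable_funM; first exact: measurable_indic.
  by apply: measurable_funD => //; exact: (measurable_enorm (f := id)).
have mf : measurable_fun setT f by apply: emeasurable_funD.
have mg : measurable_fun setT g.
  by apply: emeasurable_funM => //; apply/measurable_EFinP; exact: measurable_indic.
have f10 x : (0 <= (\1_(~` cball rho) x * (enorm x + rho))%:E)%E.
  by rewrite lee_fin mulr_ge0// ?indicE// addr_ge0// enorm_ge0.
have f0 x : (0 <= f x)%E by rewrite adde_ge0// lee_fin.
have g0 w : (0 <= g w)%E by rewrite mule_ge0// lee_fin ?mulr_ge0// indicE.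
apply: (le_trans (label_coupling (P := mu_ N) (P' := lam) (X := id) (Y := X) (f := f) (g := g)
   (mlab k.+1) (@mJG N k.+1) (@law_labels N k.+1) _ mX (fun A _ => erefl) (fun A _ => erefl) mf f0 mg g0 _)) => //.
  move=> x w /= labx.
  have [h1 h2] := XP k.+1 w.
  have h3 := XX k w.
  have hk : 0 <= k.+1%:R^-1 :> R by rewrite invr_ge0.
  rewrite /f /g -!EFinD lee_fin.
  set z : R := (X in 2 * rho * X).
  have z0 : 0 <= z by rewrite /z indicE.
  have t1 := enorm_triangle x (X_ k.+1 w) (X w); rewrite (enorm_distC (X_ k.+1 w) (X w)) in t1.
  have t2 := enormD x (- X_ k.+1 w); rewrite enormN in t2.
  have h1' : enorm (X_ k.+1 w) <= rho by exact: h1.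
  have p2 : 0 <= 2 * rho * z by rewrite mulr_ge0 ?mulr_ge0.
  have [xr|xr] := pselect (cball rho x); last first.
    rewrite indicE mem_set// mul1r /d.
    move: h3 hk; set a := _^-1; set b := n%:R * a => h3 hk; lra.
  rewrite [\1_(~` _) x]indicE memNset; last by move=> /(_ xr).
  rewrite mul0r addr0 /d.
  have xr' : enorm x <= rho by exact: xr.
  have [e|ne] := pselect (JG N k.+1 w = J k.+1 w); last first.
    rewrite /z indicE mem_set// mulr1.
    move: h3 hk; set a := _^-1; set b := n%:R * a => h3 hk; lra.
  have := small xr h1 (etrans labx (etrans e (esym h2))).
  move: h3 hk; set a := _^-1; set b := n%:R * a => h3 hk; lra.
have -> : (\int[mu_ N]_x f x = d%:E)%E.
  rewrite ge0_integralD// integral_prob_cst -[RHS]adde0; congr (_ + _)%E.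
  rewrite (ge0_ae_eq_integral (g := cst 0%E))//; first by rewrite integral0.
  exists (~` cball rho); split => // x /= /not_implyP[_ h] xr; apply: h.
  by rewrite indicE memNset ?mul0r//; move=> /(_ xr).
have -> : (\int[lam]_w g w = (2 * rho)%:E * lam D)%E.
  rewrite ge0_integralZl//=; first by rewrite integral_indic// setIT.
  - by apply/measurable_EFinP; exact: measurable_indic.
  - by rewrite lee_fin mulr_ge0.
rewrite [leRHS]EFinD; apply: leeD => //; rewrite [leRHS]EFinM; apply: lee_wpmul2l.
  by rewrite lee_fin mulr_ge0.
exact: near_labels.
Qed.

Lemma ultra_limit_of_partition : exists nu : probability E R,
  forall e : R, 0 < e -> \forall N \near U, (W1 (mu_ N) nu <= e%:E)%E.
Proof.
exists nu => e e0.
have [k ke] : exists k : nat, k.+1%:R^-1 + n%:R / k.+1%:R <= e / 2.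
  have [M [M0 hM]] := exists_natdiv_le (1 + n%:R) (divr_gt0 e0 (ltr0n R 2)).
  by exists M.-1; rewrite prednK// -[X in X + _]mul1r -mulrDl.
pose S N : R := \sum_(j < (cnt k.+1).+1) `|G N k.+1 j - F k.+1 j|.
have S0 : S N @[N --> U] --> (0 : R).
  rewrite [X in _ --> X](_ : _ = \sum_(j < (cnt k.+1).+1) `|F k.+1 j - F k.+1 j|); last first.
    by rewrite big1// => j _; rewrite subrr normr0.
  rewrite /S; apply: (cvg_big (op := +%R)); [exact: add_continuous|move=> j _]; apply: cvg_norm; apply: cvgB; [exact: (@FG k.+1 j)|exact: cvg_cst].
have [r1 r10 r1e] : exists2 r : R, 0 < r & 2 * rho * r <= e / 2.
  exists (e / (4 * (`|rho| + 1))); first by rewrite divr_gt0// mulr_gt0// ltr_wpDl.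
  have p : 0 < `|rho| + 1 by rewrite ltr_wpDl.
  rewrite mulrA ler_pdivrMr ?mulr_gt0//.
  have := ler_norm rho; have := mulr_ge0 (ltW e0) (ltW ltr01); nra.
have hS : \forall N \near U, `|S N| < r1 by exact: (cvgr0_norm_lt _ S0).
apply: (filterS _ (filterI (ultra_limit_bound k) hS)) => N [h1 h2].
apply: (le_trans h1); rewrite lee_fin.
have Sge : 0 <= S N by apply: sumr_ge0.
have h3 : S N <= r1 by rewrite ltW// (le_lt_trans (ler_norm _)).
move: ke; set a := _^-1 + _ => ke.
have [r0|r0] := leP 0 rho; first by have := ler_wpM2l (mulr_ge0 (ler0n R 2) r0) h3; rewrite -/(S N); lra.
have := mulr_ge0 (ltW (_ : 0 < - rho)) Sge; rewrite -/(S N) oppr_gt0 => /(_ r0); lra.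
Qed.

End Limit.

Lemma ultra_limit (R : realType) (n : nat) (U : set_system nat) (UU : UltraFilter U)
    (mu_ : nat -> probability 'rV[R]_n R) (rho : R) :
  (\forall N \near U, inball (mu_ N) rho) ->
  exists nu : probability 'rV[R]_n R,
    forall e : R, 0 < e -> \forall N \near U, (W1 (mu_ N) nu <= e%:E)%E.
Proof.
move=> hmu.
have H k := @finite_partition R n rho (k.+1%:R^-1) ltac:(by rewrite invr_gt0).
pose m k := sval (cid (H k)).
pose idx k := sval (cid (svalP (cid (H k)))).
have P k := svalP (cid (svalP (cid (H k)))).
apply: (@ultra_limit_of_partition R n U UU mu_ rho hmu m idx).
- by move=> k; have [] := P k.
- by move=> k; have [] := P k.
- by move=> k; have [] := P k.
- by move=> k x y hx hy; have [_ _ _] := P k; apply.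
Qed.

(** * Test functions *)

Section PartialCalculus.
Context (R : realType) (n : nat).
Notation E := 'rV[R]_n.
Implicit Types (f : E -> R) (x y z : E).

Lemma is_derive_line f z k s : derivable f (z + s *: basisv R k) (basisv R k) ->
  is_derive s (1 : R) (fun s => f (z + s *: basisv R k)) ('D_(basisv R k) f (z + s *: basisv R k)).
Proof.
set e := basisv R k => df.
have E1 : (fun h : R => h^-1 *: (f (h *: e + (z + s *: e)) - f (z + s *: e))) =
  (fun h : R => h^-1 *: (f (z + (h *: (1 : R) + s) *: e) - f (z + s *: e))).
  apply/funext => h; congr (_ *: (f _ - _)).
  by rewrite scalerDl addrCA /GRing.scale/= mulr1.
split; first by rewrite /derivable -E1.
by rewrite /derive -E1.
Qed.

Lemma coord_MVT f k z d : (forall x, derivable f x (basisv R k)) ->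
  exists2 c, Num.min 0 d <= c <= Num.max 0 d &
    f (z + d *: basisv R k) - f z = 'D_(basisv R k) f (z + c *: basisv R k) * d.
Proof.
move=> df.
have pos z' d' : 0 <= d' -> exists2 c, 0 <= c <= d' &
    f (z' + d' *: basisv R k) - f z' = 'D_(basisv R k) f (z' + c *: basisv R k) * d'.
  move=> d0.
  have [||c] := @MVT_segment R (fun s => f (z' + s *: basisv R k))
    (fun s => 'D_(basisv R k) f (z' + s *: basisv R k)) 0 d' d0.
  - by move=> s _; apply: is_derive_line.
  - apply: derivable_within_continuous => s _.
    by have [] := is_derive_line (df (z' + s *: basisv R k)).
  by rewrite in_itv/= scale0r addr0 subr0 => cd ->; exists c.
have [d0|d0] := leP 0 d.
  exact: pos.
(* For [d < 0] the segment is run from its other end. *)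
have [|c /andP[c0 c1]] := pos (z + d *: basisv R k) (- d); first by rewrite oppr_ge0 ltW.
rewrite -addrA -scalerDl subrr scale0r addr0 -addrA -scalerDl => h.
exists (d + c); first by apply/andP; split; lra.
by rewrite -opprB h; lra.
Qed.

(** [smooth] speaks of iterated partial derivatives, so the increment is followed along segments
    parallel to the axes. The intermediate points stay in the box spanned by [x] and [y]. *)
Lemma path_MVT f x y : (forall k z, derivable f z (basisv R k)) ->
  exists xi : 'I_n -> E,
    (forall i k, Num.min (x ord0 k) (y ord0 k) <= xi i ord0 k <= Num.max (x ord0 k) (y ord0 k)) /\
    f y - f x = \sum_(i < n) 'D_(basisv R i) f (xi i) * (y ord0 i - x ord0 i).
Proof.
move=> df.
pose z (j : nat) : E := \row_k (if (k < j)%N then y ord0 k else x ord0 k).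
have zS (i : 'I_n) : z i.+1 = z i + (y ord0 i - x ord0 i) *: basisv R i.
  apply/rowP => k; rewrite !mxE eqxx/=.
  have [->|ki] := eqVneq k i; first by rewrite ltnSn ltnn mulr1 addrC subrK.
  have ki' : (k : nat) != i by [].
  by rewrite mulr0 addr0 ltnS (ltn_neqAle k i) ki'.
have H (i : 'I_n) : exists2 c, Num.min 0 (y ord0 i - x ord0 i) <= c <= Num.max 0 (y ord0 i - x ord0 i) &
    f (z i.+1) - f (z i) = 'D_(basisv R i) f (z i + c *: basisv R i) * (y ord0 i - x ord0 i).
  by rewrite zS; exact: coord_MVT.
pose c i := s2val (cid2 (H i)).
exists (fun i : 'I_n => z i + c i *: basisv R i); split.
  move=> i k; rewrite !mxE eqxx/=.
  have [->|ki] := eqVneq k i; last first.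
    by rewrite mulr0 addr0; case: ifP => _; rewrite ge_min le_max lexx ?orbT.
  rewrite ltnn mulr1; rewrite /c; case: cid2 => /= t /andP[t1 t2] _.
  apply/andP; split.
    by move: t1; rewrite ge_min => /orP[t1|t1]; rewrite ge_min; apply/orP; [left|right]; lra.
  by move: t2; rewrite le_max => /orP[t2|t2]; rewrite le_max; apply/orP; [left|right]; lra.
transitivity (\sum_(i < n) (f (z i.+1) - f (z i))).
  rewrite -(big_mkord xpredT (fun i => f (z i.+1) - f (z i))) telescope_sumr//.
  congr (f _ - f _); apply/rowP => k; rewrite !mxE//.
  by rewrite ltn_ord.
by apply: eq_bigr => i _; rewrite /c; case: cid2.
Qed.

(** A path parallel to the axes between two points of a ball may leave the ball, but it cannot leave
    a cube. *)
Definition cube (r : R) : set E := [set x | forall k, `|x ord0 k| <= r].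

Lemma compact_cube r : compact (cube r).
Proof.
rewrite (_ : cube r = [set v : E | forall i, `[(- r), r]%classic (v ord0 i)]).
  by apply: (@rV_compact _ _ (fun=> `[(- r), r]%classic)) => i; exact: segment_compact.
by apply/seteqP; split => x h k; have := h k; rewrite /= in_itv/= ler_norml.
Qed.

Lemma cball_cube r x : cball r x -> cube r x.
Proof. by move=> xr k; apply: le_trans xr; exact: enorm_coord. Qed.

Lemma between_cube r x y (xi : E) : cube r x -> cube r y ->
  (forall k, Num.min (x ord0 k) (y ord0 k) <= xi ord0 k <= Num.max (x ord0 k) (y ord0 k)) ->
  cube r xi.
Proof.
move=> hx hy h k; have /andP[h1 h2] := h k.
have := hx k; have := hy k; rewrite !ler_norml => /andP[y1 y2] /andP[x1 x2].
apply/andP; split.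
  by apply: le_trans h1; rewrite le_min x1.
by apply: (le_trans h2); rewrite ge_max x2.
Qed.

Lemma continuous_cube_bounded f r : continuous f -> exists2 B, 0 <= B & forall x, cube r x -> `|f x| <= B.
Proof.
move=> cf.
have /compact_bounded [M [_ hM]] : compact (f @` cube r).
  by apply: continuous_compact; [exact: continuous_subspaceT|exact: compact_cube].
exists (`|M| + 1); first by rewrite addr_ge0.
move=> x xr; apply: hM; last by exists x.
by rewrite (le_lt_trans (ler_norm M))// ltrDl.
Qed.

Lemma lipschitz_cube f r (B : R) : (forall k z, derivable f z (basisv R k)) ->
  (forall k x, cube r x -> `|'D_(basisv R k) f x| <= B) ->
  forall x y, cube r x -> cube r y -> `|f y - f x| <= n%:R * B * enorm (y - x).
Proof.
move=> df hB x y hx hy.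
have [xi [h ->]] := path_MVT x y df.
apply: (le_trans (ler_norm_sum _ _ _)).
rewrite -mulrA (_ : n%:R * _ = \sum_(i < n) (B * enorm (y - x))); last by rewrite sumr_const card_ord mulr_natl.
apply: ler_sum => i _.
rewrite normrM ler_pM//; first by apply: hB; exact: between_cube (h i).
by have := enorm_coord (y - x) i; rewrite !mxE.
Qed.

End PartialCalculus.

Section TestFunction.
Context (R : realType) (n : nat) (f : 'rV[R]_n -> R) (r : R).
Hypothesis sf : smooth f.

Lemma smooth_derivable k z : derivable f z (basisv R k).
Proof. by have [_] := sf [::]; apply. Qed.

Lemma smooth_partial k : continuous ('D_(basisv R k) f).
Proof. by have [+ _] := sf [:: k]. Qed.

Lemma smooth_partial_derivable k l z : derivable ('D_(basisv R k) f) z (basisv R l).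
Proof. by have [_] := sf [:: k]; apply. Qed.

Lemma smooth_partial2 k l : continuous ('D_(basisv R l) ('D_(basisv R k) f)).
Proof. by have [+ _] := sf [:: l; k]. Qed.

Lemma smooth_bounds : exists2 L : R, 0 < L &
  [/\ forall x y, cube r x -> cube r y -> `|f y - f x| <= L * enorm (y - x),
      forall x, cube r x -> enorm (grad f x) <= L,
      forall x y, cube r x -> cube r y -> enorm (grad f y - grad f x) <= L * enorm (y - x)
    & forall x y, cube r x -> cube r y ->
      `|f y - f x - dotp (grad f x) (y - x)| <= L * enorm (y - x) ^+ 2].
Proof.
have uniform_bound (I : finType) (g : I -> 'rV[R]_n -> R) : (forall i, continuous (g i)) ->
    exists2 B, 0 <= B & forall i x, cube r x -> `|g i x| <= B.
  move=> cg; pose B i := s2val (cid2 (continuous_cube_bounded r (cg i))).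
  have B0 i : 0 <= B i by rewrite /B; case: cid2.
  exists (\sum_i B i); first by apply: sumr_ge0.
  move=> i x xr; rewrite (bigD1 i)//= ler_wpDr ?sumr_ge0//.
  by rewrite /B; case: cid2 => //= ? _; apply.
have [B1 B10 hB1] := uniform_bound _ (fun k => 'D_(basisv R k) f) smooth_partial.
have [B2 B20 hB2] := uniform_bound _ (fun kl : 'I_n * 'I_n => 'D_(basisv R kl.2) ('D_(basisv R kl.1) f))
   (fun kl => @smooth_partial2 kl.1 kl.2).
have N0 : 0 <= n%:R :> R by [].
have hD k x y : cube r x -> cube r y ->
    `|'D_(basisv R k) f y - 'D_(basisv R k) f x| <= n%:R * B2 * enorm (y - x).
  apply: (@lipschitz_cube R n ('D_(basisv R k) f) r B2); first exact: smooth_partial_derivable.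
  by move=> l z; exact: (hB2 (k, l)).
(* One constant for the four bounds: the first summand serves values and gradients, the second the
   increments of the gradient, the third the Taylor remainder, and [1] makes it positive. *)
exists (n%:R * B1 + n%:R * (n%:R * B2) + n%:R * (n%:R * B2 * n%:R) + 1).
  by rewrite ltr_wpDl// !addr_ge0// !mulr_ge0.
have p1 : 0 <= n%:R * B1 by rewrite mulr_ge0.
have p2 : 0 <= n%:R * (n%:R * B2) by rewrite !mulr_ge0.
have p3 : 0 <= n%:R * (n%:R * B2 * n%:R) by rewrite !mulr_ge0.
split.
- move=> x y hx hy; apply: (le_trans (lipschitz_cube smooth_derivable hB1 hx hy)).
  by apply: ler_wpM2r; [exact: enorm_ge0|lra].
- move=> x hx; apply: (@le_trans _ _ (n%:R * B1)); last by lra.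
  by apply: enorm_le_coord => k; rewrite mxE; exact: hB1.
- move=> x y hx hy; apply: (@le_trans _ _ (n%:R * (n%:R * B2 * enorm (y - x)))).
    by apply: enorm_le_coord => k; rewrite !mxE; exact: hD.
  by rewrite mulrA; apply: ler_wpM2r; [exact: enorm_ge0|lra].
move=> x y hx hy.
have [xi [h ->]] := path_MVT x y smooth_derivable.
rewrite /dotp -sumrB.
apply: (@le_trans _ _ (n%:R * (n%:R * B2 * n%:R) * enorm (y - x) ^+ 2)); last first.
  by apply: ler_wpM2r; [exact: sqr_ge0|lra].
apply: (le_trans (ler_norm_sum _ _ _)).
rewrite -[leRHS]mulrA (_ : n%:R * _ = \sum_(i < n) (n%:R * B2 * n%:R * enorm (y - x) ^+ 2)); last by rewrite sumr_const card_ord mulr_natl.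
apply: ler_sum => i _.
rewrite !mxE -mulrBl normrM expr2 mulrA ler_pM//; last first.
  by have := enorm_coord (y - x) i; rewrite !mxE.
apply: (le_trans (hD i _ _ hx (between_cube hx hy (h i)))).
rewrite -[leRHS]mulrA ler_wpM2l ?mulr_ge0//.
apply: enorm_le_coord => k; rewrite !mxE.
have := enorm_coord (y - x) k; rewrite !mxE; apply: le_trans.
have /andP[] := h i k.
have [xy|xy] := leP (x ord0 k) (y ord0 k) => h1 h2.
  by rewrite !ger0_norm; lra.
by rewrite !ler0_norm; lra.
Qed.

Lemma measurable_grad : measurable_fun setT (grad f).
Proof.
apply: measurable_mx => i k; under eq_fun do rewrite mxE.
apply: continuous_measurable_mx; exact: smooth_partial.
Qed.

Lemma measurable_smooth : measurable_fun setT f.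
Proof. by apply: continuous_measurable_mx; have [+ _] := sf [::]. Qed.

End TestFunction.

Lemma ge0_integral_le_null d (T : measurableType d) (R : realType) (P : probability T R) (A : set T)
    (f : T -> \bar R) (c : R) :
  measurable A -> P (~` A) = 0%E -> measurable_fun setT f -> (forall x, 0 <= f x)%E -> 0 <= c ->
  (forall x, A x -> f x <= c%:E)%E -> (\int[P]_x f x <= c%:E)%E.
Proof.
move=> mA PA mf f0 c0 h; rewrite -[leRHS](integral_prob_cst P).
apply: ae_ge0_le_integral => //.
exists (~` A); split => //; first exact: measurableC.
by move=> x /= /not_implyP[_ nfx] Ax; apply: nfx; exact: h.
Qed.

Section Null.
Context d (T : measurableType d) (R : realType) (P : probability T R).
Implicit Types A B : set T.

Lemma null_subset A B : measurable A -> measurable B -> A `<=` B -> P B = 0%E -> P A = 0%E.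
Proof.
move=> mA mB AB PB; apply/eqP; rewrite eq_le measure_ge0 andbT -PB.
by apply: le_measure; rewrite ?inE.
Qed.

Lemma null_union A B : measurable A -> measurable B -> P A = 0%E -> P B = 0%E -> P (A `|` B) = 0%E.
Proof. exact: null_set_setU. Qed.

Lemma integrable_concentrated (f : T -> R) (A : set T) (c : R) : measurable_fun setT f -> 0 <= c ->
  measurable A -> P (~` A) = 0%E -> (forall x, A x -> `|f x| <= c) ->
  P.-integrable setT (EFin \o f).
Proof.
move=> mf c0 mA PA h; apply/integrableP; split; first exact/measurable_EFinP.
apply: (@le_lt_trans _ _ c%:E); last exact: ltry.
apply: (ge0_integral_le_null mA PA) => //.
by do 2 apply: measurableT_comp => //.
Qed.

(** Bounds on a test function are uniform only on a bounded set, so the pointwise comparison is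
    asked on a set [A] of full measure. *)
Lemma Rintegral_dist_le (f g : T -> R) (h : T -> \bar R) (A : set T) (c : R) :
  P.-integrable setT (EFin \o f) -> P.-integrable setT (EFin \o g) ->
  measurable_fun setT h -> (forall x, 0 <= h x)%E ->
  measurable A -> P (~` A) = 0%E -> (forall x, A x -> `|f x - g x|%:E <= h x)%E ->
  (\int[P]_x h x <= c%:E)%E ->
  `|\int[P]_x f x - \int[P]_x g x| <= c.
Proof.
move=> If Ig mh h0 mA PA hA hc.
rewrite -RintegralB//.
have Ifg : P.-integrable setT (EFin \o (fun x => f x - g x)).
  rewrite (_ : _ \o _ = ((EFin \o f) \- (EFin \o g))%E); last exact/funext.
  exact: integrableB.
rewrite -lee_fin EFin_normr_Rintegral//.
have mfg : measurable_fun setT (EFin \o (fun x => f x - g x)) by exact: measurable_int Ifg.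
apply: (le_trans (le_abse_integral _ measurableT mfg)).
apply: le_trans hc; apply: ae_ge0_le_integral => //.
- exact: measurableT_comp.
- exists (~` A); split => //; first exact: measurableC.
  by move=> x /= /not_implyP[_ nfx] Ax; apply: nfx; exact: hA.
Qed.

End Null.

(** * The Euler step *)

Section Step.
Context (R : realType) (n : nat).
Notation E := 'rV[R]_n.
Notation TE := (E * E)%type.
Variables (V : probability E R -> probability TE R) (C : R).
Hypotheses (V1 : PVF V) (C0 : 0 < C) (Vsub : support_sublinear C V)
  (Vlip : locally_calW_lipschitz V).
Implicit Types mu nu : probability E R.

Definition speed (r : R) := C * (1 + r).

Lemma PVF_preimage mu (A : set E) : measurable A -> V mu (fst @^-1` A) = mu A.
Proof. by move=> mA; rewrite -[RHS]V1. Qed.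

(** Sublinearity bounds velocities on [supp (V mu)], and the complement of this support is null
    because the product space is second countable. *)
Lemma V_concentrated mu r : 0 <= r -> inball mu r ->
  V mu (~` (cball r `*` cball (speed r))) = 0%E.
Proof.
move=> r0 hmu.
have m1 : measurable (fst @^-1` (~` @cball R n r) : set TE).
  by rewrite -[X in measurable X]setTI; apply: measurable_fst => //; apply: measurableC; exact: measurable_cball.
have m2 : measurable (snd @^-1` (~` @cball R n (speed r)) : set TE).
  by rewrite -[X in measurable X]setTI; apply: measurable_snd => //; apply: measurableC; exact: measurable_cball.
apply: (null_subset _ (measurableU _ _ m1 m2)).
- by apply: measurableC; apply: measurableX; exact: measurable_cball.
- by move=> z /= /not_andP.
apply: null_union => //.
  by rewrite PVF_preimage//; apply: measurableC; exact: measurable_cball.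
have oS : open (~` supp (V mu)) by rewrite openC; exact: closed_supp.
apply: (null_subset m2 (open_measurable_mx2 oS)); last first.
  apply: (@supp_null R TE _ TE id (V mu) (V mu)) => //.
    by apply: second_countable_prod; exact: second_countable_mx.
  exact: open_measurable_mx2.
apply: subsetC => z sz; rewrite /cball/= -lee_fin.
have hz : ((enorm z.2)%:E <= ereal_sup [set (enorm z.2)%:E | z in supp (V mu)])%E.
  by apply: ereal_sup_ubound; exists z.
apply: (le_trans hz).
apply: (le_trans (Vsub (inball_compact hmu))).
rewrite /speed EFinM; apply: lee_wpmul2l; first by rewrite lee_fin ltW.
rewrite EFinD; apply: leeD => //; apply: ge_ereal_sup => _ [x sx <-].
by rewrite lee_fin; exact: (inball_supp hmu sx).
Qed.

Definition adv (N : nat) (t : R) (z : TE) : E := z.1 + t *: rnd N z.2.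

Lemma measurable_adv N t : measurable_fun setT (adv N t).
Proof.
by apply: measurable_mxD => //; apply: measurable_mxZ; exact: measurable_rnd.
Qed.

(** There is no truncation to the grid, so the estimates hold for all measures in a ball. Agreement
    with the lattice sums is proved separately, for [N] large ([euler_sum]). *)
Definition euler N t mu : probability E R := law (V mu) (measurable_adv N t).

Definition lattice N mu : probability E R := law mu (measurable_rnd (N ^ 2) (@measurable_id _ E setT)).

Definition las N k mu : probability E R := iter k (euler N N%:R^-1) (lattice N mu).

Definition err (N : nat) : R := n%:R / N%:R.

Lemma err_ge0 N : 0 <= err N.
Proof. by rewrite divr_ge0. Qed.

Lemma speed_ge0 r : 0 <= r -> 0 <= speed r.
Proof. by move=> r0; rewrite mulr_ge0 ?(ltW C0)// addr_ge0. Qed.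

Lemma enorm_rnd N (v : E) : (0 < N)%N -> enorm (rnd N v) <= enorm v + err N.
Proof.
move=> N0; have := rnd_err v N0; have := enormD (rnd N v - v) v.
by rewrite subrK enorm_distC /err; lra.
Qed.

Lemma enorm_adv N t (z : TE) r s : (0 < N)%N -> 0 <= t -> cball r z.1 -> cball s z.2 ->
  enorm (adv N t z - z.1) <= t * (s + err N).
Proof.
move=> N0 t0 h1 h2; rewrite /adv addrC addKr enormZ ger0_norm// ler_wpM2l//.
by apply: (le_trans (enorm_rnd _ N0)); rewrite lerD2r.
Qed.

Lemma adv_dist N t (z z' : TE) : (0 < N)%N -> 0 <= t ->
  enorm (adv N t z - adv N t z') <= enorm (z.1 - z'.1) + t * enorm (z.2 - z'.2) + 2 * t * err N.
Proof.
case: z z' => [x v] [y w] N0 t0; rewrite /adv/=.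
have -> : x + t *: rnd N v - (y + t *: rnd N w) = (x - y) + t *: (v - w) + t *: ((rnd N v - v) + (w - rnd N w)).
  apply/rowP => i; rewrite !mxE; ring.
apply: (le_trans (enormD _ _)); apply: lerD.
  by apply: (le_trans (enormD _ _)); rewrite enormZ ger0_norm.
have -> : 2 * t * err N = t * (2 * err N) by ring.
rewrite enormZ ger0_norm// ler_wpM2l//.
apply: (le_trans (enormD _ _)); rewrite (enorm_distC _ v).
by have := rnd_err v N0; have := rnd_err w N0; rewrite /err; lra.
Qed.

Lemma euler_inball N t mu r : (0 < N)%N -> 0 <= t -> 0 <= r -> inball mu r ->
  inball (euler N t mu) (r + t * (speed r + err N)).
Proof.
move=> N0 t0 r0 hmu; rewrite /inball lawE.
apply: (null_subset _ _ _ (V_concentrated r0 hmu)).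
- by rewrite -[X in measurable X]setTI; apply: measurable_adv => //; apply: measurableC; exact: measurable_cball.
- by apply: measurableC; apply: measurableX; exact: measurable_cball.
apply: subsetC => z [h1 h2]; rewrite /cball/=.
have := enorm_adv N0 t0 h1 h2; have := enormD (adv N t z - z.1) z.1; rewrite subrK.
by move: h1; rewrite /cball/=; lra.
Qed.

Lemma euler_speed N t mu r : (0 < N)%N -> 0 <= t -> 0 <= r -> inball mu r ->
  (W1 (euler N t mu) mu <= (t * (speed r + err N))%:E)%E.
Proof.
move=> N0 t0 r0 hmu.
apply: (le_trans (W1_joint (P := V mu) (measurable_adv N t) measurable_fst _ _)).
- by [].
- exact: V1.
apply: (ge0_integral_le_null _ (V_concentrated r0 hmu)).
- by apply: measurableX; exact: measurable_cball.
- by apply/measurable_EFinP/measurable_enorm/measurable_mxB => //; exact: measurable_adv.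
- by move=> z; rewrite lee_fin enorm_ge0.
- by rewrite mulr_ge0// addr_ge0 ?err_ge0 ?speed_ge0.
by move=> z [h1 h2]; rewrite lee_fin; exact: (enorm_adv N0 t0 h1 h2).
Qed.

Lemma calW_witness r : 0 <= r -> exists2 K : R, 0 < K &
  forall mu nu a e, inball mu r -> inball nu r -> (W1 mu nu <= a%:E)%E -> 0 < e ->
  exists T : probability (TE * TE)%type R,
   [/\ coupling (V mu) (V nu) T, (\int[T]_z (enorm (z.1.1 - z.2.1))%:E <= a%:E)%E
     & (\int[T]_z (enorm (z.1.2 - z.2.2))%:E <= (K * a + e)%:E)%E].
Proof.
move=> r0; have [|K K0 hK] := Vlip (r := r + 1); first by rewrite ltr_wpDl.
exists K => // mu nu a e hmu hnu hW e0.
have hs (m : probability E R) : inball m r -> supp m `<=` eball (r + 1).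
  by move=> /inball_supp h x /h xr; rewrite /eball/= (le_lt_trans xr)// ltrDl.
have h1 : (calW (V mu) (V nu) < (K * a + e)%:E)%E.
  apply: (le_lt_trans (hK _ _ (hs _ hmu) (hs _ hnu))).
  apply: (@le_lt_trans _ _ (K * a)%:E); last by rewrite lte_fin ltrDl.
  by rewrite EFinM; apply: lee_wpmul2l => //; rewrite lee_fin ltW.
have [_ [T [cT [tau [ctau otau] hT]] <-] /ltW h2] := ereal_inf_lt h1.
exists T; split => //.
have m13 : measurable_fun setT (@pi13 R n).
  apply: measurable_fun_pair.
    exact: (measurableT_comp measurable_fst measurable_fst).
  exact: (measurableT_comp measurable_fst measurable_snd).
have -> : (\int[T]_z (enorm (z.1.1 - z.2.1))%:E = transport_cost (law T m13))%E.
  by rewrite /transport_cost (ge0_integral_law T m13 (@measurable_cost R n) (@cost_ge0 R n)).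
have -> : transport_cost (law T m13) = transport_cost tau.
  by apply: eq_measure_integral => A mA _; exact: hT.
apply: le_trans hW.
rewrite -(W1_eq (V1 mu) (V1 nu)).
by apply: le_ereal_inf_tmp => _ [tau' ct' <-]; exact: otau.
Qed.

Lemma euler_lipschitz r : 0 <= r -> exists2 K : R, 0 < K &
  forall N t mu nu a, (0 < N)%N -> 0 <= t -> inball mu r -> inball nu r -> (W1 mu nu <= a%:E)%E ->
  (W1 (euler N t mu) (euler N t nu) <= ((1 + K * t) * a + 2 * t * err N)%:E)%E.
Proof.
move=> r0; have [K K0 hK] := calW_witness r0; exists K => // N t mu nu a N0 t0 hmu hnu hW.
apply/lee_addgt0Pr => e e0.
have t1 : 0 < t + 1 by rewrite ltr_wpDl.
(* The gap is multiplied by [t] later; dividing by [t + 1] also covers [t = 0]. *)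
have [T [cT hT1 hT2]] := hK mu nu a (e / (t + 1)) hmu hnu hW (divr_gt0 e0 t1).
have madv1 : measurable_fun setT (fun z : TE * TE => adv N t z.1).
  exact: (measurableT_comp (measurable_adv N t)).
have madv2 : measurable_fun setT (fun z : TE * TE => adv N t z.2).
  exact: (measurableT_comp (measurable_adv N t)).
apply: (le_trans (W1_joint (P := T) madv1 madv2 _ _)).
- move=> A mA; rewrite lawE -[RHS]cT.1//.
  by rewrite -[X in measurable X]setTI; exact: measurable_adv.
- move=> A mA; rewrite lawE -[RHS]cT.2//.
  by rewrite -[X in measurable X]setTI; exact: measurable_adv.
pose c1 (z : TE * TE) : \bar R := (enorm (z.1.1 - z.2.1))%:E.
pose c2 (z : TE * TE) : \bar R := (t%:E * (enorm (z.1.2 - z.2.2))%:E)%E.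
have mf1 (i : TE * TE -> TE) (j : TE -> E) : measurable_fun setT i -> measurable_fun setT j -> measurable_fun setT (j \o i).
  by move=> mi mj; exact: measurableT_comp.
have mc1 : measurable_fun setT c1.
  apply/measurable_EFinP/measurable_enorm/measurable_mxB.
    by apply: (mf1 fst fst).
  by apply: (mf1 snd fst).
have mc2' : measurable_fun setT (fun z : TE * TE => (enorm (z.1.2 - z.2.2))%:E).
  apply/measurable_EFinP/measurable_enorm/measurable_mxB.
    by apply: (mf1 fst snd).
  by apply: (mf1 snd snd).
have mc2 : measurable_fun setT c2 by exact: measurable_funeM.
have c10 z : (0 <= c1 z)%E by rewrite lee_fin enorm_ge0.
have c20 z : (0 <= c2 z)%E by rewrite mule_ge0// lee_fin ?enorm_ge0.
have en0 : 0 <= 2 * t * err N by rewrite !mulr_ge0// divr_ge0.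
apply: (@le_trans _ _ (\int[T]_z (c1 z + c2 z + (2 * t * err N)%:E))%E).
  apply: ge0_le_integral => //.
  - by move=> z _; rewrite lee_fin enorm_ge0.
  - by apply/measurable_EFinP/measurable_enorm/measurable_mxB.
  - by apply: emeasurable_funD => //; exact: emeasurable_funD.
  by move=> z _; rewrite /c1 /c2 -EFinM -!EFinD lee_fin; exact: adv_dist.
rewrite ge0_integralD//; last 2 first.
- by move=> z _; rewrite adde_ge0.
- exact: emeasurable_funD.
rewrite integral_prob_cst ge0_integralD//.
rewrite ge0_integralZl//; last by move=> z _; rewrite lee_fin enorm_ge0.
apply: (@le_trans _ _ ((a + t * (K * a + e / (t + 1)) + 2 * t * err N)%:E)).
  rewrite !EFinD; apply: leeD => //; apply: leeD => //.
  by rewrite EFinM; apply: lee_wpmul2l => //; rewrite lee_fin.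
rewrite -EFinD lee_fin.
have : t * (K * a + e / (t + 1)) <= t * K * a + e.
  by rewrite mulrDr !mulrA lerD2l ler_pdivrMr// mulrC ler_wpM2l ?ltW// ltrDl.
rewrite [X in _ -> _ <= X](_ : _ = a + (t * K * a + e) + 2 * t * err N); last by ring.
by rewrite lerD2r lerD2l.
Qed.

Lemma lattice_close N mu : (0 < N)%N -> (W1 (lattice N mu) mu <= (err (N ^ 2))%:E)%E.
Proof.
move=> N0.
apply: (le_trans (W1_joint (P := mu) (measurable_rnd (N ^ 2) (@measurable_id _ E setT)) (@measurable_id _ E setT) _ _)) => //.
apply: (ge0_integral_le_null measurableT).
- by rewrite setCT measure0.
- by apply/measurable_EFinP/measurable_enorm/measurable_mxB => //; exact: measurable_rnd.
- by move=> z; rewrite lee_fin enorm_ge0.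
- by rewrite divr_ge0.
by move=> z _; rewrite lee_fin enorm_distC; apply: rnd_err; rewrite expn_gt0 N0.
Qed.

Lemma lattice_inball N mu r : (0 < N)%N -> inball mu r -> inball (lattice N mu) (r + err (N ^ 2)).
Proof.
move=> N0 hmu; rewrite /inball lawE.
apply: (null_subset _ _ _ hmu).
- by rewrite -[X in measurable X]setTI; apply: measurable_rnd => //; apply: measurableC; exact: measurable_cball.
- by apply: measurableC; exact: measurable_cball.
apply: subsetC => z; rewrite /cball/= => h.
by apply: (le_trans (enorm_rnd z _)); rewrite ?expn_gt0 ?N0// lerD2r.
Qed.

End Step.

Lemma integral_transfer d d' (T1 : measurableType d) (T2 : measurableType d') (R : realType)
    (P : probability T1 R) (Q : probability T2 R) (X : T1 -> T2) (g : T2 -> R) :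
  measurable_fun setT X -> meas_eq (pushforward P X) Q -> Q.-integrable setT (EFin \o g) ->
  P.-integrable setT (EFin \o (g \o X)) /\ \int[P]_x g (X x) = \int[Q]_y g y.
Proof.
move=> mX PQ Ig; have mg : measurable_fun setT (EFin \o g) by exact: measurable_int Ig.
have Igx : P.-integrable setT (EFin \o (g \o X)).
  apply/integrableP; split; first exact: (measurableT_comp mg).
  move/integrableP : Ig => [_]; rewrite (eq_measure_integral (law P mX)); last first.
    by move=> A mA _; exact/esym/PQ.
  rewrite ge0_integral_law//; exact: measurableT_comp.
split=> //; rewrite /Rintegral; congr fine.
rewrite [RHS](eq_measure_integral (law P mX)); last by move=> A mA _; exact/esym/PQ.
rewrite /law /distribution /= integral_pushforward//.
Qed.

Lemma coupling_null d (T1 : measurableType d) (R : realType) (P Q : probability T1 R)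
    (tau : probability (T1 * T1)%type R) (A : set T1) :
  coupling P Q tau -> measurable A -> P (~` A) = 0%E -> Q (~` A) = 0%E ->
  tau (~` (A `*` A)) = 0%E.
Proof.
move=> [c1 c2] mA PA QA; have mC := measurableC mA.
have m1 : measurable (fst @^-1` (~` A) : set (T1 * T1)).
  by rewrite -[X in measurable X]setTI; exact: measurable_fst.
have m2 : measurable (snd @^-1` (~` A) : set (T1 * T1)).
  by rewrite -[X in measurable X]setTI; exact: measurable_snd.
have z1 : tau (fst @^-1` (~` A)) = 0%E by rewrite -PA -(c1 _ mC).
have z2 : tau (snd @^-1` (~` A)) = 0%E by rewrite -QA -(c2 _ mC).
have mAA : measurable (~` (A `*` A) : set (T1 * T1)).
  by apply: measurableC; exact: measurableX.
have sAA : ~` (A `*` A) `<=` (fst @^-1` (~` A)) `|` (snd @^-1` (~` A)) by move=> z /= /not_andP.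
have h := null_subset (P := tau) mAA (measurableU _ _ m1 m2) sAA (null_union m1 m2 z1 z2).
exact: h.
Qed.

(** * First-order expansion of an Euler step *)

Section Generator.
Context (R : realType) (n : nat).
Notation E := 'rV[R]_n.
Notation TE := (E * E)%type.
Variables (V : probability E R -> probability TE R) (C : R).
Hypotheses (V1 : PVF V) (C0 : 0 < C) (Vsub : support_sublinear C V)
  (Vlip : locally_calW_lipschitz V).
Implicit Types mu nu : probability E R.
Variable f : E -> R.
Hypothesis sf : smooth f.

Definition Phi mu : R := \int[V mu]_z transport_term f z.

Lemma measurable_transport_term : measurable_fun setT (transport_term f : TE -> R).
Proof.
apply: measurable_dotp => //; apply: (measurableT_comp (measurable_grad sf)) => //.
Qed.

Lemma smooth_integrable mu r : inball mu r -> mu.-integrable setT (EFin \o f).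
Proof.
have [B B0 hB] := continuous_cube_bounded r (sf [::]).1.
move=> hmu; apply: (integrable_concentrated (measurable_smooth sf) B0 _ hmu).
  exact: measurable_cball.
by move=> x /cball_cube; exact: hB.
Qed.

Lemma transport_integrable mu r : 0 <= r -> inball mu r ->
  (V mu).-integrable setT (EFin \o transport_term f).
Proof.
move=> r0 hmu; have [L L0 [_ hL _ _]] := smooth_bounds r sf.
apply: (integrable_concentrated measurable_transport_term (c := L * speed C r) _ _ (V_concentrated V1 C0 Vsub r0 hmu)).
- by apply: mulr_ge0; [exact: ltW|exact: speed_ge0].
- by apply: measurableX; exact: measurable_cball.
move=> [x v] [/= /cball_cube hx hv]; apply: (le_trans (cauchy_schwarz _ _)).
by apply: ler_pM => //=; rewrite ?enorm_ge0//; exact: hL.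
Qed.

Lemma smooth_lip r : exists2 L : R, 0 < L & forall mu nu a, inball mu r -> inball nu r ->
  (W1 mu nu <= a%:E)%E -> `|\int[mu]_x f x - \int[nu]_x f x| <= L * a.
Proof.
have [L L0 [hL _ _ _]] := smooth_bounds r sf.
exists L => // mu nu a hmu hnu hW; apply/ler_addgt0Pr => e e0.
have [T cT hT] := W1_witness hW (divr_gt0 e0 L0).
have [I1 <-] := integral_transfer measurable_fst cT.1 (smooth_integrable hmu).
have [I2 <-] := integral_transfer measurable_snd cT.2 (smooth_integrable hnu).
have mc := @measurable_cost R n.
apply: (Rintegral_dist_le (h := fun z => (L%:E * cost z)%E) (A := cball r `*` cball r) I1 I2).
- exact: measurable_funeM.
- by move=> z; rewrite mule_ge0 ?cost_ge0// lee_fin ltW.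
- by apply: measurableX; exact: measurable_cball.
- by apply: (coupling_null cT) => //; exact: measurable_cball.
- move=> [x y] [/= /cball_cube hx /cball_cube hy]; rewrite /cost -EFinM lee_fin; exact: hL.
rewrite ge0_integralZl//; [|by move=> z _; exact: cost_ge0|by rewrite lee_fin ltW].
apply: (@le_trans _ _ (L%:E * (a + e / L)%:E)%E).
  by apply: lee_wpmul2l => //; rewrite lee_fin ltW.
by rewrite -EFinM lee_fin mulrDr mulrCA divff ?gt_eqF// mulr1.
Qed.

(** The integrand changes through the position, at a price proportional to the speed bound, and
    through the velocity, at a price bounded by the gradient. The plan of [calW_witness] controls
    both. *)
Lemma Phi_lipschitz r : 0 <= r -> exists2 L : R, 0 < L & forall mu nu a, inball mu r -> inball nu r ->
  (W1 mu nu <= a%:E)%E -> `|Phi mu - Phi nu| <= L * a.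
Proof.
move=> r0; have [L L0 [_ hL hL2 _]] := smooth_bounds r sf.
have [K K0 hK] := calW_witness V1 Vlip r0.
have s0 := speed_ge0 C0 r0; set s := speed C r in s0.
exists (L * (s + K)); first by rewrite mulr_gt0// ltr_wpDl.
move=> mu nu a hmu hnu hW; apply/ler_addgt0Pr => e e0.
have [T [cT hT1 hT2]] := hK mu nu a (e / L) hmu hnu hW (divr_gt0 e0 L0).
have [I1 E1] := integral_transfer measurable_fst cT.1 (transport_integrable r0 hmu).
have [I2 E2] := integral_transfer measurable_snd cT.2 (transport_integrable r0 hnu).
rewrite /Phi -E1 -E2.
pose c1 (z : TE * TE) : \bar R := (enorm (z.1.1 - z.2.1))%:E.
pose c2 (z : TE * TE) : \bar R := (enorm (z.1.2 - z.2.2))%:E.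
have mf1 (i : TE * TE -> TE) (j : TE -> E) : measurable_fun setT i -> measurable_fun setT j -> measurable_fun setT (j \o i).
  by move=> mi mj; exact: measurableT_comp.
have mc1 : measurable_fun setT c1.
  apply/measurable_EFinP/measurable_enorm/measurable_mxB.
    by apply: (mf1 fst fst).
  by apply: (mf1 snd fst).
have mc2 : measurable_fun setT c2.
  apply/measurable_EFinP/measurable_enorm/measurable_mxB.
    by apply: (mf1 fst snd).
  by apply: (mf1 snd snd).
have c10 z : (0 <= c1 z)%E by rewrite lee_fin enorm_ge0.
have c20 z : (0 <= c2 z)%E by rewrite lee_fin enorm_ge0.
have Ls0 : 0 <= L * s by apply: mulr_ge0 => //; exact: ltW.
pose G : set TE := cball r `*` cball s.
have mG : measurable G by apply: measurableX; exact: measurable_cball.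
have mc1' : measurable_fun setT (fun z => (L * s)%:E * c1 z)%E by exact: measurable_funeM.
have mc2' : measurable_fun setT (fun z => L%:E * c2 z)%E by exact: measurable_funeM.
apply: (Rintegral_dist_le (h := fun z => ((L * s)%:E * c1 z + L%:E * c2 z)%E) (A := G `*` G) I1 I2).
- exact: emeasurable_funD.
- by move=> z; rewrite adde_ge0// mule_ge0// lee_fin// ltW.
- exact: measurableX.
- by apply: (coupling_null cT) => //; apply: V_concentrated.
- move=> [[x v] [y w]] [[/= /cball_cube hx hv] [/= /cball_cube hy hw]].
  rewrite /c1 /c2 -!EFinM -EFinD lee_fin /transport_term/=.
  have -> : dotp (grad f x) v - dotp (grad f y) w = dotp (grad f x - grad f y) v + dotp (grad f y) (v - w).
    by rewrite dotpBl dotpBr; ring.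
  apply: (le_trans (ler_normD _ _)); apply: lerD.
    apply: (le_trans (cauchy_schwarz _ _)); rewrite mulrAC.
    by apply: ler_pM; rewrite ?enorm_ge0//; exact: hL2.
  apply: (le_trans (cauchy_schwarz _ _)).
  by apply: ler_wpM2r; [exact: enorm_ge0|exact: hL].
rewrite ge0_integralD//; first last.
- by move=> z _; rewrite mule_ge0// lee_fin ltW.
- by move=> z _; rewrite mule_ge0// lee_fin.
rewrite !ge0_integralZl//; last by rewrite lee_fin ltW.
apply: (@le_trans _ _ ((L * s)%:E * a%:E + L%:E * (K * a + e / L)%:E)%E).
  apply: leeD; apply: lee_wpmul2l => //; by rewrite lee_fin// ltW.
rewrite -!EFinM -EFinD lee_fin.
have : L * (e / L) = e by rewrite mulrCA divff ?gt_eqF// mulr1.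
set q := e / L => hq; rewrite mulrDr hq.
rewrite [leRHS](_ : _ = L * s * a + (L * (K * a) + e))//; ring.
Qed.

(** Taylor expansion of [f] along the displacement [t *: rnd N v] leaves a remainder quadratic in
    [t]; replacing [rnd N v] by [v] costs another [t / N]. *)
Lemma generator r : 0 <= r -> exists2 c : R, 0 < c & forall N t mu, (0 < N)%N -> 0 <= t <= 1 ->
  inball mu r ->
  `|\int[euler V N t mu]_x f x - \int[mu]_x f x - t * Phi mu| <= c * (t ^+ 2 + t / N%:R).
Proof.
move=> r0.
have s0 := speed_ge0 C0 r0; set s := speed C r in s0.
(* Since [t <= 1] and a rounding error is at most [n], this radius also contains the advected
   points. *)
pose r' := r + (s + n%:R).
have [L L0 [_ hL _ hL2]] := smooth_bounds r' sf.
exists (L * (s + n%:R) ^+ 2 + L * n%:R + 1).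
  by rewrite ltr_wpDl// addr_ge0// mulr_ge0 ?(ltW L0)// sqr_ge0.
move=> N t mu N0 /andP[t0 t1] hmu.
have errn : err R n N <= n%:R by rewrite ler_pdivrMr ?ltr0n// ler_peMr// ler1n.
have e0 := err_ge0 R n N.
have he := euler_inball V1 C0 Vsub N0 t0 r0 hmu.
have [I1 E1] := integral_transfer (P := V mu) (Q := euler V N t mu) (measurable_adv N t) (fun A _ => erefl) (smooth_integrable he).
have [I2 E2] := integral_transfer (P := V mu) (Q := mu) measurable_fst (V1 mu) (smooth_integrable hmu).
have I3 := transport_integrable r0 hmu.
rewrite -E1 -E2 /Phi -RintegralB// -RintegralZl//.
have I12 : (V mu).-integrable setT (EFin \o (fun z => f (adv N t z) - f z.1)).
  rewrite (_ : _ \o _ = ((EFin \o (f \o adv N t)) \- (EFin \o (f \o fst)))%E); last exact/funext.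
  exact: integrableB.
have I3t : (V mu).-integrable setT (EFin \o (fun z => t * transport_term f z)).
  rewrite (_ : _ \o _ = (fun z => (t%:E * (EFin \o transport_term f) z)%E)); last exact/funext.
  exact: integrableZl.
have cc0 : 0 <= (L * (s + n%:R) ^+ 2 + L * n%:R + 1) * (t ^+ 2 + t / N%:R).
  apply: mulr_ge0; last by apply: addr_ge0; [exact: sqr_ge0|exact: divr_ge0].
  apply: addr_ge0 => //; apply: addr_ge0; apply: mulr_ge0 => //; try exact: ltW.
  exact: sqr_ge0.
apply: (Rintegral_dist_le (h := cst ((L * (s + n%:R) ^+ 2 + L * n%:R + 1) * (t ^+ 2 + t / N%:R))%:E) I12 I3t _ _ _ (V_concentrated V1 C0 Vsub r0 hmu)) => //.
- by apply: measurableX; exact: measurable_cball.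
- move=> [x v] [h1 h2]; rewrite /= in h1 h2; rewrite lee_fin /transport_term/=.
  have hd := enorm_adv (z := (x, v)) N0 t0 h1 h2; rewrite /= in hd.
  have hx : cube r' x.
    apply: cball_cube; move: h1; rewrite /cball/= => /le_trans; apply.
    by rewrite /r' lerDl addr_ge0.
  have ts : t * (speed C r + err R n N) <= s + n%:R.
    apply: (@le_trans _ _ (1 * (s + n%:R))); last by rewrite mul1r.
    by apply: ler_pM => //; [rewrite addr_ge0|rewrite lerD2l].
  have hy : cube r' (adv N t (x, v)).
    apply: cball_cube; rewrite /cball/= /r'.
    have := enormD (adv N t (x, v) - x) x; rewrite subrK; move: h1; rewrite /cball/=; lra.
  have hT := hL2 _ _ hx hy.
  have -> : f (adv N t (x, v)) - f x - t * dotp (grad f x) v =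
     (f (adv N t (x, v)) - f x - dotp (grad f x) (adv N t (x, v) - x)) + t * dotp (grad f x) (rnd N v - v).
    by rewrite /adv/= [x + _]addrC addrK dotpZr dotpBr; ring.
  apply: (le_trans (ler_normD _ _)).
  have hd2 : enorm (adv N t (x, v) - x) ^+ 2 <= t ^+ 2 * (s + n%:R) ^+ 2.
    rewrite -exprMn ler_sqr ?nnegrE ?enorm_ge0//; last by rewrite mulr_ge0// addr_ge0.
    by apply: (le_trans hd); rewrite ler_wpM2l// lerD2l.
  have hT2 : `|t * dotp (grad f x) (rnd N v - v)| <= t * (L * (n%:R / N%:R)).
    rewrite normrM ger0_norm// ler_wpM2l//.
    apply: (le_trans (cauchy_schwarz _ _)); apply: ler_pM; rewrite ?enorm_ge0//; first exact: hL.
    by rewrite enorm_distC; exact: rnd_err.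
  apply: (le_trans (lerD hT hT2)).
  have h3 := ler_wpM2l (ltW L0) hd2.
  apply: (le_trans (lerD h3 (lexx _))).
  have p1 : 0 <= t / N%:R by rewrite divr_ge0.
  set q := t / N%:R in p1 *.
  have -> : t * (L * (n%:R / N%:R)) = L * n%:R * q by rewrite /q; ring.
  have p2 := sqr_ge0 t.
  set A := L * (s + n%:R) ^+ 2; set B := L * n%:R.
  have A0 : 0 <= A by rewrite mulr_ge0 ?(ltW L0)// sqr_ge0.
  have B0 : 0 <= B by rewrite mulr_ge0 ?(ltW L0).
  have -> : L * (t ^+ 2 * (s + n%:R) ^+ 2) = A * t ^+ 2 by rewrite /A; ring.
  have h5 := mulr_ge0 A0 p1; have h6 := mulr_ge0 B0 p2.
  have -> : (A + B + 1) * (t ^+ 2 + q) = A * t ^+ 2 + B * q + (A * q + B * t ^+ 2 + t ^+ 2 + q) by ring.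
  by rewrite lerDl !addr_ge0.
by rewrite integral_prob_cst.
Qed.

End Generator.

(** * Lattice approximate solutions and their limit *)

Section Iterates.
Context (R : realType) (n : nat).
Notation E := 'rV[R]_n.
Notation TE := (E * E)%type.
Variables (V : probability E R -> probability TE R) (C T : R).
Hypotheses (V1 : PVF V) (C0 : 0 < C) (Vsub : support_sublinear C V)
  (Vlip : locally_calW_lipschitz V) (T0 : 0 < T).
Implicit Types mu nu : probability E R.

(* Bounds the support at time [t] when it starts in the ball of radius [r] and
   the rounding errors accumulate to [d]. *)
Definition reach (r t d : R) := expR (C * t) * (1 + r + d) - 1.

Lemma reach_mono r t t' d d' : 0 <= r -> 0 <= d -> t <= t' -> d <= d' -> reach r t d <= reach r t' d'.
Proof.
move=> r0 d0 tt dd; rewrite /reach lerD2r; apply: ler_pM.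
- exact: expR_ge0.
- by rewrite !addr_ge0.
- by rewrite ler_expR ler_wpM2l// ltW.
- by rewrite lerD2l.
Qed.

Lemma reach_ge r t d : 0 <= r -> 0 <= t -> 0 <= d -> r <= reach r t d.
Proof.
move=> r0 t0 d0; apply: (@le_trans _ _ (reach r 0 0)); last exact: reach_mono.
by rewrite /reach mulr0 expR0 mul1r addr0 addrC addrA addNr add0r.
Qed.

(** One step multiplies [1 + reach] by [1 + C * t], which is at most [expR (C * t)], and adds
    [t * e]. *)
Lemma reach_step r s t d e : 0 <= r -> 0 <= s -> 0 <= t -> 0 <= d -> 0 <= e ->
  reach r s d + t * (speed C (reach r s d) + e) <= reach r (s + t) (d + t * e).
Proof.
move=> r0 s0 t0 d0 e0; rewrite /reach /speed (mulrDr C s t) expRD.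
have a1 : 1 <= expR (C * s).
  by rewrite -[X in X <= _]expR0 ler_expR mulr_ge0// ltW.
have ct0 : 0 <= C * t by rewrite mulr_ge0// ltW.
have b1 := expR_ge1Dx (C * t).
set a := expR (C * s) in a1 *; set b := expR (C * t) in b1 *.
have te : 0 <= t * e by rewrite mulr_ge0.
have X0 : 0 <= 1 + r + d by rewrite !addr_ge0.
set X := 1 + r + d in X0 *.
have aX0 : 0 <= a * X by rewrite mulr_ge0//; lra.
have h1 := ler_wpM2l aX0 b1.
have ab1 : 1 <= a * b.
  by rewrite -[X in X <= _]mulr1; apply: ler_pM => //; lra.
have h2 := ler_wpM2r te ab1.
have -> : 1 + r + (d + t * e) = X + t * e by rewrite /X; ring.
have -> : a * b * (X + t * e) = a * X * b + a * b * (t * e) by ring.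
have -> : a * X - 1 + t * (C * (1 + (a * X - 1)) + e) = a * X * (1 + C * t) + 1 * (t * e) - 1 by ring.
by rewrite lerD2r; exact: lerD.
Qed.

(** Iteration without the initial rounding: [flowD] continues from an iterate, which must not be
    rounded again. *)
Definition eit N k mu := iter k (euler V N N%:R^-1) mu.

Lemma lasE N k mu : las V N k mu = eit N k (lattice N mu). Proof. by []. Qed.

Lemma eitD N k j mu : eit N (k + j) mu = eit N k (eit N j mu).
Proof. by rewrite /eit iterD. Qed.

Lemma eit_inball N k mu r : (0 < N)%N -> 0 <= r -> inball mu r ->
  inball (eit N k mu) (reach r (k%:R / N%:R) (k%:R / N%:R * err R n N)).
Proof.
move=> N0 r0 hmu; elim: k => [|k IH].
  by apply: (inball_le hmu); apply: reach_ge; rewrite ?mul0r.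
have q0 : 0 <= k%:R / N%:R :> R by rewrite divr_ge0.
have e0 := err_ge0 R n N; have i0 : 0 <= N%:R^-1 :> R by rewrite invr_ge0.
have d0 : 0 <= k%:R / N%:R * err R n N by rewrite mulr_ge0.
have h := euler_inball V1 C0 Vsub N0 i0 (le_trans r0 (reach_ge r0 q0 d0)) IH.
apply: (inball_le h).
have -> : k.+1%:R / N%:R = k%:R / N%:R + N%:R^-1 :> R by rewrite -natr1 mulrDl mul1r.
by rewrite mulrDl; exact: reach_step.
Qed.

Lemma err_le_n N : (0 < N)%N -> err R n N <= n%:R.
Proof. by move=> N0; rewrite ler_pdivrMr ?ltr0n// ler_peMr// ler1n. Qed.

Lemma err_sqr_le N : (0 < N)%N -> err R n (N ^ 2) <= err R n N.
Proof.
move=> N0; rewrite ler_wpM2l// lef_pV2 ?posrE ?ltr0n ?expn_gt0 ?N0// ler_nat.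
by rewrite expnS expn1 leq_pmulr.
Qed.

(** A radius valid for all [N] and all times up to [T]: [n] bounds the initial rounding, [T * n] the
    accumulated rounding of velocities, and [1] leaves the room that passing to limits consumes. *)
Definition Rmax r := reach (r + n%:R + 1) T (T * n%:R).

Lemma Rmax_gt0 r : 0 <= r -> r < Rmax r.
Proof.
move=> r0; apply: (@lt_le_trans _ _ (r + n%:R + 1)); last first.
  by apply: reach_ge; rewrite ?addr_ge0// ?mulr_ge0// ltW.
by rewrite -addrA ltrDl ltr_wpDl.
Qed.

Lemma eit_inball_max N k mu r : (0 < N)%N -> 0 <= r -> k%:R / N%:R <= T -> inball mu (r + n%:R + 1) ->
  inball (eit N k mu) (Rmax r).
Proof.
move=> N0 r0 kT hmu; have r1 : 0 <= r + n%:R + 1 by rewrite !addr_ge0.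
apply: (inball_le (eit_inball k N0 r1 hmu)); apply: reach_mono => //.
  by rewrite mulr_ge0 ?err_ge0// divr_ge0.
by apply: ler_pM => //; rewrite ?err_ge0 ?err_le_n// divr_ge0.
Qed.

Lemma lattice_inball_max N mu r : (0 < N)%N -> 0 <= r -> inball mu r ->
  inball (lattice N mu) (r + n%:R + 1).
Proof.
move=> N0 r0 hmu; apply: (inball_le (lattice_inball N0 hmu)).
have := err_sqr_le N0; have := err_le_n N0; lra.
Qed.

Lemma las_inball_max N k mu r : (0 < N)%N -> 0 <= r -> k%:R / N%:R <= T -> inball mu r ->
  inball (las V N k mu) (Rmax r).
Proof.
by move=> N0 r0 kT hmu; apply: eit_inball_max => //; exact: lattice_inball_max.
Qed.

(** The old bound grows by at most [expR (K * t)], and the new error [2 * t * e] only gains from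
    being multiplied by an exponential that is at least 1. *)
Lemma gronwall_step (K a s t e : R) : 0 <= K -> 0 <= a -> 0 <= s -> 0 <= t -> 0 <= e ->
  (1 + K * t) * (expR (K * s) * (a + 2 * s * e)) + 2 * t * e
  <= expR (K * (s + t)) * (a + 2 * (s + t) * e).
Proof.
move=> K0 a0 s0 t0 e0; rewrite (mulrDr K) expRD.
have a1 : 1 <= expR (K * s).
  by rewrite -[X in X <= _]expR0 ler_expR mulr_ge0.
have ct0 : 0 <= K * t by rewrite mulr_ge0.
have b1 := expR_ge1Dx (K * t).
set A := expR (K * s) in a1 *; set b := expR (K * t) in b1 *.
have te : 0 <= 2 * t * e by rewrite !mulr_ge0.
have X0 : 0 <= a + 2 * s * e by rewrite !addr_ge0// !mulr_ge0.
set X := a + 2 * s * e in X0 *.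
have aX0 : 0 <= A * X by rewrite mulr_ge0//; lra.
have h1 := ler_wpM2r aX0 b1.
have ab1 : 1 <= A * b.
  by rewrite -[X in X <= _]mulr1; apply: ler_pM => //; lra.
have h2 := ler_wpM2r te ab1; rewrite mul1r in h2.
have -> : a + 2 * (s + t) * e = X + 2 * t * e by rewrite /X; ring.
have -> : A * b * (X + 2 * t * e) = b * (A * X) + A * b * (2 * t * e) by ring.
exact: lerD.
Qed.

Lemma eit_stable r : 0 <= r -> exists2 K : R, 0 < K & forall N k mu nu a, (0 < N)%N ->
  k%:R / N%:R <= T -> inball mu (r + n%:R + 1) -> inball nu (r + n%:R + 1) ->
  (W1 mu nu <= a%:E)%E ->
  (W1 (eit N k mu) (eit N k nu) <=
   (expR (K * (k%:R / N%:R)) * (a + 2 * (k%:R / N%:R) * err R n N))%:E)%E.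
Proof.
move=> r0; have [K K0 hK] := euler_lipschitz V1 Vlip (le_trans r0 (ltW (Rmax_gt0 r0))).
exists K => // N k mu nu a N0 kT hmu hnu hW.
have a0 : 0 <= a by rewrite -lee_fin; apply: le_trans hW; exact: W1_ge0.
have i0 : 0 <= N%:R^-1 :> R by rewrite invr_ge0.
elim: k kT => [|k IH] kT; first by rewrite mul0r !mulr0 expR0 mul1r mul0r addr0.
have kS : k.+1%:R / N%:R = k%:R / N%:R + N%:R^-1 :> R by rewrite -natr1 mulrDl mul1r.
have kT' : k%:R / N%:R <= T by apply: le_trans kT; rewrite kS lerDl.
have h := hK N N%:R^-1 _ _ _ N0 i0 (eit_inball_max N0 r0 kT' hmu) (eit_inball_max N0 r0 kT' hnu) (IH kT').
apply: (le_trans h); rewrite lee_fin kS; apply: gronwall_step => //; first exact: ltW.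
  by rewrite divr_ge0.
Qed.

Lemma eit_speed r : 0 <= r -> exists2 c : R, 0 < c & forall N k j mu, (0 < N)%N ->
  (k + j)%:R / N%:R <= T -> inball mu (r + n%:R + 1) ->
  (W1 (eit N (k + j) mu) (eit N j mu) <= (k%:R / N%:R * c)%:E)%E.
Proof.
move=> r0; have R0 := le_trans r0 (ltW (Rmax_gt0 r0)).
exists (speed C (Rmax r) + n%:R).
  by rewrite ltr_pwDl// mulr_gt0// ltr_pwDl.
move=> N k j mu N0 kT hmu.
have i0 : 0 <= N%:R^-1 :> R by rewrite invr_ge0.
elim: k kT => [|k IH] kT; first by rewrite !mul0r (W1_refl (nu := eit N j mu)).
have kS m : m.+1%:R / N%:R = m%:R / N%:R + N%:R^-1 :> R by rewrite -natr1 mulrDl mul1r.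
have kT' : (k + j)%:R / N%:R <= T by apply: le_trans kT; rewrite addSn kS lerDl.
rewrite kS mulrDl addrC; apply: W1_triangle_le (IH kT').
have h := euler_speed V1 C0 Vsub N0 i0 R0 (eit_inball_max N0 r0 kT' hmu).
apply: (le_trans h); rewrite lee_fin ler_wpM2l// lerD2l; exact: err_le_n.
Qed.

End Iterates.

Section LimW1.
Context (R : realType) (n : nat) (U : set_system nat) {FU : ProperFilter U}.
Notation E := 'rV[R]_n.
Implicit Types (m : nat -> probability E R) (mu nu : probability E R).

Definition limW1 m nu := forall e : R, 0 < e -> \forall N \near U, (W1 (m N) nu <= e%:E)%E.

Lemma limW1_cst mu : limW1 (fun=> mu) mu.
Proof.
move=> e e0; apply: filterE => N.
by rewrite (W1_refl (nu := mu))// lee_fin ltW.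
Qed.

Lemma limW1_le m m' mu nu a : limW1 m mu -> limW1 m' nu ->
  (forall e : R, 0 < e -> \forall N \near U, (W1 (m N) (m' N) <= (a + e)%:E)%E) ->
  (W1 mu nu <= a%:E)%E.
Proof.
move=> h1 h2 h3; apply/lee_addgt0Pr => e e0.
have e3 : 0 < e / 3 by rewrite divr_gt0.
have [N [[H1 H2] H3]] := filter_ex (filterI (filterI (h1 _ e3) (h2 _ e3)) (h3 _ e3)).
rewrite W1_sym in H1.
apply: (le_trans (W1_triangle_le (W1_triangle_le H1 H3) H2)); rewrite -EFinD lee_fin; lra.
Qed.

Lemma limW1_inball m nu (r s : R) : limW1 m nu -> (\forall N \near U, inball (m N) r) ->
  r < s -> inball nu s.
Proof.
move=> h hr rs; have d0 : 0 < s - r by rewrite subr_gt0.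
apply/eqP; rewrite eq_le measure_ge0 andbT; apply/lee_addgt0Pr => e e0; rewrite add0e.
have [N [h1 h2]] := filter_ex (filterI (h (e * (s - r)) (mulr_gt0 e0 d0)) hr).
have := inball_lim h2 d0 h1; rewrite mulfK ?gt_eqF//.
by rewrite (_ : r + (s - r) = s)//; ring.
Qed.

End LimW1.

Section Tick.
Context (R : realType).
Implicit Types (t s : R).

Definition tick N t := Num.truncn (t * N%:R).

Lemma tick_le N t : (0 < N)%N -> 0 <= t -> (tick N t)%:R / N%:R <= t.
Proof.
move=> N0 t0; rewrite ler_pdivrMr ?ltr0n//.
have tN : 0 <= t * N%:R by rewrite mulr_ge0.
by have /andP[] := truncn_itv tN.
Qed.

Lemma tick_gt N t : (0 < N)%N -> 0 <= t -> t < (tick N t)%:R / N%:R + N%:R^-1.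
Proof.
move=> N0 t0; rewrite -[X in _ + X]mul1r -mulrDl ltr_pdivlMr ?ltr0n// natr1.
have tN : 0 <= t * N%:R by rewrite mulr_ge0.
by have /andP[] := truncn_itv tN.
Qed.

(** Counts of completed steps are additive up to one step, and one step moves measures by
    [O(1 / N)]. *)
Lemma tickD N t s : 0 <= t -> 0 <= s ->
  (tick N t + tick N s <= tick N (t + s) <= (tick N t + tick N s).+1)%N.
Proof.
move=> t0 s0.
have tN : 0 <= t * N%:R by rewrite mulr_ge0.
have sN : 0 <= s * N%:R by rewrite mulr_ge0.
have tsN : 0 <= (t + s) * N%:R by rewrite mulr_ge0// addr_ge0.
have /andP[a1 a2] := truncn_itv tN; have /andP[b1 b2] := truncn_itv sN.
have /andP[c1 c2] := truncn_itv tsN.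
rewrite /tick in a1 a2 b1 b2 c1 c2 *.
set a := Num.truncn (t * _) in a1 a2 *; set b := Num.truncn (s * _) in b1 b2 *.
set c := Num.truncn ((t + s) * _) in c1 c2 *.
rewrite mulrDl in c1 c2; apply/andP; split; rewrite -ltnS -(ltr_nat R).
  by apply: le_lt_trans c2; rewrite natrD; lra.
by apply: (le_lt_trans c1); move: a2 b2; rewrite -!natr1 natrD; lra.
Qed.

Lemma tick0 N : tick N (0 : R) = 0%N.
Proof. by rewrite /tick mul0r truncn0. Qed.

Lemma tick_mono N t s : 0 <= s -> s <= t -> (tick N s <= tick N t)%N.
Proof.
move=> s0 st; have h : 0 <= t - s by rewrite subr_ge0.
by have /andP[] := tickD N h s0; rewrite subrK => /(leq_trans (leq_addl _ _)).
Qed.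

End Tick.

(** * The limit flow and its semigroup property *)

Section Semigroup.
Context (R : realType) (n : nat).
Notation E := 'rV[R]_n.
Notation TE := (E * E)%type.
Variables (V : probability E R -> probability TE R) (C T : R).
Hypotheses (V1 : PVF V) (C0 : 0 < C) (Vsub : support_sublinear C V)
  (Vlip : locally_calW_lipschitz V) (T0 : 0 < T).
Variable U : set_system nat.
Hypotheses (UU : UltraFilter U) (Uoo : \oo `<=` U).
Implicit Types mu nu : probability E R.

Lemma near_small (c e : R) : 0 < e -> \forall N \near U, (0 < N)%N /\ c * N%:R^-1 <= e.
Proof.
move=> e0; apply: Uoo; have [M [M0 hM]] := exists_natdiv_le `|c| e0.
exists M => // N /= MN; have N0 := leq_trans M0 MN; split => //.
apply: le_trans hM; apply: (@le_trans _ _ (`|c| * N%:R^-1)).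
  by rewrite ler_wpM2r ?invr_ge0// ler_norm.
by rewrite ler_wpM2l// lef_pV2 ?posrE ?ltr0n// ler_nat.
Qed.

(* The same ultrafilter serves all data and times, so no subsequence has to be
   extracted before the semigroup property is proved. *)
Definition flow (t : R) mu : probability E R :=
  get [set nu | limW1 U (fun N => las V N (tick N t) mu) nu].

Lemma flow_lim r t mu : 0 <= r -> 0 <= t <= T -> inball mu r ->
  limW1 U (fun N => las V N (tick N t) mu) (flow t mu).
Proof.
move=> r0 /andP[t0 tT] hmu.
apply: (@getPex _ [set nu | limW1 U (fun N => las V N (tick N t) mu) nu]).
apply: (@ultra_limit R n U UU _ (Rmax n C T r)).
apply: filterS (near_small 0 ltr01) => N [N0 _].
apply: las_inball_max => //; exact: (le_trans (tick_le N0 t0)).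
Qed.

Lemma err_sqr_inv N : (0 < N)%N -> err R n (N ^ 2) <= n%:R * N%:R^-1.
Proof. by move=> N0; apply: (le_trans (err_sqr_le _ _ N0)). Qed.

Lemma flow_inball r t mu s : 0 <= r -> 0 <= t <= T -> inball mu r ->
  reach C r t 0 < s -> inball (flow t mu) s.
Proof.
move=> r0 tT hmu hs; have hl := flow_lim r0 tT hmu; move/andP: tT => [t0 tT].
(* Half of the room absorbs the rounding errors, the other half is lost in the limit of the
   supports. *)
have d0 : 0 < (s - reach C r t 0) / 2 by rewrite divr_gt0// subr_gt0.
apply: (limW1_inball hl (r := reach C r t 0 + (s - reach C r t 0) / 2)); last lra.
have := near_small (expR (C * t) * (n%:R + t * n%:R)) d0.
apply: filterS => N [N0 hN].
have q0 : 0 <= (tick N t)%:R / N%:R :> R by rewrite divr_ge0.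
have r1 : 0 <= r + err R n (N ^ 2) by rewrite addr_ge0// err_ge0.
apply: (inball_le (eit_inball V1 C0 Vsub (tick N t) N0 r1 (lattice_inball N0 hmu))).
apply: (@le_trans _ _ (reach C (r + err R n (N ^ 2)) t (t * err R n N))).
  apply: reach_mono => //; first by rewrite mulr_ge0// err_ge0.
    exact: tick_le.
  by rewrite ler_wpM2r ?err_ge0//; exact: tick_le.
apply: le_trans (lerD (lexx _) hN); rewrite /reach addr0.
set A := expR _; have A0 : 0 <= A by exact: expR_ge0.
have -> : A * (1 + r) - 1 + A * (n%:R + t * n%:R) * N%:R^-1 =
   A * (1 + (r + n%:R * N%:R^-1) + t * (n%:R * N%:R^-1)) - 1 by ring.
by rewrite lerD2r ler_wpM2l// lerD2r !lerD2l; exact: err_sqr_inv.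
Qed.

Lemma flow_inball_max r t mu : 0 <= r -> 0 <= t <= T -> inball mu r ->
  inball (flow t mu) (Rmax n C T r).
Proof.
move=> r0 tT hmu; apply: (flow_inball r0 tT hmu); move/andP: tT => [t0 tT].
apply: (@le_lt_trans _ _ (reach C (r + n%:R) T (T * n%:R))).
  apply: (@le_trans _ _ (reach C r T (T * n%:R))).
    by apply: reach_mono => //; rewrite mulr_ge0// ltW.
  by rewrite /reach lerD2r ler_wpM2l ?expR_ge0// lerD2r lerD2l lerDl.
by rewrite /Rmax /reach ltrD2r ltr_pM2l ?expR_gt0// ltrD2r ltrD2l ltrDl.
Qed.

Lemma lattice_W1 N mu nu a : (0 < N)%N -> (W1 mu nu <= a%:E)%E ->
  (W1 (lattice N mu) (lattice N nu) <= (a + 2 * n%:R * N%:R^-1)%:E)%E.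
Proof.
move=> N0 h; have h1 := lattice_close mu N0; have h2 := lattice_close nu N0.
rewrite W1_sym in h2; apply: (le_trans (W1_triangle_le (W1_triangle_le h1 h) h2)).
by rewrite lee_fin; have := err_sqr_inv N0; lra.
Qed.

Lemma flow_stable r : 0 <= r -> exists2 L : R, 0 < L & forall mu nu a t,
  inball mu r -> inball nu r -> 0 <= t <= T -> (W1 mu nu <= a%:E)%E ->
  (W1 (flow t mu) (flow t nu) <= (expR (L * t) * a)%:E)%E.
Proof.
move=> r0; have [K K0 hK] := eit_stable V1 C0 Vsub Vlip T0 r0; exists K => //.
move=> mu nu a t hmu hnu tT hW.
apply: (limW1_le (flow_lim r0 tT hmu) (flow_lim r0 tT hnu)) => e e0; move/andP: tT => [t0 tT].
have := near_small (expR (K * t) * (2 * n%:R + 2 * t * n%:R)) e0; apply: filterS => N [N0 hN].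
have hq := tick_le N0 t0; have qT := le_trans hq tT.
have q0 : 0 <= (tick N t)%:R / N%:R :> R by rewrite divr_ge0.
have a0 : 0 <= a by rewrite -lee_fin; apply: le_trans hW; exact: W1_ge0.
have := hK N (tick N t) _ _ _ N0 qT (lattice_inball_max N0 r0 hmu) (lattice_inball_max N0 r0 hnu) (lattice_W1 N0 hW).
move=> /le_trans; apply; rewrite lee_fin.
apply: le_trans (lerD (lexx _) hN).
rewrite -[X in _ <= _ + X]mulrA -[leRHS]mulrDr; apply: ler_pM; rewrite ?expR_ge0//.
- by rewrite !addr_ge0// !mulr_ge0 ?invr_ge0.
- by rewrite ler_expR ler_wpM2l// ltW.
have h3 : (tick N t)%:R / N%:R * err R n N <= t * err R n N by rewrite ler_wpM2r// err_ge0.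
have -> : a + (2 * n%:R + 2 * t * n%:R) / N%:R = a + 2 * n%:R * N%:R^-1 + 2 * (t * err R n N).
  by rewrite /err; ring.
by rewrite lerD2l -mulrA; lra.
Qed.

Lemma las_speed r : 0 <= r -> exists2 c : R, 0 < c & forall N k j mu, (0 < N)%N ->
  (k + j)%:R / N%:R <= T -> inball mu r ->
  (W1 (las V N (k + j) mu) (las V N j mu) <= (k%:R / N%:R * c)%:E)%E.
Proof.
move=> r0; have [c c0 hc] := eit_speed V1 C0 Vsub T0 r0; exists c => // N k j mu N0 kT hmu.
by rewrite !lasE; apply: hc => //; exact: lattice_inball_max.
Qed.

Lemma flow_speed r : 0 <= r -> exists2 L : R, 0 < L & forall mu t s,
  inball mu r -> 0 <= s -> s <= t -> t <= T ->
  (W1 (flow t mu) (flow s mu) <= (L * (t - s))%:E)%E.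
Proof.
move=> r0; have [c c0 hc] := las_speed r0; exists c => //.
move=> mu t s hmu s0 st tT; have t0 := le_trans s0 st.
have htT : 0 <= t <= T by rewrite t0.
have hsT : 0 <= s <= T by rewrite s0 (le_trans st).
apply: (limW1_le (flow_lim r0 htT hmu) (flow_lim r0 hsT hmu)) => e e0.
have := near_small c e0; apply: filterS => N [N0 hN].
have hle := tick_mono N s0 st.
have := hc N (tick N t - tick N s)%N (tick N s) mu N0; rewrite subnK//.
move=> /(_ (le_trans (tick_le N0 t0) tT) hmu) /le_trans; apply; rewrite lee_fin.
apply: le_trans (lerD (lexx _) hN); rewrite -mulrDr mulrC ler_wpM2l ?(ltW c0)//.
rewrite natrB// mulrBl; have := tick_le N0 t0; have := tick_gt N0 s0; lra.
Qed.

Lemma flow0 r mu : 0 <= r -> inball mu r -> meas_eq (flow 0 mu) mu.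
Proof.
move=> r0 hmu; apply: W1_eq0; apply/eqP; rewrite eq_le W1_ge0 andbT.
have tT : (0 : R) <= 0 <= T by rewrite lexx ltW.
apply: (limW1_le (flow_lim r0 tT hmu) (@limW1_cst R n U _ mu)) => e e0.
have := near_small n%:R e0; apply: filterS => N [N0 hN].
rewrite tick0 add0r; apply: (le_trans (lattice_close mu N0)).
by rewrite lee_fin; apply: le_trans hN; exact: err_sqr_inv.
Qed.

(** The approximation of [mu] after [tick N s] steps is close to [flow s mu], hence to the rounding
    of it from which the approximation of [flow t (flow s mu)] starts. Stability carries this
    closeness through [tick N t] further steps. *)
Lemma flowD r t s mu : 0 <= r -> inball mu r -> 0 <= t -> 0 <= s -> t + s <= T ->
  meas_eq (flow t (flow s mu)) (flow (t + s) mu).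
Proof.
move=> r0 hmu t0 s0 tsT; apply: W1_eq0; apply/eqP; rewrite eq_le W1_ge0 andbT.
have tT : 0 <= t <= T by rewrite t0 (le_trans _ tsT)// lerDl.
have sT : 0 <= s <= T by rewrite s0 (le_trans _ tsT)// lerDr.
have htsT : 0 <= t + s <= T by rewrite addr_ge0.
have hs := flow_inball_max r0 sT hmu.
have R0 : 0 <= Rmax n C T r by apply: (le_trans r0); apply/ltW/Rmax_gt0.
have [K K0 hK] := eit_stable V1 C0 Vsub Vlip T0 R0.
have [c c0 hc] := las_speed r0.
apply: (limW1_le (flow_lim R0 tT hs) (flow_lim r0 htsT hmu)) => e e0.
(* The three shares are for the distance to the limit at time [s], amplified by [A], for the
   rounding errors, and for the step that [tickD] may lose. *)
have e3 : 0 < e / 3 by rewrite divr_gt0.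
set A := expR (K * t); have A0 : 0 < A by exact: expR_gt0.
have hl := flow_lim r0 sT hmu (divr_gt0 e3 A0).
apply: filterS3 hl (near_small c e3) (near_small (A * (n%:R + 2 * t * n%:R)) e3) => N h1 [N0 h2] [_ h3].
have /andP[t1 t2] := tickD N t0 s0.
have ht := tick_le N0 t0; have hts := tick_le N0 (addr_ge0 t0 s0).
have q0 : 0 <= (tick N t)%:R / N%:R :> R by rewrite divr_ge0.
have kT : (tick N t + tick N s)%:R / N%:R <= T.
  by apply: (le_trans _ tsT); apply: le_trans hts; rewrite ler_wpM2r ?invr_ge0// ler_nat.
have sT' : (tick N s)%:R / N%:R <= T.
  by apply: le_trans kT; rewrite ler_wpM2r ?invr_ge0// ler_nat leq_addl.
have H1 : (W1 (las V N (tick N t + tick N s) mu) (las V N (tick N (t + s)) mu) <= (c * N%:R^-1)%:E)%E.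
  have := hc N (tick N (t + s) - (tick N t + tick N s))%N (tick N t + tick N s)%N mu N0.
  rewrite subnK// => /(_ (le_trans hts tsT) hmu); rewrite W1_sym => /le_trans; apply.
  rewrite lee_fin mulrC ler_wpM2l ?(ltW c0)// -[leRHS]mul1r ler_wpM2r ?invr_ge0//.
  by rewrite (ler_nat _ _ 1) leq_subLR addn1.
have hx : inball (lattice N (flow s mu)) (Rmax n C T r + n%:R + 1) by exact: lattice_inball_max.
have hy : inball (las V N (tick N s) mu) (Rmax n C T r + n%:R + 1).
  by apply: (inball_le (las_inball_max V1 C0 Vsub N0 r0 sT' hmu)); rewrite -addrA lerDl addr_ge0.
rewrite W1_sym in h1.
have H2 := W1_triangle_le (lattice_close (flow s mu) N0) h1.
have H3 := hK N (tick N t) _ _ _ N0 (le_trans ht (andP tT).2) hx hy H2.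
rewrite !lasE eitD -!lasE in H1.
apply: (le_trans (W1_triangle_le H3 H1)); rewrite lee_fin add0r.
have eA : e / 3 / A * A = e / 3 by rewrite divfK ?gt_eqF.
rewrite [leRHS](_ : _ = e / 3 / A * A + e / 3 + e / 3); last by rewrite eA; field.
set d := e / 3 / A.
apply: lerD => //.
apply: le_trans (lerD (lexx _) h3); rewrite [_ * A]mulrC -[X in _ <= _ + X]mulrA -[leRHS]mulrDr.
apply: ler_pM; rewrite ?expR_ge0//.
- apply: addr_ge0; last by rewrite mulr_ge0 ?err_ge0// mulr_ge0.
  by apply: addr_ge0; [exact: err_ge0|apply: divr_ge0; exact: ltW].
- by rewrite ler_expR ler_wpM2l// ltW.
have h4 : (tick N t)%:R / N%:R * err R n N <= t * err R n N by rewrite ler_wpM2r// err_ge0.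
have -> : (n%:R + 2 * t * n%:R) / N%:R = n%:R * N%:R^-1 + 2 * (t * err R n N).
  by rewrite /err; ring.
have := err_sqr_inv N0; rewrite -(mulrA 2); lra.
Qed.

End Semigroup.

Lemma is_derive_quadratic (R : realType) (g : R -> R) (t l c d : R) : 0 < d -> 0 < c ->
  (forall s, `|s - t| < d -> `|g s - g t - (s - t) * l| <= c * (s - t) ^+ 2) ->
  is_derive t 1 g l.
Proof.
move=> d0 c0 hg.
have hc : (fun h => h^-1 *: (g (h *: (1 : R) + t) - g t)) @ 0^' --> l.
  apply/cvgrPdist_le => e e0.
  have de0 : 0 < Num.min d (e / c) by rewrite lt_min d0 divr_gt0.
  near=> h.
  have h0 : h != 0 by near: h; exact: nbhs_dnbhs_neq.
  have hd : `|h| < Num.min d (e / c).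
    by near: h; apply: dnbhs0_lt.
  move: hd; rewrite lt_min => /andP[hd he].
  have := hg (h + t); rewrite addrK => /(_ hd) H.
  rewrite /GRing.scale/= mulr1 distrC.
  have -> : h^-1 * (g (h + t) - g t) - l = h^-1 * (g (h + t) - g t - h * l).
    by rewrite [RHS]mulrBr [in RHS]mulrA mulVf// mul1r.
  rewrite normrM normfV ler_pdivrMl ?normr_gt0//.
  apply: (le_trans H); rewrite -real_normK ?num_real// expr2 mulrCA ler_wpM2l//.
  by rewrite mulrC -ler_pdivlMr// ltW.
apply: DeriveDef; first by apply/cvg_ex; exists l.
exact: (cvg_lim (@Rhausdorff R) hc).
Unshelve. all: by end_near.
Qed.

Lemma lipschitz_abs_continuous (R : realType) (a b L : R) (g : R -> R) : 0 < L ->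
  (forall s t, a <= s -> s <= t -> t <= b -> `|g t - g s| <= L * (t - s)) ->
  abs_continuous a b g.
Proof.
move=> L0 hg e e0; exists (e / L); first exact: divr_gt0.
move=> m p q hpq _ hs; apply: (@le_lt_trans _ _ (\sum_(i < m) L * (q i - p i))).
  by apply: ler_sum => i _; have [/andP[h1 h2] h3] := hpq i; exact: hg.
by rewrite -mulr_sumr mulrC -ltr_pdivlMr.
Qed.

Lemma lipschitz_within_continuous (R : realType) (a b L : R) (g : R -> R) : 0 < L ->
  (forall s t, a <= s -> s <= t -> t <= b -> `|g t - g s| <= L * (t - s)) ->
  {within `[a, b], continuous (g : R -> R^o)}.
Proof.
move=> L0 hg; apply/subspace_continuousP => s; rewrite /= in_itv/= => /andP[s1 s2].
apply/cvgrPdist_le => e e0; rewrite near_withinE; near=> t.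
rewrite /= in_itv/= => /andP[t1 t2].
have hst : `|s - t| <= e / L.
  by near: t; apply: cvgr_dist_le => //; exact: divr_gt0.
rewrite ler_pdivlMr// mulrC in hst; apply: le_trans hst.
have [st|ts] := leP s t.
  by rewrite distrC (distrC s) (ger0_norm (x := t - s)) ?subr_ge0//; exact: hg.
rewrite [X in _ <= L * X]ger0_norm ?subr_ge0 ?(ltW ts)//; exact: (hg t s t1 (ltW ts) s2).
Unshelve. all: by end_near.
Qed.

Lemma meas_eq_Rintegral d (X : measurableType d) (R : realType) (mu nu : probability X R) (f : X -> R) :
  meas_eq mu nu -> \int[mu]_x f x = \int[nu]_x f x.
Proof.
by move=> h; rewrite /Rintegral; congr fine; apply: eq_measure_integral => A mA _; exact: h.
Qed.

(** The induction step of [las_generator] on numbers. [A], [B], [D] are the integrals of [f] after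
    [k + 1], [k] and no steps, [Q] and [P] the values of [Phi] at the [k]-th iterate and at [mu];
    [q = k / N], [h = 1 / N], and [e] is the initial rounding error. *)
Lemma telescope_step (R : realType) (c1 c2 L P Q A B D e q h m : R) :
  0 < c1 -> 0 < c2 -> 0 < L -> 0 <= m -> 0 <= q -> 0 <= h -> e <= m * h ->
  `|A - B - h * Q| <= c1 * (h ^+ 2 + h * h) -> `|Q - P| <= L * (q * c2 + e) ->
  `|B - D - q * P| <= q * ((2 * c1 + L * c2 + L * m) * q + (2 * c1 + L * c2 + L * m) * h) ->
  `|A - D - (q + h) * P| <=
    (q + h) * ((2 * c1 + L * c2 + L * m) * (q + h) + (2 * c1 + L * c2 + L * m) * h).
Proof.
move=> c10 c20 L0 m0 q0 h0 he h1 h2 IH.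
have hQP : `|h * (Q - P)| <= h * (L * (q * c2 + m * h)).
  rewrite normrM (ger0_norm h0) ler_wpM2l//; apply: (le_trans h2).
  by rewrite ler_wpM2l ?(ltW L0)// lerD2l.
have -> : A - D - (q + h) * P = (B - D - q * P) + ((A - B - h * Q) + h * (Q - P)) by ring.
apply: (le_trans (ler_normD _ _)).
apply: (le_trans (lerD IH (le_trans (ler_normD _ _) (lerD h1 hQP)))).
rewrite -subr_ge0; set c := _ + _ + _.
have -> : (q + h) * (c * (q + h) + c * h) - (q * (c * q + c * h) + (c1 * (h ^+ 2 + h * h) + h * (L * (q * c2 + m * h)))) =
  2 * (2 * (c1 * (q * h)) + L * m * (q * h)) + L * c2 * (q * h) + (2 * (c1 * (h * h)) + 2 * (L * c2 * (h * h)) + L * m * (h * h)).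
  by rewrite /c; ring.
have qh : 0 <= q * h by rewrite mulr_ge0.
have hh : 0 <= h * h by rewrite mulr_ge0.
have c1' := ltW c10; have c2' := ltW c20; have L' := ltW L0.
by rewrite !addr_ge0// !mulr_ge0// addr_ge0// !mulr_ge0.
Qed.

(** The arithmetic of [flow_generator]: [A], [B], [F], [G] are the integrals of [f] against the
    approximation, the rounded datum, the flow and [mu]; [i = 1 / N], and [q] is the time of the
    last completed step before [h]. *)
Lemma taylor_limit_step (R : realType) (A B F G P L c e h i m q : R) :
  0 <= c -> 0 <= q -> q <= h -> h < q + i -> 0 <= i -> (L * m + `|P| + h * c) * i <= e / 2 ->
  `|A - F| <= e / 2 -> `|B - G| <= L * (m * i) -> `|A - B - q * P| <= q * (c * q + c * i) ->
  `|F - G - h * P| <= c * h ^+ 2 + e.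
Proof.
move=> c0 q0 qh hq i0 H g1 g2 g3.
have h0 := le_trans q0 qh.
have b1 : q * (c * q + c * i) <= h * (c * h + c * i).
  by apply: ler_pM => //; rewrite ?addr_ge0 ?mulr_ge0// lerD2r ler_wpM2l.
have b2 : `|(q - h) * P| <= i * `|P|.
  by rewrite normrM ler_wpM2r// ler_norml; lra.
have -> : F - G - h * P = - (A - F) + (B - G) + (A - B - q * P) + (q - h) * P by ring.
apply: (le_trans (ler_normD _ _)); apply: (le_trans (lerD (ler_normD _ _) b2)).
apply: (le_trans (lerD (lerD (ler_normD _ _) g3) (lexx _))); rewrite normrN.
apply: (le_trans (lerD (lerD (lerD g1 g2) b1) (lexx _))).
have -> : c * h ^+ 2 + e = e / 2 + h * (c * h) + e / 2 by field.
apply: (le_trans _ (lerD (lexx _) H)).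
by rewrite le_eqVlt; apply/orP; left; apply/eqP; ring.
Qed.

(** * The flow solves the equation *)

Section Solution.
Context (R : realType) (n : nat).
Notation E := 'rV[R]_n.
Notation TE := (E * E)%type.
Variables (V : probability E R -> probability TE R) (C T : R).
Hypotheses (V1 : PVF V) (C0 : 0 < C) (Vsub : support_sublinear C V)
  (Vlip : locally_calW_lipschitz V) (T0 : 0 < T).
Variable U : set_system nat.
Hypotheses (UU : UltraFilter U) (Uoo : \oo `<=` U).
Implicit Types mu nu : probability E R.

Section TestFunction.
Variable f : E -> R.
Hypothesis sf : smooth f.

(** The local errors of [k] steps sum to [O(k / N ^ 2)]. Replacing [Phi] at an iterate by [Phi] at
    [mu] costs the distance travelled, which gives the term quadratic in [k / N]. *)
Lemma las_generator r : 0 <= r -> exists2 c : R, 0 < c & forall N k mu, (0 < N)%N ->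
  k%:R / N%:R <= T -> inball mu r ->
  `|\int[las V N k mu]_x f x - \int[lattice N mu]_x f x - k%:R / N%:R * Phi V f mu| <=
  k%:R / N%:R * (c * (k%:R / N%:R) + c * N%:R^-1).
Proof.
move=> r0; have R0 : 0 <= Rmax n C T r by apply: (le_trans r0); exact/ltW/Rmax_gt0.
have [c1 c10 h1] := generator V1 C0 Vsub sf R0.
have [L L0 h2] := Phi_lipschitz V1 C0 Vsub Vlip sf R0.
have [c2 c20 h3] := las_speed V1 C0 Vsub T0 r0.
exists (2 * c1 + L * c2 + L * n%:R).
  by rewrite ltr_pwDl// ?mulr_ge0 ?(ltW L0)// ltr_pwDl ?mulr_gt0// mulr_ge0 ?ltW.
move=> N k mu N0 kT hmu.
have i0 : 0 <= N%:R^-1 :> R by rewrite invr_ge0.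
have i1 : N%:R^-1 <= 1 :> R by rewrite invf_le1 ?ltr0n// ler1n.
have kS m : m.+1%:R / N%:R = m%:R / N%:R + N%:R^-1 :> R by rewrite -natr1 mulrDl mul1r.
have hmu' : inball mu (Rmax n C T r) by apply: (inball_le hmu); exact/ltW/Rmax_gt0.
elim: k kT => [|k IH] kT; first by rewrite !mul0r subr0 subrr normr0.
have kT' : k%:R / N%:R <= T by apply: le_trans kT; rewrite kS lerDl.
have hk := las_inball_max V1 C0 Vsub N0 r0 kT' hmu.
have {}IH := IH kT'.
have q0 : 0 <= k%:R / N%:R :> R by rewrite divr_ge0.
have {}h1 : `|\int[las V N k.+1 mu]_x f x - \int[las V N k mu]_x f x - N%:R^-1 * Phi V f (las V N k mu)| <= c1 * (N%:R^-1 ^+ 2 + N%:R^-1 / N%:R).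
  by apply: h1 => //; rewrite i0.
have hW : (W1 (las V N k mu) mu <= (k%:R / N%:R * c2 + err R n (N ^ 2))%:E)%E.
  have := h3 N k 0%N mu N0; rewrite addn0 => /(_ kT' hmu) /W1_triangle_le; apply.
  exact: lattice_close.
have {}h2 := h2 _ _ _ hk hmu' hW.
have he : err R n (N ^ 2) <= n%:R * N%:R^-1 by exact: err_sqr_inv.
by rewrite kS; exact: telescope_step he h1 h2 IH.
Qed.

Lemma flow_generator r : 0 <= r -> exists2 c : R, 0 < c & forall h mu, 0 <= h <= T ->
  inball mu r ->
  `|\int[flow V U h mu]_x f x - \int[mu]_x f x - h * Phi V f mu| <= c * h ^+ 2.
Proof.
move=> r0; have R0 : 0 <= Rmax n C T r by apply: (le_trans r0); exact/ltW/Rmax_gt0.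
have [c c0 h1] := las_generator r0.
have [L L0 h2] := smooth_lip sf (Rmax n C T r).
exists c => // h mu hT hmu; apply/ler_addgt0Pr => e e0.
have hl := flow_lim V1 C0 Vsub UU Uoo r0 hT hmu.
have hf := flow_inball_max V1 C0 Vsub T0 UU Uoo r0 hT hmu.
have hmu' : inball mu (Rmax n C T r) by apply: (inball_le hmu); exact/ltW/Rmax_gt0.
have [N [H1 [N0 H2]]] := filter_ex (filterI (hl (e / (2 * L)) (divr_gt0 e0 (mulr_gt0 (ltr0n _ 2) L0)))
   (near_small Uoo (L * n%:R + `|Phi V f mu| + h * c) (divr_gt0 e0 (ltr0n R 2)))).
move/andP: hT => [h0 hT].
have i0 : 0 <= N%:R^-1 :> R by rewrite invr_ge0.
have q1 := tick_le N0 h0; have q2 := tick_gt N0 h0; have qT := le_trans q1 hT.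
have q0 : 0 <= (tick N h)%:R / N%:R :> R by rewrite divr_ge0.
have hk := las_inball_max V1 C0 Vsub N0 r0 qT hmu.
have g1 := h2 _ _ _ hk hf H1.
have LL : L * (e / (2 * L)) = e / 2.
  by field; rewrite gt_eqF.
rewrite LL in g1.
have hla : inball (lattice N mu) (Rmax n C T r).
  by have := las_inball_max (k := 0) V1 C0 Vsub N0 r0; rewrite mul0r; apply => //; exact: ltW.
have g2 := h2 _ _ _ hla hmu' (lattice_close mu N0).
have {}g2 := le_trans g2 (ler_wpM2l (ltW L0) (err_sqr_inv R n N0)).
have g3 := h1 N (tick N h) mu N0 qT hmu.
exact: taylor_limit_step (ltW c0) q0 q1 q2 i0 H2 g1 g2 g3.
Qed.

(** For [s <= t] the semigroup property moves [flow_generator] to the base time [s]. For [t < s] it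
    expands from [t], and exchanging the base point costs [L * K * (t - s) ^ 2] because [Phi] is
    Lipschitz along the flow. *)
Lemma flow_taylor r : 0 <= r -> exists2 c : R, 0 < c & forall s t mu, 0 <= s <= T -> 0 <= t <= T ->
  inball mu r ->
  `|\int[flow V U t mu]_x f x - \int[flow V U s mu]_x f x - (t - s) * Phi V f (flow V U s mu)| <=
  c * (t - s) ^+ 2.
Proof.
move=> r0; have R0 : 0 <= Rmax n C T r by apply: (le_trans r0); exact/ltW/Rmax_gt0.
have [c c0 h1] := flow_generator R0.
have [L L0 h2] := Phi_lipschitz V1 C0 Vsub Vlip sf R0.
have [K K0 h3] := flow_speed V1 C0 Vsub T0 UU Uoo r0.
exists (c + L * K); first by rewrite addr_gt0// mulr_gt0.
move=> s t mu sT tT hmu.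
have hI a b : 0 <= a <= T -> 0 <= b <= T -> a <= b ->
    `|\int[flow V U b mu]_x f x - \int[flow V U a mu]_x f x - (b - a) * Phi V f (flow V U a mu)| <=
    c * (b - a) ^+ 2.
  move=> aT bT ab; have ha := flow_inball_max V1 C0 Vsub T0 UU Uoo r0 aT hmu.
  move/andP: aT => [a0 aT]; move/andP: bT => [b0 bT].
  have ba0 : 0 <= b - a by rewrite subr_ge0.
  have baT : 0 <= b - a <= T by rewrite ba0/=; lra.
  have <- : \int[flow V U (b - a) (flow V U a mu)]_x f x = \int[flow V U b mu]_x f x.
    apply: meas_eq_Rintegral; have := flowD V1 C0 Vsub Vlip T0 UU Uoo r0 hmu ba0 a0.
    by rewrite subrK; exact.
  exact: h1.
have p0 : 0 <= L * K * (t - s) ^+ 2 by apply: mulr_ge0 (sqr_ge0 _); apply: mulr_ge0; exact: ltW.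
rewrite [leRHS]mulrDl; have [st|/ltW ts] := leP s t.
  by apply: (le_trans (hI _ _ sT tT st)); rewrite lerDl.
have hs := flow_inball_max V1 C0 Vsub T0 UU Uoo r0 sT hmu.
have ht := flow_inball_max V1 C0 Vsub T0 UU Uoo r0 tT hmu.
have a1 := hI _ _ tT sT ts.
have a2 := h2 _ _ _ hs ht (h3 mu s t hmu (andP tT).1 ts (andP sT).2).
have st0 : 0 <= s - t by rewrite subr_ge0.
move: a1 a2; move: (Phi V f (flow V U s mu)) (Phi V f (flow V U t mu)) => P Q a1 a2.
have a3 : `|(s - t) * (P - Q)| <= (s - t) * (L * (K * (s - t))).
  by rewrite normrM (ger0_norm st0) ler_wpM2l.
move: a1; set A := Rintegral _ _ _; set B := Rintegral _ _ _ => a1.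
have -> : B - A - (t - s) * P = - (A - B - (s - t) * Q) + (s - t) * (P - Q) by ring.
apply: (le_trans (ler_normD _ _)); rewrite normrN; apply: (le_trans (lerD a1 a3)).
by rewrite le_eqVlt; apply/orP; left; apply/eqP; ring.
Qed.

Lemma flow_derive r mu t : 0 <= r -> inball mu r -> 0 < t < T ->
  is_derive t 1 (fun s => \int[flow V U s mu]_x f x) (Phi V f (flow V U t mu)).
Proof.
move=> r0 hmu /andP[t0 tT]; have [c c0 h] := flow_taylor r0.
have d0 : 0 < Num.min t (T - t) by rewrite lt_min t0 subr_gt0.
apply: (is_derive_quadratic d0 c0) => s; rewrite lt_min ltr_norml => /andP[/andP[a1 a2]].
rewrite ltr_norml => /andP[a3 a4].
by apply: h => //; apply/andP; split; lra.
Qed.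

Lemma flow_integral_lipschitz r : 0 <= r -> exists2 L : R, 0 < L & forall mu s t,
  inball mu r -> 0 <= s -> s <= t -> t <= T ->
  `|\int[flow V U t mu]_x f x - \int[flow V U s mu]_x f x| <= L * (t - s) /\
  `|Phi V f (flow V U t mu) - Phi V f (flow V U s mu)| <= L * (t - s).
Proof.
move=> r0; have R0 : 0 <= Rmax n C T r by apply: (le_trans r0); exact/ltW/Rmax_gt0.
have [L1 L10 h1] := smooth_lip sf (Rmax n C T r).
have [L2 L20 h2] := Phi_lipschitz V1 C0 Vsub Vlip sf R0.
have [K K0 h3] := flow_speed V1 C0 Vsub T0 UU Uoo r0.
exists ((L1 + L2) * K); first by rewrite mulr_gt0// addr_gt0.
move=> mu s t hmu s0 st tT.
have tTT : 0 <= t <= T by rewrite tT (le_trans s0).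
have sTT : 0 <= s <= T by rewrite s0 (le_trans st).
have hs := flow_inball_max V1 C0 Vsub T0 UU Uoo r0 sTT hmu.
have ht := flow_inball_max V1 C0 Vsub T0 UU Uoo r0 tTT hmu.
have hW := h3 mu t s hmu s0 st tT.
have kk : 0 <= K * (t - s) by rewrite mulr_ge0 ?(ltW K0)// subr_ge0.
rewrite -mulrA; split.
  by apply: (le_trans (h1 _ _ _ ht hs hW)); rewrite ler_wpM2r// lerDl ltW.
by apply: (le_trans (h2 _ _ _ ht hs hW)); rewrite ler_wpM2r// lerDr ltW.
Qed.

End TestFunction.

Lemma flow_solution r mu : 0 <= r -> inball mu r -> is_solution V T (fun t => flow V U t mu).
Proof.
move=> r0 hmu f [sf _]; have R0 : 0 <= Rmax n C T r by apply: (le_trans r0); exact/ltW/Rmax_gt0.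
have [L L0 hL] := flow_integral_lipschitz sf r0.
have hint s : s \in `[0, T] -> (V (flow V U s mu)).-integrable setT (EFin \o transport_term f).
  rewrite in_itv/= => sT; apply: (transport_integrable V1 C0 Vsub sf R0).
  exact: flow_inball_max.
split.
- by apply: aeW => s; exact: hint.
- have cP : {within `[0, T], continuous ((fun s => Phi V f (flow V U s mu)) : R -> R^o)}.
    by apply: (lipschitz_within_continuous L0) => s t s0 st tT; have [] := hL mu s t hmu s0 st tT.
  apply: eq_integrable (continuous_compact_integrable (@segment_compact _ _ _) cP) => //.
  move=> s; rewrite inE => sT /=; rewrite /Phi /Rintegral fineK//.
  by apply: integrable_fin_num => //; exact: hint.
- by apply: (lipschitz_abs_continuous L0) => s t s0 st tT; have [] := hL mu s t hmu s0 st tT.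
(* The flow is controlled on one side only of the end points, which form a null set. *)
exists ([set 0] `|` [set T]); split.
- by apply: measurableU; exact: measurable_set1.
- apply: countable_lebesgue_measure0; apply: finite_set_countable.
  by rewrite finite_setU; split; exact: finite_set1.
move=> t /= /not_implyP[tT nd]; apply: contrapT => /not_orP[t0 t1]; apply: nd.
apply: (flow_derive sf r0 hmu); move: tT; rewrite in_itv/= => /andP[a b].
by rewrite !lt_neqAle a b !andbT; apply/andP; split; apply/eqP => //; apply/nesym.
Qed.

End Solution.

(** * Grids and subsequences *)

Section Grid.
Context (R : realType) (n : nat).
Notation E := 'rV[R]_n.
Implicit Types x y : E.

Definition in_lattice (M : nat) : set E :=
  [set x | forall k, exists z : int, x ord0 k = z%:~R / M%:R].

Lemma in_lattice_rnd M x : in_lattice M (rnd M x).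
Proof. by move=> k; exists (Num.floor (x ord0 k * M%:R)); rewrite mxE. Qed.

Lemma grid_in_lattice M N x : in_lattice M x -> (forall k, `|x ord0 k| <= N%:R) -> grid M N x.
Proof. by move=> h1 h2 k. Qed.

(** The reason for the two mesh sizes: a time [1 / N] at a velocity in [Z^n / N] is a displacement
    in [Z^n / N^2]. *)
Lemma in_lattice_adv N x (v : E) : in_lattice (N ^ 2) x ->
  in_lattice (N ^ 2) (adv N N%:R^-1 (x, v)).
Proof.
move=> hx k; have [z hz] := hx k; exists (z + Num.floor (v ord0 k * N%:R)).
by rewrite !mxE hz intrD mulrDl; congr (_ + _); rewrite mulrCA -invfM -natrM.
Qed.

Lemma rnd_fiber M N x y : (0 < M)%N -> grid M N x -> (rnd M y = x) <-> cell x M%:R^-1 y.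
Proof.
move=> M0 gx; have Mp : 0 < M%:R :> R by rewrite ltr0n.
have hk k : (rnd M y ord0 k = x ord0 k) <-> (x ord0 k <= y ord0 k < x ord0 k + M%:R^-1).
  have [[z ->] _] := gx k; rewrite mxE -[X in _ < _ + X]mul1r -mulrDl.
  rewrite ler_pdivrMr// ltr_pdivlMr//.
  have -> : z%:~R + 1 = (z + 1)%:~R :> R by rewrite intrD.
  rewrite -floor_eq.
  by split => [/(mulIf (invr_neq0 (lt0r_neq0 Mp)))/intr_inj->|/eqP->].
split=> [e k|hc]; first by apply/hk; rewrite e.
by apply/rowP => k; apply/hk; exact: hc.
Qed.

Lemma finite_grid M N : (0 < M)%N -> finite_set (grid M N : set E).
Proof.
move=> M0; have Mp : 0 < M%:R :> R by rewrite ltr0n.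
(* Numerators range from [- (N * M)] to [N * M] and are shifted to start at 0. *)
pose g (f : {ffun 'I_n -> 'I_(2 * (N * M)).+1}) : E := \row_k (((f k)%:R - (N * M)%:R) / M%:R).
apply: (@sub_finite_set _ _ (g @` setT)); last exact/finite_image/finite_finset.
move=> x gx.
have hz k : exists i : 'I_(2 * (N * M)).+1, x ord0 k = (i%:R - (N * M)%:R) / M%:R.
  have [[z ->] hz] := gx k.
  have {}hz : `|z| <= (N * M)%N.
    move: hz; rewrite normrM normfV (ger0_norm (ltW Mp)) ler_pdivrMr// -natrM -intr_norm.
    by rewrite (ler_int R _ (N * M)%N).
  have lt : (`|(z + (N * M)%N)%R| < (2 * (N * M)).+1)%N by lia.
  exists (Ordinal lt) => /=; congr (_ / _).
  have h0 : (0 <= z + (N * M)%N)%R by lia.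
  by rewrite natr_absz (ger0_norm h0) intrD addrK.
exists [ffun k => xget ord0 [set i : 'I_(2 * (N * M)).+1 | x ord0 k = (i%:R - (N * M)%:R) / M%:R]] => //.
apply/rowP => k; rewrite !mxE ffunE; case: xgetP => [i _ <-//|/= h].
by have [i /h] := hz k.
Qed.

Lemma measurable_grid M N : (0 < M)%N -> measurable (grid M N : set E).
Proof.
move=> M0; rewrite (_ : grid M N = \bigcup_(x in grid M N) [set x]).
  by apply: fin_bigcup_measurable; [exact: finite_grid|move=> x _; exact: measurable_set1_mx].
by apply/seteqP; split => [x gx|x [y gy ->]//]; exists x.
Qed.

End Grid.

(** Serves both sums of a lattice approximation: [F i] is a cell for the initial datum, and a point
    times a velocity cell for a step. *)
Lemma finite_valued_law d (X : measurableType d) (R : realType) (I : choiceType)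
    (P : probability X R) (Y : X -> I) (D S : set I) (F : I -> set X) :
  finite_set D -> (forall i, D i -> measurable (F i)) ->
  (forall i x, D i -> Y x = i <-> F i x) ->
  measurable (Y @^-1` S) -> P (~` (Y @^-1` D)) = 0%E ->
  (P (Y @^-1` S) = \sum_(i \in D) P (F i) * (i \in S)%:R%:E)%E.
Proof.
move=> fD mF YF mS PD.
have mD : measurable (Y @^-1` D).
  rewrite (_ : Y @^-1` D = \bigcup_(i in D) F i); first exact: fin_bigcup_measurable.
  by apply/seteqP; split => [x Dx|x [i Di Fx]]; [exists (Y x) => //; apply/YF|rewrite /preimage/= ((YF _ _ Di).2 Fx)].
transitivity (P (\bigcup_(i in D `&` S) F i)).
  have -> : \bigcup_(i in D `&` S) F i = Y @^-1` S `&` Y @^-1` D.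
    apply/seteqP; split => [x [i [Di Si] Fx]|x [Sx Dx]].
      by rewrite /preimage/=; have -> := (YF _ _ Di).2 Fx.
    by exists (Y x) => //; apply/YF.
  apply/eqP; rewrite eq_le; apply/andP; split; last first.
    by apply: le_measure; rewrite ?inE//; exact: measurableI.
  rewrite -[leRHS]adde0 -PD.
  apply: le_trans (measureU2 _ _ _); last 2 first.
  - exact: measurableI.
  - exact: measurableC.
  apply: le_measure; rewrite ?inE//.
    by apply: measurableU; [exact: measurableI|exact: measurableC].
  by move=> x Sx; have [Dx|nDx] := pselect (D (Y x)); [left|right].
rewrite measure_fin_bigcup//; last 3 first.
- exact: finite_setIl.
- apply/trivIsetP => i j [Di _] [Dj _] ij; apply/seteqP; split => // x [Fi Fj]; case/eqP: ij.
  by rewrite -((YF _ _ Di).2 Fi) -((YF _ _ Dj).2 Fj).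
- by move=> i [Di _]; exact: mF.
rewrite fsbig_mkcondr; apply: eq_fsbigr => i _.
by case: (i \in S); rewrite ?mule1 ?mule0.
Qed.

(** * Euler iterates as sums over the grid *)

Section Las.
Context (R : realType) (n : nat).
Notation E := 'rV[R]_n.
Notation TE := (E * E)%type.
Variables (V : probability E R -> probability TE R) (C T : R).
Hypotheses (V1 : PVF V) (C0 : 0 < C) (Vsub : support_sublinear C V)
  (Vlip : locally_calW_lipschitz V) (T0 : 0 < T).
Implicit Types mu nu : probability E R.

Lemma lattice_grid N mu : (0 < N)%N -> inball (lattice N mu) N%:R ->
  lattice N mu (~` grid (N ^ 2) N) = 0%E.
Proof.
move=> N0; have N2 : (0 < N ^ 2)%N by rewrite expn_gt0 N0.
move=> h; have {}h : mu (rnd (N ^ 2) @^-1` (~` cball N%:R)) = 0%E by exact: h.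
rewrite lawE.
apply: (null_subset _ _ _ h).
- rewrite -[X in measurable X]setTI; apply: measurable_rnd => //.
  by apply: measurableC; exact: measurable_grid.
- rewrite -[X in measurable X]setTI; apply: measurable_rnd => //.
  by apply: measurableC; exact: measurable_cball.
apply: subsetC => x hx; apply: grid_in_lattice; first exact: in_lattice_rnd.
by move=> k; exact: (le_trans (enorm_coord _ _) hx).
Qed.

Lemma euler_grid N mu : (0 < N)%N -> mu (~` grid (N ^ 2) N) = 0%E ->
  inball (euler V N N%:R^-1 mu) N%:R -> euler V N N%:R^-1 mu (~` grid (N ^ 2) N) = 0%E.
Proof.
move=> N0 hg h; have N2 : (0 < N ^ 2)%N by rewrite expn_gt0 N0.
have {}h : V mu (adv N N%:R^-1 @^-1` (~` cball N%:R)) = 0%E by exact: h.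
rewrite lawE.
have m1 (A : set E) : measurable A -> measurable (adv N N%:R^-1 @^-1` A).
  by move=> mA; rewrite -[X in measurable X]setTI; exact: measurable_adv.
have m2 (A : set E) : measurable A -> measurable (fst @^-1` A : set TE).
  by move=> mA; rewrite -[X in measurable X]setTI; exact: measurable_fst.
have mG : measurable (~` grid (N ^ 2) N : set E) by apply: measurableC; exact: measurable_grid.
have mB : measurable (~` cball N%:R : set E) by apply: measurableC; exact: measurable_cball.
have z1 : V mu (fst @^-1` (~` grid (N ^ 2) N)) = 0%E by rewrite PVF_preimage.
apply: (null_subset (m1 _ mG) (measurableU _ _ (m2 _ mG) (m1 _ mB)) _ (null_union (m2 _ mG) (m1 _ mB) z1 h)).
move=> [x v] ng; apply: contrapT => /not_orP[/contrapT/= gx /contrapT hb]; apply: ng.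
apply: grid_in_lattice; last by move=> k; exact: (le_trans (enorm_coord _ _) hb).
by apply: in_lattice_adv => k; have [] := gx k.
Qed.

Lemma las_grid r N k mu : (0 < N)%N -> 0 <= r -> inball mu r -> k%:R / N%:R <= T ->
  Rmax n C T r <= N%:R -> las V N k mu (~` grid (N ^ 2) N) = 0%E.
Proof.
move=> N0 r0 hmu kT RN.
have hb j : j%:R / N%:R <= T -> inball (las V N j mu) N%:R.
  by move=> jT; apply: (inball_le (las_inball_max V1 C0 Vsub N0 r0 jT hmu)).
elim: k kT => [|k IH] kT; first by apply: lattice_grid => //; exact: (hb 0%N).
apply: euler_grid => //; last exact: (hb k.+1).
apply: IH; apply: le_trans kT; rewrite ler_wpM2r ?invr_ge0// ler_nat; exact: leqnSn.
Qed.

Lemma lattice_sum N mu : (0 < N)%N -> inball (lattice N mu) N%:R ->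
  meas_eq (lattice N mu) (fun A =>
    \sum_(x \in grid (N ^ 2) N) mu (cell x (N%:R ^- 2)) * \d_x A)%E.
Proof.
move=> N0 h A mA; have N2 : (0 < N ^ 2)%N by rewrite expn_gt0 N0.
rewrite lawE (finite_valued_law (P := mu) (D := grid (N ^ 2) N) (F := fun x => cell x (N%:R ^- 2))).
- by apply: eq_fsbigr => x _; rewrite diracE.
- exact: finite_grid.
- move=> x gx; rewrite -natrX.
  rewrite (_ : cell _ _ = rnd (N ^ 2) @^-1` [set x]).
    rewrite -[X in measurable X]setTI; apply: measurable_rnd => //; exact: measurable_set1_mx.
  by apply/seteqP; split => y /(rnd_fiber y N2 gx).
- by move=> x y gx; rewrite -natrX; exact: rnd_fiber.
- by rewrite -[X in measurable X]setTI; exact: measurable_rnd.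
by have := lattice_grid N0 h; rewrite lawE.
Qed.

Lemma euler0 N mu : meas_eq (euler V N 0 mu) mu.
Proof.
move=> A mA; rewrite lawE -(PVF_preimage V1 mu mA); congr (V mu _).
by apply/seteqP; split => z; rewrite /preimage/= /adv scale0r addr0.
Qed.

(** Up to a null set of [V mu] the position is a grid point and the rounded velocity has norm at
    most [speed C r + n], hence at most [N], so the double sum catches the whole mass. *)
Lemma euler_sum r N t mu : (0 < N)%N -> 0 <= r -> inball mu r -> speed C r + n%:R <= N%:R ->
  mu (~` grid (N ^ 2) N) = 0%E ->
  meas_eq (euler V N t mu) (fun A =>
    \sum_(x \in grid (N ^ 2) N) \sum_(v \in grid N N)
      V mu ([set x] `*` cell v N%:R^-1) * \d_(x + t *: v)%R A)%E.
Proof.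
move=> N0 r0 hmu sN hg A mA; have N2 : (0 < N ^ 2)%N by rewrite expn_gt0 N0.
rewrite pair_fsbig; [|exact: finite_grid..].
rewrite lawE.
have mfib v : grid N N v -> measurable (cell v N%:R^-1 : set E).
  move=> gv; rewrite (_ : cell _ _ = rnd N @^-1` [set v]).
    rewrite -[X in measurable X]setTI; apply: measurable_rnd => //; exact: measurable_set1_mx.
  by apply/seteqP; split => y /(rnd_fiber y N0 gv).
pose Y (z : TE) : TE := (z.1, rnd N z.2).
pose S : set TE := [set p | A (p.1 + t *: p.2)].
rewrite (_ : adv N t @^-1` A = Y @^-1` S)//.
rewrite (finite_valued_law (P := V mu) (D := grid (N ^ 2) N `*` grid N N)
  (F := fun p => [set p.1] `*` cell p.2 N%:R^-1)).
- by apply: eq_fsbigr => p _; rewrite diracE; congr (_ * _%:R%:E)%E; apply/idP/idP; rewrite !inE.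
- by apply: finite_setX; exact: finite_grid.
- by move=> [x v] [/= gx gv]; apply: measurableX; [exact: measurable_set1_mx|exact: mfib].
- move=> [x v] [y w] [/= gx gv]; rewrite /Y/=; split.
    by case=> -> h; split => //=; apply/(rnd_fiber w N0 gv).
  by case=> /= -> /(rnd_fiber w N0 gv) ->.
- rewrite (_ : Y @^-1` S = adv N t @^-1` A)//.
  by rewrite -[X in measurable X]setTI; exact: measurable_adv.
have mG : measurable (~` grid (N ^ 2) N : set E) by apply: measurableC; exact: measurable_grid.
have m1 : measurable (fst @^-1` (~` grid (N ^ 2) N) : set TE).
  by rewrite -[X in measurable X]setTI; exact: measurable_fst.
have m2 : measurable (~` (cball r `*` cball (speed C r)) : set TE).
  by apply: measurableC; apply: measurableX; exact: measurable_cball.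
have z1 : V mu (fst @^-1` (~` grid (N ^ 2) N)) = 0%E by rewrite PVF_preimage.
have sub : ~` (Y @^-1` (grid (N ^ 2) N `*` grid N N)) `<=`
    fst @^-1` (~` grid (N ^ 2) N) `|` ~` (cball r `*` cball (speed C r)).
  move=> [x v] ng; apply: contrapT => /not_orP[/contrapT/= gx /contrapT[/= _ hv]]; apply: ng.
  split => //=; apply: grid_in_lattice; first exact: in_lattice_rnd.
  move=> k; apply: (le_trans (enorm_coord _ _)); apply: (le_trans (enorm_rnd _ N0)).
  by apply: le_trans sN; apply: lerD => //; exact: err_le_n.
apply: (null_subset _ (measurableU _ _ m1 m2) sub (null_union m1 m2 z1 (V_concentrated V1 C0 Vsub r0 hmu))).
apply: measurableC; rewrite (_ : _ @^-1` _ = (fst @^-1` grid (N ^ 2) N) `&` (snd @^-1` (rnd N @^-1` grid N N)))//.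
apply: measurableI; rewrite -[X in measurable X]setTI.
  by apply: measurable_fst => //; exact: measurable_grid.
apply: (measurable_rnd N measurable_snd) => //; exact: measurable_grid.
Qed.

(* The case split makes [las_path N mu] agree with [las V N l mu] at [l / N] as
   an element of [probability E R]; [V] need not respect [meas_eq]. *)
Definition las_path N mu (t : R) : probability E R :=
  let l := tick N t in
  if t == l%:R / N%:R then las V N l mu else euler V N (t - l%:R / N%:R) (las V N l mu).

Lemma las_path_tick N mu l : (0 < N)%N -> las_path N mu (l%:R / N%:R) = las V N l mu.
Proof.
move=> N0; rewrite /las_path (_ : tick N _ = l) ?eqxx//.
by rewrite /tick divfK ?natrK// pnatr_eq0 -lt0n.
Qed.

Lemma las_path_is_LAS r N mu : (0 < N)%N -> 0 <= r -> inball mu r ->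
  Rmax n C T r <= N%:R -> speed C (Rmax n C T r) + n%:R <= N%:R ->
  is_LAS V T N mu (las_path N mu).
Proof.
move=> N0 r0 hmu RN sN; have R0 : 0 <= Rmax n C T r by apply: (le_trans r0); exact/ltW/Rmax_gt0.
have Np : 0 < N%:R :> R by rewrite ltr0n.
split => //.
  rewrite -[0](mul0r (N%:R^-1 : R)) (las_path_tick mu 0%N N0); apply: lattice_sum => //.
  apply: (inball_le _ RN); apply: (las_inball_max V1 C0 Vsub (k := 0) N0 r0 _ hmu).
  by rewrite mul0r ltW.
move=> l t /andP[t0 tN] ltT; rewrite las_path_tick//.
have lT : l%:R / N%:R <= T by apply: le_trans ltT; rewrite lerDl.
have hE := euler_sum t N0 R0 (las_inball_max V1 C0 Vsub N0 r0 lT hmu) sN (las_grid N0 r0 hmu lT RN).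
(* At a tick the path is the iterate itself, which is only [meas_eq] to an Euler step of length
   0. *)
have [->|tn0] := eqVneq t 0.
  rewrite addr0 las_path_tick// => A mA.
  rewrite -(euler0 N (las V N l mu) mA).
  exact: (euler_sum 0 N0 R0 (las_inball_max V1 C0 Vsub N0 r0 lT hmu) sN (las_grid N0 r0 hmu lT RN) mA).
(* The right end is the next tick; the next iterate unfolds to a full Euler step. *)
have [te|tne] := eqVneq t N%:R^-1.
  suff -> : las_path N mu (l%:R / N%:R + t) = euler V N t (las V N l mu) by [].
  by rewrite te -[X in _ + X]mul1r -mulrDl natr1 las_path_tick.
have tk : tick N (l%:R / N%:R + t) = l.
  apply: truncn_def; rewrite mulrDl divfK ?gt_eqF// lerDl mulr_ge0//= -natr1 ltrD2l.
  by rewrite -ltr_pdivlMr// mul1r lt_neqAle tne.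
by rewrite /las_path tk -subr_eq0 addrAC subrr add0r (negbTE tn0).
Qed.

Lemma las_path_dist r : 0 <= r -> exists2 c : R, 0 < c & forall N mu t, (0 < N)%N ->
  inball mu r -> 0 <= t <= T ->
  (W1 (las_path N mu t) (las V N (tick N t) mu) <= (c * N%:R^-1)%:E)%E.
Proof.
move=> r0; have R0 : 0 <= Rmax n C T r by apply: (le_trans r0); exact/ltW/Rmax_gt0.
have s0 := speed_ge0 C0 R0; have c0 : 0 < speed C (Rmax n C T r) + n%:R + 1 by rewrite ltr_wpDl// addr_ge0.
exists (speed C (Rmax n C T r) + n%:R + 1) => // N mu t N0 hmu /andP[t0 tT].
have i0 : 0 <= N%:R^-1 :> R by rewrite invr_ge0.
rewrite /las_path; case: eqP => _.
  by rewrite (W1_refl (nu := las V N (tick N t) mu))// lee_fin mulr_ge0// ltW.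
have h1 := tick_le N0 t0; have h2 := tick_gt N0 t0.
have d0 : 0 <= t - (tick N t)%:R / N%:R by rewrite subr_ge0.
apply: (le_trans (euler_speed V1 C0 Vsub N0 d0 R0 (las_inball_max V1 C0 Vsub N0 r0 (le_trans h1 tT) hmu))).
rewrite lee_fin [leRHS]mulrC; apply: ler_pM => //.
- by rewrite addr_ge0// err_ge0.
- by rewrite lerBlDl ltW.
by apply: (@le_trans _ _ (speed C (Rmax n C T r) + n%:R)); [rewrite lerD2l err_le_n|rewrite lerDl].
Qed.

End Las.

Lemma ultrafilter_subsequence (U : set_system nat) (FU : ProperFilter U) (P : nat -> nat -> Prop) :
  \oo `<=` U -> (forall i, \forall N \near U, P i N) ->
  exists2 s : nat -> nat, {homo s : i j / (i < j)%N} & forall i, P i (s i).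
Proof.
move=> Uoo hP.
have hg (p : nat * nat) : exists N, (p.2 <= N)%N /\ P p.1 N.
  have hge : \forall N \near U, (p.2 <= N)%N by apply: Uoo; exists p.2.
  by have [N [h1 h2]] := filter_ex (filterI hge (hP p.1)); exists N.
have [g hg'] := choice hg.
pose s := fix s i := if i is j.+1 then g (i, (s j).+1) else g (0%N, 0%N).
exists s; last by case=> [|i]; [exact: (hg' (0%N, 0%N)).2|exact: (hg' (i.+1, (s i).+1)).2].
by apply: homo_ltn; [exact: ltn_trans|move=> i; exact: (hg' (i.+1, (s i).+1)).1].
Qed.

(** * Uniform convergence of a subsequence *)

Section LasLimit.
Context (R : realType) (n : nat).
Notation E := 'rV[R]_n.
Notation TE := (E * E)%type.
Variables (V : probability E R -> probability TE R) (C T : R).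
Hypotheses (V1 : PVF V) (C0 : 0 < C) (Vsub : support_sublinear C V)
  (Vlip : locally_calW_lipschitz V) (T0 : 0 < T).
Variable U : set_system nat.
Hypotheses (UU : UltraFilter U) (Uoo : \oo `<=` U).
Implicit Types mu nu : probability E R.

(** Convergence at the finitely many times of a net holds on one set of the ultrafilter. Between
    these times both sides are Lipschitz with constants independent of [N], up to [c / N] for the
    approximations. *)
Lemma las_uniform r mu e : 0 <= r -> inball mu r -> 0 < e ->
  \forall N \near U, forall t, 0 <= t <= T ->
    (W1 (las V N (tick N t) mu) (flow V U t mu) <= e%:E)%E.
Proof.
move=> r0 hmu e0; have [c c0 hc] := las_speed V1 C0 Vsub T0 r0.
have [K K0 hK] := flow_speed V1 C0 Vsub T0 UU Uoo r0.
have e4 : 0 < e / 4 by rewrite divr_gt0.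
have [M [M0 hM]] := exists_natdiv_le ((c + K) * T) e4.
have Mp : 0 < M%:R :> R by rewrite ltr0n.
have h0 : 0 < T / M%:R by rewrite divr_gt0.
set h := T / M%:R in h0.
have hMT : M%:R * h = T by rewrite /h mulrC divfK ?gt_eqF.
have hi (i : 'I_M.+1) : 0 <= i%:R * h <= T.
  apply/andP; split; first by rewrite mulr_ge0// ltW.
  by rewrite -[leRHS]hMT ler_wpM2r ?(ltW h0)// ler_nat -ltnS.
have hnet : \forall N \near U, forall i : 'I_M.+1,
    (W1 (las V N (tick N (i%:R * h)) mu) (flow V U (i%:R * h) mu) <= (e / 4)%:E)%E.
  by apply: filter_forall => i; exact: (flow_lim V1 C0 Vsub UU Uoo r0 (hi i) hmu e4).
apply: filterS2 hnet (near_small Uoo c e4) => N H [N0 hN] t /andP[t0 tT].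
have th0 : 0 <= t / h by apply: divr_ge0 => //; exact: ltW.
have /andP[j1 j2] := truncn_itv th0.
set j := Num.truncn (t / h) in j1 j2.
rewrite ler_pdivlMr// in j1; rewrite ltr_pdivrMr// -natr1 mulrDl mul1r in j2.
(* [j = M] occurs at [t = T], hence the [M + 1] times of the net. *)
have jM : (j < M.+1)%N.
  rewrite ltnS -(ler_nat R) -(ler_pM2r h0) hMT; exact: le_trans tT.
have {}H := H (Ordinal jM); rewrite /= in H.
have s0 : 0 <= j%:R * h by rewrite mulr_ge0// ltW.
have A1 : (W1 (las V N (tick N t) mu) (las V N (tick N (j%:R * h)) mu) <= (c * h + e / 4)%:E)%E.
  have hle := tick_mono N s0 j1.
  have := hc N (tick N t - tick N (j%:R * h))%N (tick N (j%:R * h)) mu N0; rewrite subnK//.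
  move=> /(_ (le_trans (tick_le N0 t0) tT) hmu) /le_trans; apply; rewrite lee_fin.
  apply: le_trans (lerD (lexx _) hN); rewrite -mulrDr mulrC ler_wpM2l ?(ltW c0)//.
  have b1 := tick_le N0 t0; have b2 := tick_gt N0 s0.
  rewrite natrB// mulrBl; lra.
have A2 : (W1 (flow V U (j%:R * h) mu) (flow V U t mu) <= (K * h)%:E)%E.
  rewrite W1_sym; apply: (le_trans (hK mu t _ hmu s0 j1 tT)); rewrite lee_fin ler_wpM2l ?(ltW K0)//.
  by rewrite lerBlDl ltW.
apply: (le_trans (W1_triangle_le (W1_triangle_le A1 H) A2)); rewrite lee_fin.
have {}hM : c * h + K * h <= e / 4 by move: hM; rewrite -mulrA -/h mulrDl.
lra.
Qed.

Lemma flow_is_LAS_limit r mu : 0 <= r -> inball mu r ->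
  is_LAS_limit V T mu (fun t => flow V U t mu).
Proof.
move=> r0 hmu; have R0 : 0 <= Rmax n C T r by apply: (le_trans r0); exact/ltW/Rmax_gt0.
have [c c0 hc] := las_path_dist V1 C0 Vsub T0 r0.
have s0 := speed_ge0 C0 R0.
(* Beyond [B] the grids contain both the positions and the rounded velocities, as [las_path_is_LAS]
   requires. *)
pose B := Num.bound (Rmax n C T r + (speed C (Rmax n C T r) + n%:R)).
pose P i N := [/\ (0 < N)%N, (B <= N)%N & forall t, 0 <= t <= T ->
  (W1 (las_path V N mu t) (flow V U t mu) <= (i.+1%:R^-1)%:E)%E].
have hP i : \forall N \near U, P i N.
  have e0 : 0 < i.+1%:R^-1 / 2 :> R by rewrite divr_gt0.
  have hB : \forall N \near U, (B <= N)%N by apply: Uoo; exists B.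
  apply: filterS3 hB (near_small Uoo c e0) (las_uniform r0 hmu e0) => N BN [N0 hN] H.
  split => // t tT; have h1 := hc N mu t N0 hmu tT.
  apply: (le_trans (W1_triangle_le h1 (H t tT))); rewrite lee_fin.
  by move: hN; set a := i.+1%:R^-1; set b := c / _; lra.
have [s s_mono hs] := ultrafilter_subsequence _ Uoo hP.
exists s, (fun i => las_path V (s i) mu); split => //.
- move=> i; have [N0 BN _] := hs i.
  have bd : Rmax n C T r + (speed C (Rmax n C T r) + n%:R) <= (s i)%:R.
    apply: (@le_trans _ _ B%:R); last by rewrite ler_nat.
    by apply/ltW/archi_boundP; apply: addr_ge0 => //; exact: addr_ge0.
  have n0 : 0 <= n%:R :> R by [].
  by apply: (las_path_is_LAS V1 C0 Vsub T0 N0 r0 hmu); lra.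
move=> e e0; near=> i => t; rewrite in_itv/= => tT; have [_ _ h] := hs i.
apply: (le_trans (h t tT)); rewrite lee_fin ltW//.
by near: i; exact: near_infty_natSinv_lt (PosNum e0).
Unshelve. all: by end_near.
Qed.

End LasLimit.

Theorem theorem4p1 (R : realType) (n : nat)
    (V : probability 'rV[R]_n R -> probability ('rV[R]_n * 'rV[R]_n)%type R)
    (C T : R) :
  PVF V -> 0 < C -> support_sublinear C V -> locally_calW_lipschitz V ->
  0 < T ->
  exists S : R -> probability 'rV[R]_n R -> probability 'rV[R]_n R,
    lipschitz_semigroup V T C S /\
    forall mu0, compactly_supported mu0 ->
      is_LAS_limit V T mu0 (fun t => S t mu0).
Proof.
move=> V1 C0 Vsub Vlip T0.
have [U [UU Uoo]] := @ultraFilterLemma nat \oo _.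
exists (flow V U).
have cpt (mu : probability 'rV[R]_n R) : compactly_supported mu -> exists2 r, 0 <= r & inball mu r.
  move=> /compact_inball [r rgt0 hr]; exists r; first exact: ltW.
  by apply: supp_inball => x /hr /ltW.
split; last by move=> mu /cpt[r r0 hmu]; exact: (flow_is_LAS_limit V1 C0 Vsub T0 UU Uoo r0 hmu).
split.
- move=> t mu; rewrite in_itv/= => tT /cpt[r r0 hmu].
  exact: (inball_compact (flow_inball_max V1 C0 Vsub T0 UU Uoo r0 tT hmu)).
- move=> mu /cpt[r r0 hmu]; split; first exact: (flow0 V1 C0 Vsub T0 UU Uoo r0 hmu).
  move=> t s; rewrite !in_itv/= => /andP[t0 _] /andP[s0 _] ts.
  exact: (flowD V1 C0 Vsub Vlip T0 UU Uoo r0 hmu).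
- by move=> mu /cpt[r r0 hmu]; exact: (flow_solution V1 C0 Vsub Vlip T0 UU Uoo r0 hmu).
move=> r rgt0; have r0 := ltW rgt0.
have [L1 L10 h1] := flow_stable V1 C0 Vsub Vlip T0 UU Uoo r0.
have [L2 L20 h2] := flow_speed V1 C0 Vsub T0 UU Uoo r0.
exists (L1 + L2); first exact: addr_gt0.
move=> mu nu _ _ smu snu t s; rewrite !in_itv/= => tT sT.
have hmu : inball mu r by apply: supp_inball => x /smu /ltW.
have hnu : inball nu r by apply: supp_inball => x /snu /ltW.
split; last 2 first.
- have := W1_ge0 mu nu.
  (* [flow_stable] takes a real bound; for an infinite distance the claim is trivial. *)
  case hW : (W1 mu nu) => [a| |]// a0; last by rewrite gt0_muley ?leey// lte_fin expR_gt0.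
  apply: (le_trans (h1 mu nu a t hmu hnu tT _)); first by rewrite hW.
  rewrite lee_fin in a0; rewrite -EFinM lee_fin ler_wpM2r// ler_expR ler_wpM2r//.
    by case/andP: tT.
  by rewrite lerDl ltW.
- have hsp a b : 0 <= a -> a <= b -> b <= T ->
    (W1 (flow V U b mu) (flow V U a mu) <= ((L1 + L2) * `|b - a|)%:E)%E.
    move=> a0 ab bT; apply: (le_trans (h2 mu b a hmu a0 ab bT)).
    by rewrite lee_fin ger0_norm ?subr_ge0// ler_wpM2r ?subr_ge0// lerDr ltW.
  move/andP: tT => [t0 tT]; move/andP: sT => [s0 sT]; have [st|/ltW ts] := leP s t; first exact: hsp.
  by rewrite W1_sym distrC; exact: hsp.
(* [reach C r t 0] is smaller than the required radius by 1. Half of it gives the strict inequality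
   of [flow_inball], the other half puts the closed ball inside the open one. *)
have h : inball (flow V U t mu) (expR (C * t) * (r + 1) - 2^-1).
  apply: (flow_inball V1 C0 Vsub UU Uoo r0 tT hmu); rewrite /reach addr0 (addrC 1).
  by rewrite ltrD2l ltrN2 invf_lt1 ?ltr1n.
move=> x /(inball_supp h); rewrite /cball /eball/= => /le_lt_trans; apply.
by rewrite ltrBlDr ltrDl invr_gt0.
Qed.
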